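(* Let $\mathbf{X} = (X, \mathcal{X}, \mu, T)$ be an ergodic system, with $X$ infinite (i.e. $\mu$ non-atomic), whose entropy $h_\mu(T)$ is zero. Then $\mathbf{X}$ is not dominant; that is, there does not exist a dense $G_\delta$ subset $\mathcal{S}_0 \subset \mathcal{S}$ of the space $\mathcal{S}$ of Rokhlin cocycles over $\mathbf{X}$ such that for every $S \in \mathcal{S}_0$ the skew product $\hat{S}$ is isomorphic to $T$.
   Context: An ergodic system $\mathbf{X} = (X,\mathcal{X},\mu,T)$ is an ergodic invertible measure preserving transformation $T$ of a standard probability space. Let $I=[0,1]$ with Lebesgue measure $\lambda$ and Borel $\sigma$-algebra $\mathcal{C}$. For a standard probability space $(Z,\nu)$, $\mathrm{MPT}(Z,\nu)$ denotes the Polish group (weak topology) of invertible measure preserving transformations of $(Z,\nu)$, modulo equality almost everywhere. $\mathcal{S}$ denotes the set of Rokhlin cocycles over $\mathbf{X}$, i.e. measurable maps $x \mapsto S_x$ from $X$ to $\mathrm{MPT}(I,\lambda)$ (modulo equality $\mu$-a.e.). To $S \in \mathcal{S}$ one associates the skew product transformation $\hat{S}(x,u) = (Tx, S_x u)$ on $(X\times I, \mathcal{X}\otimes\mathcal{C}, \mu\times\lambda)$. Via $S \mapsto \hat S$, $\mathcal{S}$ is identified with a subset of $\mathrm{MPT}(X\times I,\mu\times\lambda)$ and it carries the Polish topology inherited from that group. Isomorphism means measure-theoretic isomorphism of measure preserving systems. *)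

(* Defs.v *)
From HB Require Import structures.
From mathcomp Require Import all_boot all_order all_algebra.
From mathcomp Require Import generic_quotient.
From mathcomp Require Import all_classical all_reals all_analysis.
From mathcomp Require Import borel_hierarchy.

Set Implicit Arguments.
Unset Strict Implicit.
Unset Printing Implicit Defensive.

Import Order.TTheory GRing.Theory Num.Theory.
Import numFieldNormedType.Exports.

Local Open Scope classical_set_scope.
Local Open Scope ring_scope.

(* A standard Borel space: its sigma-algebra is the Borel sigma-algebra of a
   Polish topology (transported along the bijection f). *)
Definition standard_borel (R : realType) d (X : measurableType d) : Prop :=
  exists (P : completePseudoMetricType R) (f : X -> P),
    [/\ hausdorff_space P, @second_countable P, bijective f &
        forall A : set X,
          measurable A <-> exists2 B : set P, <<s open >> B & A = f @^-1` B].

Section measure_preserving.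
Context {R : realType}.
Local Open Scope ereal_scope.

Definition mod0_isomorphism d1 d2 (Y : measurableType d1)
    (Z : measurableType d2) (nu : probability Y R) (rho : probability Z R)
    (phi : Y -> Z) : Prop :=
  [/\ measurable_fun setT phi,
      (forall A, measurable A -> nu (phi @^-1` A) = rho A) &
      exists psi : Z -> Y,
        [/\ measurable_fun setT psi,
            {ae nu, forall y, psi (phi y) = y} &
            {ae rho, forall z, phi (psi z) = z}]].

Definition invertible_mpt d (Z : measurableType d) (nu : probability Z R)
    (T : Z -> Z) : Prop :=
  mod0_isomorphism nu nu T.

Definition ergodic d (Z : measurableType d) (nu : probability Z R)
    (T : Z -> Z) : Prop :=
  forall A, measurable A -> T @^-1` A = A -> nu A = 0 \/ nu A = 1.

Definition isomorphic d1 d2 (Y : measurableType d1) (Z : measurableType d2)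
    (nu : probability Y R) (g : Y -> Y) (rho : probability Z R) (h : Z -> Z) :
    Prop :=
  exists2 phi : Y -> Z, mod0_isomorphism nu rho phi &
    {ae nu, forall y, phi (g y) = h (phi y)}.

Definition nonatomic d (Z : measurableType d) (nu : probability Z R) : Prop :=
  forall A, measurable A -> 0 < nu A ->
    exists B, [/\ measurable B, B `<=` A, 0 < nu B & nu B < nu A].

End measure_preserving.

Section entropy.
Context {R : realType} d (X : measurableType d) (mu : probability X R).
Variable T : X -> X.

(* A finite measurable partition is given by its labelling xi : X -> 'I_k. *)
Definition finite_partition k (xi : X -> 'I_k) : Prop :=
  forall j : 'I_k, measurable (xi @^-1` [set j]).

(* The cell, labelled by w, of the join of the T^-i xi for i < n. *)
Definition join_cell k (xi : X -> 'I_k) n (w : {ffun 'I_n -> 'I_k}) : set X :=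
  [set x | forall i : 'I_n, xi (iter i T x) = w i].

Definition join_entropy k (xi : X -> 'I_k) n : R :=
  - \sum_(w : {ffun 'I_n -> 'I_k})
      fine (mu (join_cell xi w)) * ln (fine (mu (join_cell xi w))).

(* The sequence converges by subadditivity, so the limsup is its limit. *)
Definition partition_entropy k (xi : X -> 'I_k) : \bar R :=
  limn_esup (fun n : nat => (join_entropy xi n / n%:R)%:E).

Definition entropy : \bar R :=
  ereal_sup [set h | exists k (xi : X -> 'I_k),
    finite_partition xi /\ h = partition_entropy xi].

End entropy.

Section MPT.
Context {R : realType} d (Z : measurableType d) (nu : probability Z R).

Record mpt := Mpt {
  mpt_fun :> Z -> Z ;
  mptP : invertible_mpt nu mpt_fun }.

HB.instance Definition _ := gen_eqMixin mpt.
HB.instance Definition _ := gen_choiceMixin mpt.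

Definition ae_eq_mpt (g h : mpt) : bool := `[< {ae nu, forall z, g z = h z} >].

Let ae_eq_mpt_refl : reflexive ae_eq_mpt.
Proof. by move=> g; apply/asboolP; exact: aeW. Qed.

Let ae_eq_mpt_sym : symmetric ae_eq_mpt.
Proof.
by move=> g h; apply/idP/idP => /asboolP gh; apply/asboolP;
   apply: filterS gh => z ->.
Qed.

Let ae_eq_mpt_trans : transitive ae_eq_mpt.
Proof.
move=> h g k /asboolP gh /asboolP hk; apply/asboolP.
by apply: filterS2 gh hk => z -> ->.
Qed.

Canonical ae_eq_mpt_equiv :=
  EquivRel ae_eq_mpt ae_eq_mpt_refl ae_eq_mpt_sym ae_eq_mpt_trans.

Local Open Scope quotient_scope.

Definition MPT : Type := {eq_quot ae_eq_mpt}.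
HB.instance Definition _ := Choice.on MPT.
HB.instance Definition _ := EqQuotient.on MPT.

Definition MPT_fun (g : MPT) : Z -> Z := mpt_fun (repr g).
Coercion MPT_fun : MPT >-> Funclass.

(* The weak topology is the coarsest one for which all the functions
   g |-> nu (g^-1 A (+) B), with A and B measurable, are continuous. Images
   g A in place of the preimages would define the same topology, since
   nu (g^-1 A (+) B) = nu (A (+) g B). *)
Definition weak_coordinates (g : MPT) :
    {ptws (set_type (@measurable _ Z) * set_type (@measurable _ Z))%type -> R} :=
  fun AB => fine (nu ((g @^-1` set_val AB.1) `+` set_val AB.2)).

HB.instance Definition _ :=
  Topological.copy MPT (initial_topology weak_coordinates).

End MPT.

Section unit_interval.
Variable R : realType.

Definition unit_itv : Type := set_type (`[0, 1]%classic : set R).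

HB.instance Definition _ := Choice.on unit_itv.

Definition unit_itv_val (u : unit_itv) : measurableTypeR R := set_val u.

Let unit_itv0 : unit_itv.
Proof. by exists 0; apply/mem_set; rewrite /= in_itv /= lexx ler01. Defined.

HB.instance Definition _ := isPointed.Build unit_itv unit_itv0.

(* The unit interval with its Borel (trace) sigma-algebra *)
Definition I01 := g_sigma_algebra_preimageType unit_itv_val.

HB.instance Definition _ := Measurable.on I01.

Definition lebesgue_I01 (A : set I01) : \bar R :=
  lebesgue_measure (unit_itv_val @` A).

Lemma image_unit_itv_val (B : set (measurableTypeR R)) :
  unit_itv_val @` (unit_itv_val @^-1` B) = B `&` `[0, 1].
Proof.
apply/seteqP; split => [_ [u Bu <-]|x [Bx x01]].
  by split => //; exact: set_mem (valP u).
by exists (SigSub (mem_set x01)).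
Qed.

Lemma measurable_image_unit_itv_val (A : set I01) :
  measurable A -> measurable (unit_itv_val @` A).
Proof.
move=> [B mB <-]; rewrite setTI image_unit_itv_val.
by apply: measurableI => //; exact: measurable_itv.
Qed.

Lemma unit_itv_val_inj : injective unit_itv_val.
Proof. exact: val_inj. Qed.

Let lebesgue_I01_0 : lebesgue_I01 set0 = 0%E.
Proof. by rewrite /lebesgue_I01 image_set0 measure0. Qed.

Let lebesgue_I01_ge0 A : (0 <= lebesgue_I01 A)%E.
Proof. exact: measure_ge0. Qed.

Let lebesgue_I01_sigma_additive : semi_sigma_additive lebesgue_I01.
Proof.
move=> F mF tF mUF; rewrite /lebesgue_I01 image_bigcup.
apply: measure_semi_sigma_additive.
- by move=> i; exact: measurable_image_unit_itv_val.
- apply/trivIsetP => i j _ _ ij; apply/seteqP; split => // x [[u Fu <-] [v Fv]].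
  move=> /unit_itv_val_inj vu.
  have /trivIsetP/(_ i j I I ij) := tF; rewrite -subset0; apply; split.
    exact: Fu.
  by rewrite -vu.
- by rewrite -image_bigcup; exact: measurable_image_unit_itv_val.
Qed.

HB.instance Definition _ := isMeasure.Build _ _ _ lebesgue_I01
  lebesgue_I01_0 lebesgue_I01_ge0 lebesgue_I01_sigma_additive.

Let lebesgue_I01_setT : lebesgue_I01 setT = 1%E.
Proof.
rewrite /lebesgue_I01 -[setT](@preimage_setT _ _ unit_itv_val).
rewrite image_unit_itv_val setTI lebesgue_measure_itv /= lte_fin ltr01.
by rewrite oppr0 adde0.
Qed.

HB.instance Definition _ :=
  Measure_isProbability.Build _ _ _ lebesgue_I01 lebesgue_I01_setT.

End unit_interval.

Section rokhlin_cocycles.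
Context {R : realType} d (X : measurableType d) (mu : probability X R).
Variable T : X -> X.

Local Notation lambda := (@lebesgue_I01 R).

(* Measurability with respect to the Borel sigma-algebra of the weak topology *)
Definition rokhlin_cocycle (S : X -> MPT lambda) : Prop :=
  forall U : set (MPT lambda), open U -> measurable (S @^-1` U).

(* F is the class of the skew product (x, u) |-> (T x, S_x u); as each S x is
   only defined up to null sets, so is the equation. Each Rokhlin cocycle S has
   exactly one skew product, which determines S up to null sets. *)
Definition is_skew_product (S : X -> MPT lambda)
    (F : MPT (mu \x lambda)%E) : Prop :=
  {ae mu, forall x, {ae lambda, forall u, F (x, u) = (T x, S x u)}}.

(* The space of Rokhlin cocycles modulo null sets, identified with the set of
   their skew products. *)
Definition skew_products : set (MPT (mu \x lambda)%E) :=
  [set F | exists2 S, rokhlin_cocycle S & is_skew_product S F].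

(* set_type A carries the subspace topology. *)
Definition dominant : Prop :=
  exists S0 : set (set_type skew_products),
    [/\ Gdelta S0, dense S0 &
        forall F : set_type skew_products, S0 F ->
          isomorphic (mu \x lambda)%E (set_val F : MPT (mu \x lambda)%E) mu T].

End rokhlin_cocycles.

(* Main.v *)
Require Import Defs.
From mathcomp Require Import all_boot all_order all_algebra.
From mathcomp Require Import generic_quotient.
From mathcomp Require Import all_classical all_reals all_analysis.
From mathcomp Require Import measurable_realfun ring lra.

(** A system isomorphic to T has few names, because T has zero entropy, while the
    names of a generic skew product are spread out.

    The name of a point y under F, up to time n, is the sequence of bits that tell
    whether F^i y lies in a fixed set A, for i < n. [near_word F A w n] is the
    Hamming ball of the points whose name differs from the word w in at most n / 8
    places. Here A is the lower half of X x [0, 1], the points (x, u) with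
    u < 1/2.

    Systems isomorphic to T have heavy balls. Let U be a sequence of sets that generates
    the sigma-algebra of X, and H_n the entropy of the join up to time n of the
    partition generated by the first m sets of U. An isomorphism carries the lower
    half to some subset A of X, which for a suitable m agrees with a union of cells
    of this partition up to measure 1/16. Most names of T with respect to A are
    then near the coded name of their cell, so some ball has measure at least
    exp (- 2 (H_n + 1)), for each n ([heavy_word]). Hence a skew product that lies
    in [complex_at] m for every m, meaning that at some time n all balls are
    lighter than this bound, is not isomorphic to T ([not_isomorphic]). The set A
    is unknown, but the bound only depends on T, m and n.

    Each complex_at m is open, because names up to a fixed time depend continuously
    on the skew product ([open_complex_at]).

    Each complex_at m is dense ([dense_complex_at]). Let F be a skew product with
    fibre maps f, and B a set of small measure that every orbit of T visits within
    L steps ([return_set]). Enlarge the fibre to I x (I x I): a current point u, a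
    reservoir r of random digits, and a stack. The current point moves by f, except
    that on each arrival in B it is replaced by a fresh point from the reservoir,
    and the old one is pushed on the stack, which keeps the map invertible
    ([refresh]). The segments of a name between visits are independent, and a
    Chernoff bound gives all balls measure at most exp (- n / (8 L))
    ([near_word_refreshed]). Since H_n = o(n), this is less than
    exp (- 2 (H_n + 1)) for large n. The isomorphisms [theta] p pack the enlarged
    fibre back into I and keep the first p digits of the current point. The lower
    half is not affected, and for large p the result is weakly close to F, as the
    map was changed over the small set B only.

    Finally, countably many dense open sets of skew products have a point in common
    ([skew_products_baire]). The weak topology is completely metrized by controlling
    a map together with its inverse, and a limit of skew products over T is again a
    skew product, because having first coordinate T characterizes them
    ([skew_products_of_fst]). If T were dominant, some skew product in all the sets
    complex_at m would be isomorphic to T. *)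

Set Implicit Arguments.
Unset Strict Implicit.
Unset Printing Implicit Defensive.

Import Order.TTheory GRing.Theory Num.Theory.
Import numFieldNormedType.Exports.

Local Open Scope classical_set_scope.
Local Open Scope ring_scope.

(** * Measure-preserving maps *)

Section measure_preserving_maps.
Context {R : realType}.
Local Open Scope ereal_scope.

Definition mpres d1 d2 (Y : measurableType d1) (Z : measurableType d2)
    (nu : probability Y R) (rho : probability Z R) (phi : Y -> Z) : Prop :=
  measurable_fun setT phi /\
  forall A, measurable A -> nu (phi @^-1` A) = rho A.

Lemma measurable_preimage d1 d2 (Y : measurableType d1) (Z : measurableType d2)
    (phi : Y -> Z) A :
  measurable_fun setT phi -> measurable A -> measurable (phi @^-1` A).
Proof. by move=> mphi mA; rewrite -[X in measurable X]setTI; exact: mphi. Qed.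

Lemma measurable_mem_preimage d1 d2 (Y : measurableType d1) (Z : measurableType d2)
    (phi : Y -> Z) A : measurable_fun setT phi -> measurable A ->
  measurable_fun setT (fun y => phi y \in A).
Proof.
move=> mphi mA; apply: (measurable_fun_bool true); rewrite setTI.
rewrite (_ : _ @^-1` _ = phi @^-1` A); first exact: measurable_preimage.
by apply/seteqP; split => y /=; [exact: set_mem|exact: mem_set].
Qed.

Lemma mpres_id d (Y : measurableType d) (nu : probability Y R) :
  mpres nu nu id.
Proof. by split. Qed.

Lemma mpres_comp d1 d2 d3 (Y : measurableType d1) (Z : measurableType d2)
    (W : measurableType d3) (nu : probability Y R) (rho : probability Z R)
    (tau : probability W R) (f : Y -> Z) (g : Z -> W) :
  mpres nu rho f -> mpres rho tau g -> mpres nu tau (g \o f).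
Proof.
move=> [mf fP] [mg gP]; split; first exact: measurableT_comp.
by move=> A mA; rewrite comp_preimage fP ?gP//; exact: measurable_preimage.
Qed.

Lemma mpres_iter d (Y : measurableType d) (nu : probability Y R) (f : Y -> Y) n :
  mpres nu nu f -> mpres nu nu (iter n f).
Proof.
move=> mf; elim: n => [|n IH]; first exact: mpres_id.
exact: (mpres_comp IH mf).
Qed.

(** By the pi-lambda theorem, a generating pi-system suffices. *)
Lemma mpres_gen d1 d2 (Y : measurableType d1) (Z : measurableType d2)
    (nu : probability Y R) (rho : probability Z R) (phi : Y -> Z)
    (G : set (set Z)) :
  @measurable _ Z = <<s G >> -> setI_closed G -> measurable_fun setT phi ->
  (forall A, G A -> nu (phi @^-1` A) = rho A) -> mpres nu rho phi.
Proof.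
move=> mG GI mphi phiG; split => // A mA.
have : <<s G >> A by rewrite -mG.
move: A {mA}; apply: (dynkin_induction mG GI).
- by rewrite preimage_setT !probability_setT.
- exact: phiG.
- move=> S mS phiS; rewrite preimage_setC !probability_setC//.
  by rewrite phiS.
  exact: measurable_preimage.
- move=> F mF tF phiF; rewrite preimage_bigcup !measure_bigcup//.
  + by apply: eq_eseriesr => i _; exact: phiF.
  + by move=> i _; exact: measurable_preimage.
  + apply/trivIsetP => i j _ _ ij.
    rewrite -preimage_setI; have /trivIsetP/(_ i j Logic.I Logic.I ij) -> := tF.
    exact: preimage_set0.
Qed.

Lemma mpres_negligible d1 d2 (Y : measurableType d1) (Z : measurableType d2)
    (nu : probability Y R) (rho : probability Z R) (phi : Y -> Z) N :
  mpres nu rho phi -> rho.-negligible N -> nu.-negligible (phi @^-1` N).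
Proof.
move=> [mphi phiP] [A [mA A0 NA]]; exists (phi @^-1` A); split.
- exact: measurable_preimage.
- by rewrite phiP.
- exact: preimage_subset.
Qed.

Lemma mpres_ae d1 d2 (Y : measurableType d1) (Z : measurableType d2)
    (nu : probability Y R) (rho : probability Z R) (phi : Y -> Z)
    (P : Z -> Prop) :
  mpres nu rho phi -> {ae rho, forall z, P z} -> {ae nu, forall y, P (phi y)}.
Proof. by move=> mphi; exact: mpres_negligible. Qed.

Lemma ae_eq_measure d (Y : measurableType d) (nu : probability Y R) (A B : set Y) :
  measurable A -> measurable B -> {ae nu, forall y, A y <-> B y} ->
  nu A = nu B.
Proof.
move=> mA mB [N [mN N0 NAB]].
have le A' B' : measurable A' -> measurable B' -> A' `<=` B' `|` N ->
    nu A' <= nu B'.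
  move=> mA' mB' A'B'; rewrite -[leRHS]adde0 -N0.
  apply: (le_trans _ (measureU2 _ mB' mN)).
  by rewrite le_measure// ?inE//; exact: measurableU.
apply/eqP; rewrite eq_le !le// => y h; have [|/NAB] := pselect (A y <-> B y);
  by [left; tauto|right].
Qed.

Lemma mpres_ae_eq d1 d2 (Y : measurableType d1) (Z : measurableType d2)
    (nu : probability Y R) (rho : probability Z R) (phi phi' : Y -> Z) :
  mpres nu rho phi -> measurable_fun setT phi' ->
  {ae nu, forall y, phi y = phi' y} -> mpres nu rho phi'.
Proof.
move=> [mphi phiP] mphi' e; split => // A mA; rewrite -phiP//.
apply: ae_eq_measure; [exact: measurable_preimage..|].
by apply: filterS e => y /= ->.
Qed.

(** What makes the coincidence set of two measurable maps into Z measurable. *)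
Definition countably_separated d (Z : measurableType d) : Prop :=
  exists2 U : nat -> set Z, (forall i, measurable (U i)) &
    forall x y, (forall i, U i x <-> U i y) -> x = y.

Lemma measurable_eq_fun d1 d2 (Y : measurableType d1) (Z : measurableType d2)
    (f g : Y -> Z) : countably_separated Z ->
  measurable_fun setT f -> measurable_fun setT g ->
  measurable [set y | f y = g y].
Proof.
move=> [U mU sepU] mf mg.
rewrite (_ : [set _ | _] = \bigcap_i ~` ((f @^-1` U i) `+` (g @^-1` U i))).
  apply: bigcapT_measurable => i; apply: measurableC.
  by apply: measurableU; apply: measurableD; exact: measurable_preimage.
apply/seteqP; split => [y /= fg i _|y fg] /=; first by rewrite fg; tauto.
apply: sepU => i; have /= := fg i Logic.I.
by have [] := pselect (U i (f y)); have [] := pselect (U i (g y)); tauto.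
Qed.

Lemma countably_separated_prod d1 d2 (Y : measurableType d1)
    (Z : measurableType d2) :
  countably_separated Y -> countably_separated Z ->
  countably_separated (Y * Z)%type.
Proof.
move=> [U mU sU] [V mV sV].
exists (fun i => if odd i then fst @^-1` U i./2 else snd @^-1` V i./2).
  by move=> i; case: ifP => _; apply: measurable_preimage.
move=> [x1 x2] [y1 y2] h; congr pair.
  by apply: sU => i; have := h i.*2.+1; rewrite /= odd_double/= uphalf_double.
by apply: sV => i; have := h i.*2; rewrite /= odd_double/= doubleK.
Qed.

Lemma mod0_mpres d1 d2 (Y : measurableType d1) (Z : measurableType d2)
    (nu : probability Y R) (rho : probability Z R) (phi : Y -> Z) :
  mod0_isomorphism nu rho phi -> mpres nu rho phi.
Proof. by case. Qed.

(** The inverse of a mod0_isomorphism, made explicit so that inverses of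
    composites and products can be written down. *)
Definition mod0_inverse d1 d2 (Y : measurableType d1) (Z : measurableType d2)
    (nu : probability Y R) (rho : probability Z R) (phi : Y -> Z) (psi : Z -> Y) :=
  [/\ mpres nu rho phi, mpres rho nu psi,
      {ae nu, forall y, psi (phi y) = y} &
      {ae rho, forall z, phi (psi z) = z}].

Lemma mod0_inverseP d1 d2 (Y : measurableType d1) (Z : measurableType d2)
    (nu : probability Y R) (rho : probability Z R) (phi : Y -> Z) :
  mod0_isomorphism nu rho phi <-> exists psi, mod0_inverse nu rho phi psi.
Proof.
split=> [[mphi phiP [psi [mpsi h1 h2]]]|[psi [[mphi phiP] [mpsi psiP] h1 h2]]].
  exists psi; split => //; split => // A mA.
  rewrite -phiP; last exact: measurable_preimage.
  rewrite -comp_preimage; apply: ae_eq_measure => //.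
    by apply: measurable_preimage => //; exact: measurableT_comp.
  by apply: filterS h1 => y /= ->.
by split => //; exists psi; split.
Qed.

Lemma mod0_inverse_sym d1 d2 (Y : measurableType d1) (Z : measurableType d2)
    (nu : probability Y R) (rho : probability Z R) (phi : Y -> Z) psi :
  mod0_inverse nu rho phi psi -> mod0_inverse rho nu psi phi.
Proof. by case. Qed.

Lemma mod0_inverse_comp d1 d2 d3 (Y : measurableType d1) (Z : measurableType d2)
    (W : measurableType d3) (nu : probability Y R) (rho : probability Z R)
    (tau : probability W R) f f' g g' :
  mod0_inverse nu rho f f' -> mod0_inverse rho tau g g' ->
  mod0_inverse nu tau (g \o f) (f' \o g').
Proof.
move=> [f1 f2 f3 f4] [g1 g2 g3 g4]; split.
- exact: mpres_comp g1.
- exact: mpres_comp f2.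
- have := mpres_ae f1 g3.
  by apply: filterS2 f3 => y /= h ->.
- have := mpres_ae g2 f4.
  by apply: filterS2 g4 => y /= h ->.
Qed.

(** phi maps the conull set where psi (phi y) = y into the set where
    phi (psi z) = z, which is therefore conull. *)
Lemma mod0_inverse_left d1 d2 (Y : measurableType d1) (Z : measurableType d2)
    (nu : probability Y R) (rho : probability Z R) (phi : Y -> Z) psi :
  countably_separated Z -> mpres nu rho phi -> measurable_fun setT psi ->
  {ae nu, forall y, psi (phi y) = y} -> mod0_inverse nu rho phi psi.
Proof.
move=> sZ [mphi phiP] mpsi h.
have mE : measurable [set z | phi (psi z) = z].
  by apply: measurable_eq_fun => //; exact: measurableT_comp.
have phipsi : {ae rho, forall z, phi (psi z) = z}.
  apply/negligibleP; first exact: measurableC.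
  apply: etrans (esym (phiP _ (measurableC mE))) _.
  apply: measure_negligible; first by apply: measurable_preimage; [|exact: measurableC].
  by apply: negligibleS h => y /= h1 h2; apply: h1; rewrite h2.
split=> //; split => // A mA; rewrite -phiP; last exact: measurable_preimage.
rewrite -comp_preimage; apply: ae_eq_measure => //.
  by apply: measurable_preimage => //; exact: measurableT_comp.
by apply: filterS h => y /= ->.
Qed.

End measure_preserving_maps.

Lemma mpres_preimage (R : realType) d1 d2 (Y : measurableType d1) (Z : measurableType d2)
    (nu : probability Y R) (rho : probability Z R) (phi : Y -> Z) :
  mpres nu rho phi -> forall A, measurable A -> measurable (phi @^-1` A).
Proof. by move=> [mphi _] A; exact: measurable_preimage. Qed.

Lemma ae_imply (R : realType) d (Y : measurableType d) (nu : probability Y R)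
    (P Q : Y -> Prop) : (forall y, P y -> Q y) ->
  {ae nu, forall y, P y} -> {ae nu, forall y, Q y}.
Proof. by move=> PQ; apply: filterS. Qed.

Lemma ae_always (R : realType) d (Y : measurableType d) (nu : probability Y R)
    (P : Y -> Prop) : (forall y, P y) -> {ae nu, forall y, P y}.
Proof. exact: aeW. Qed.

Lemma mod0_inverse_id (R : realType) d (Y : measurableType d)
  (nu : probability Y R) : mod0_inverse nu nu id id.
Proof. by split; [exact: mpres_id|exact: mpres_id|exact: aeW|exact: aeW]. Qed.

(** * Products of measure-preserving maps *)

Section products.
Context {R : realType}.
Local Open Scope ereal_scope.
Context d1 d2 d3 d4 (Y : measurableType d1) (Z : measurableType d2)
  (W : measurableType d3) (V : measurableType d4).

Lemma mpres_rect (nu : probability Y R) (rho : probability Z R)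
    (tau : probability W R) (phi : W -> Y * Z) :
  measurable_fun setT phi ->
  (forall A B, measurable A -> measurable B ->
    tau (phi @^-1` (A `*` B)) = nu A * rho B) ->
  mpres tau (nu \x rho) phi.
Proof.
move=> mphi phiP.
apply: (mpres_gen (G := [set A `*` B | A in measurable & B in measurable])) => //.
- exact: measurable_prod_measurableType.
- move=> _ _ [A1 mA1 [A2 mA2 <-]] [B1 mB1 [B2 mB2 <-]].
  exists (A1 `&` B1); first exact: measurableI.
  exists (A2 `&` B2); first exact: measurableI.
  by rewrite setXI.
- by move=> _ [A mA [B mB <-]]; rewrite phiP// -product_measure1E.
Qed.

Lemma prodE (nu : probability Y R) (rho : probability Z R) A B :
  measurable A -> measurable B -> (nu \x rho) (A `*` B) = nu A * rho B.
Proof. by move=> mA mB; exact: product_measure1E. Qed.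

Lemma mpres_fst (nu : probability Y R) (rho : probability Z R) :
  mpres (nu \x rho) nu fst.
Proof.
split=> [|A mA]; first exact: measurable_fst.
rewrite (_ : fst @^-1` A = A `*` setT).
  by rewrite [LHS]prodE// probability_setT mule1.
by apply/seteqP; split => -[y z] //= [].
Qed.

Lemma mpres_snd (nu : probability Y R) (rho : probability Z R) :
  mpres (nu \x rho) rho snd.
Proof.
split=> [|A mA]; first exact: measurable_snd.
rewrite (_ : snd @^-1` A = setT `*` A).
  by rewrite [LHS]prodE// probability_setT mul1e.
by apply/seteqP; split => -[y z] //= [].
Qed.

End products.

Section product_maps.
Context {R : realType}.
Local Open Scope ereal_scope.
Context d1 d2 d3 d4 (Y : measurableType d1) (Z : measurableType d2)
  (W : measurableType d3) (V : measurableType d4).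

Definition fprod_map (Y Z W V : Type) (f : Y -> W) (g : Z -> V) (p : Y * Z) : W * V :=
  (f p.1, g p.2).

Lemma measurable_fprod_map (f : Y -> W) (g : Z -> V) :
  measurable_fun setT f -> measurable_fun setT g ->
  measurable_fun setT (fprod_map f g).
Proof.
move=> mf mg; apply: measurable_fun_pair.
  exact: (measurableT_comp mf measurable_fst).
exact: (measurableT_comp mg measurable_snd).
Qed.

Lemma mpres_fprod_map (nu : probability Y R) (rho : probability Z R)
    (tau : probability W R) (ups : probability V R) (f : Y -> W) (g : Z -> V) :
  mpres nu tau f -> mpres rho ups g ->
  mpres (nu \x rho) (tau \x ups) (fprod_map f g).
Proof.
move=> [mf fP] [mg gP]; apply: mpres_rect; first exact: measurable_fprod_map.
move=> A B mA mB.
rewrite -fP// -gP// -[RHS]prodE//; exact: measurable_preimage.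
Qed.

End product_maps.

Section product_isomorphisms.
Context {R : realType}.
Local Open Scope ereal_scope.
Context d1 d2 d3 d4 (Y : measurableType d1) (Z : measurableType d2)
  (W : measurableType d3) (V : measurableType d4).

Lemma mod0_inverse_fprod_map (nu : probability Y R) (rho : probability Z R)
    (tau : probability W R) (ups : probability V R) f f' g g' :
  mod0_inverse nu tau f f' -> mod0_inverse rho ups g g' ->
  mod0_inverse (nu \x rho) (tau \x ups) (fprod_map f g) (fprod_map f' g').
Proof.
move=> [f1 f2 f3 f4] [g1 g2 g3 g4]; split; [exact: mpres_fprod_map..| |].
  have := mpres_ae (mpres_snd nu rho) g3.
  have := mpres_ae (mpres_fst nu rho) f3.
  by apply: filterS2 => -[y z] /=; rewrite /fprod_map/= => -> ->.
have := mpres_ae (mpres_snd tau ups) g4.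
have := mpres_ae (mpres_fst tau ups) f4.
by apply: filterS2 => -[y z] /=; rewrite /fprod_map/= => -> ->.
Qed.

Definition assoc (Y Z W : Type) (p : Y * Z * W) : Y * (Z * W) :=
  (p.1.1, (p.1.2, p.2)).
Definition unassoc (Y Z W : Type) (p : Y * (Z * W)) : Y * Z * W :=
  (p.1, p.2.1, p.2.2).

Lemma measurable_assoc : measurable_fun setT (@assoc Y Z W).
Proof.
apply: measurable_fun_pair.
  exact: (measurableT_comp measurable_fst measurable_fst).
apply: measurable_fun_pair; last exact: measurable_snd.
exact: (measurableT_comp measurable_snd measurable_fst).
Qed.

Lemma measurable_unassoc : measurable_fun setT (@unassoc Y Z W).
Proof.
apply: measurable_fun_pair.
  apply: measurable_fun_pair; first exact: measurable_fst.
  exact: (measurableT_comp measurable_fst measurable_snd).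
exact: (measurableT_comp measurable_snd measurable_snd).
Qed.

(** By Tonelli's theorem, on the sets A x C with C any measurable set of pairs. *)
Lemma mpres_assoc (nu : probability Y R) (rho : probability Z R)
    (tau : probability W R) :
  mpres ((nu \x rho) \x tau) (nu \x (rho \x tau)) (@assoc Y Z W).
Proof.
apply: mpres_rect; first exact: measurable_assoc.
move=> A C mA mC; set E := _ @^-1` _.
have mE : measurable E.
  by apply: measurable_preimage; [exact: measurable_assoc|exact: measurableX].
transitivity (\int[nu \x rho]_x (tau \o xsection E) x) => //.
rewrite fubini_tonelli1//; last exact: measurable_fun_xsection.
rewrite /fubini_F/=.
transitivity (\int[nu]_y ((\1_A y)%:E * (rho \x tau) C)).
  apply: eq_integral => y _; have [yA|yA] := boolP (y \in A).
    rewrite indicE yA mul1e; apply: eq_integral => z _ /=; congr (tau _).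
    apply/seteqP; split => w /=; rewrite /xsection/= !inE /E/=; first by case.
    by move=> Czw; split => //=; exact: set_mem.
  rewrite indicE (negbTE yA) mul0e; apply: integral0_eq => z _ /=.
  rewrite (_ : xsection _ _ = set0) ?measure0//.
  apply/seteqP; split => w //=; rewrite /xsection/= inE /E/= => -[/= yA'].
  by rewrite mem_set in yA.
under eq_integral do rewrite muleC.
rewrite ge0_integralZl//; last by apply/measurable_EFinP; exact: measurable_indic.
by rewrite integral_indic// setIT muleC.
Qed.

Lemma mod0_inverse_assoc (nu : probability Y R) (rho : probability Z R)
    (tau : probability W R) :
  mod0_inverse ((nu \x rho) \x tau) (nu \x (rho \x tau))
    (@assoc Y Z W) (@unassoc Y Z W).
Proof.
have H := mpres_assoc nu rho tau.
split => //; [|by apply: aeW => -[[]]|by apply: aeW => -[? []]].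
split=> [|A mA]; first exact: measurable_unassoc.
rewrite -(proj2 H); first by congr (_ _); apply/seteqP; split => -[[]].
apply: measurable_preimage => //; exact: measurable_unassoc.
Qed.

Lemma mod0_inverse_swap (nu : probability Y R) (rho : probability Z R) :
  mod0_inverse (nu \x rho) (rho \x nu)
    (fun p : Y * Z => (p.2, p.1)) (fun p : Z * Y => (p.2, p.1)).
Proof.
split; [| |by apply: aeW => -[]|by apply: aeW => -[]].
  apply: mpres_rect; first exact: measurable_swap.
  move=> A B mA mB; rewrite (_ : _ @^-1` _ = B `*` A).
    by rewrite [LHS]prodE// muleC.
  by apply/seteqP; split => -[y z] [].
apply: mpres_rect; first exact: measurable_swap.
move=> A B mA mB; rewrite (_ : _ @^-1` _ = B `*` A).
  by rewrite [LHS]prodE// muleC.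
by apply/seteqP; split => -[y z] [].
Qed.

Definition fibre_if (B : set Y) (g : Z -> Z) (p : Y * Z) : Y * Z :=
  (p.1, if p.1 \in B then g p.2 else p.2).

Lemma preimage_fibre_if (B : set Y) (g : Z -> Z) A C :
  fibre_if B g @^-1` (A `*` C) =
    (A `&` B) `*` (g @^-1` C) `|` (A `\` B) `*` C.
Proof.
apply/seteqP; split => -[y z] /=; rewrite /fibre_if/=.
  case: ifPn => yB [yA zC]; [left|right].
    by split => //; split => //; exact: set_mem.
  by split => //; split => // yB'; rewrite mem_set in yB.
case=> [[[yA yB] zC]|[[yA yB] zC]]; first by rewrite mem_set.
by rewrite memNset.
Qed.

Lemma measurable_fibre_if (B : set Y) (g : Z -> Z) :
  measurable B -> measurable_fun setT g -> measurable_fun setT (fibre_if B g).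
Proof.
move=> mB mg; apply: measurable_fun_pair; first exact: measurable_fst.
apply: measurable_fun_if => //.
- exact: (measurable_mem_preimage (@measurable_fst _ _ Y Z) mB).
- apply: measurable_funTS; exact: (measurableT_comp mg measurable_snd).
- by apply: measurable_funTS; exact: measurable_snd.
Qed.

Lemma mpres_fibre_if (nu : probability Y R) (rho : probability Z R)
    (B : set Y) (g : Z -> Z) :
  measurable B -> mpres rho rho g -> mpres (nu \x rho) (nu \x rho) (fibre_if B g).
Proof.
move=> mB [mg gP]; apply: mpres_rect; first exact: measurable_fibre_if.
move=> A C mA mC; rewrite preimage_fibre_if.
have mAB : measurable (A `&` B) by exact: measurableI.
have mADB : measurable (A `\` B) by exact: measurableD.
have mgC : measurable (g @^-1` C) by exact: measurable_preimage.
rewrite measureU; [|exact: measurableX|exact: measurableX|].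
  rewrite [X in X + _]prodE// [X in _ + X]prodE//.
  rewrite gP// -ge0_muleDl//.
  congr (_ * _); rewrite -measureU//; first by rewrite setUIDK.
  by apply/seteqP; split => x // [[_ ?] []].
by apply/seteqP; split => -[y z] // [[[_ ?] _] [[_]]].
Qed.

Lemma mod0_inverse_fibre_if (nu : probability Y R) (rho : probability Z R)
    (B : set Y) (g g' : Z -> Z) :
  measurable B -> mod0_inverse rho rho g g' ->
  mod0_inverse (nu \x rho) (nu \x rho) (fibre_if B g) (fibre_if B g').
Proof.
move=> mB [g1 g2 g3 g4]; split; [exact: mpres_fibre_if..| |].
  have := mpres_ae (mpres_snd nu rho) g3.
  by apply: filterS => -[y z] /=; rewrite /fibre_if/=; case: ifP => yB; rewrite ?yB// => ->.
have := mpres_ae (mpres_snd nu rho) g4.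
by apply: filterS => -[y z] /=; rewrite /fibre_if/=; case: ifP => yB; rewrite ?yB// => ->.
Qed.

End product_isomorphisms.

(** * The measure algebra *)

Lemma half_exp_small (R : realType) (e : R) : 0 < e ->
  exists N, forall n, (N <= n)%N -> (2^-1 : R) ^+ n < e.
Proof.
move=> e0; have /cvgrPdist_lt/(_ _ e0)[N _ hN] : (2^-1 : R) ^+ n @[n --> \oo] --> 0.
  by apply: cvg_expr; rewrite ger0_norm// invf_lt1 ?ltr1n.
by exists N => n /hN; rewrite /= sub0r normrN ger0_norm ?exprn_ge0.
Qed.

Section measure_algebra.
Context {R : realType} d (Y : measurableType d) (nu : probability Y R).

Implicit Types A B C D : set Y.

Definition prob (A : set Y) : R := fine (nu A).

(** The metric of the measure algebra. *)
Definition sdist (A B : set Y) : R := prob (A `+` B).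

Lemma probK A : measurable A -> (prob A)%:E = nu A.
Proof. by move=> mA; rewrite fineK// fin_num_measure. Qed.

Lemma prob_ge0 A : 0 <= prob A.
Proof. exact: fine_ge0. Qed.

Lemma le_prob A B : measurable A -> measurable B -> A `<=` B -> prob A <= prob B.
Proof.
move=> mA mB AB; rewrite fine_le ?fin_num_measure//.
by apply: le_measure; rewrite ?inE.
Qed.

Lemma probT : prob setT = 1.
Proof. by rewrite /prob probability_setT. Qed.

Lemma prob0 : prob set0 = 0.
Proof. by rewrite /prob measure0. Qed.

Lemma prob_le1 A : measurable A -> prob A <= 1.
Proof. by move=> mA; rewrite -probT le_prob. Qed.

Lemma prob_U A B : measurable A -> measurable B -> A `&` B = set0 ->
  prob (A `|` B) = prob A + prob B.
Proof. by move=> mA mB AB; rewrite /prob measureU// fineD// fin_num_measure. Qed.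

Lemma prob_C A : measurable A -> prob (~` A) = 1 - prob A.
Proof.
move=> mA; apply/eqP; rewrite eq_sym subr_eq -prob_U//.
- by rewrite setvU probT.
- exact: measurableC.
- exact: setICl.
Qed.

Lemma le_probU A B : measurable A -> measurable B ->
  prob (A `|` B) <= prob A + prob B.
Proof.
move=> mA mB; rewrite -lee_fin EFinD !probK//; last exact: measurableU.
exact: measureU2.
Qed.

Lemma le_prob_bigsetU (D : nat -> set Y) (c : R) n : (forall i, measurable (D i)) ->
  (forall i, (i < n)%N -> prob (D i) <= c) ->
  prob (\big[setU/set0]_(i < n) D i) <= n%:R * c.
Proof.
move=> mD; elim: n => [|n IH] Dc; first by rewrite big_ord0 prob0 mul0r.
rewrite big_ord_recr/= -natr1 mulrDl mul1r.
apply: le_trans (le_probU _ _) _ => //; first exact: bigsetU_measurable.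
by apply: lerD; [apply: IH => i ni; apply: Dc; exact: ltnW|exact: Dc].
Qed.

Lemma ae_prob0 (A : set Y) : measurable A ->
  {ae nu, forall y, ~ A y} <-> prob A = 0.
Proof.
move=> mA; rewrite /almost_everywhere /prop_near1 /nbhs/= /almost_everywhere.
have -> : (~` [set x | ~ A x]) = A.
  by apply/seteqP; split => x /=; [exact: contrapT|tauto].
split=> [/(measure_negligible mA) h|h]; first by rewrite /prob h.
by apply/negligibleP => //; apply: etrans (esym (probK mA)) _; rewrite h.
Qed.

Lemma measurable_setY A B : measurable A -> measurable B -> measurable (A `+` B).
Proof. by move=> mA mB; apply: measurableU; exact: measurableD. Qed.

Lemma sdist_ge0 A B : 0 <= sdist A B.
Proof. exact: prob_ge0. Qed.

Lemma sdistC A B : sdist A B = sdist B A.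
Proof. by rewrite /sdist setYC. Qed.

Lemma sdistxx A : sdist A A = 0.
Proof. by rewrite /sdist setYK prob0. Qed.

Lemma sdist_triangle B A C : measurable A -> measurable B -> measurable C ->
  sdist A C <= sdist A B + sdist B C.
Proof.
move=> mA mB mC; apply: le_trans (le_probU _ _);
  [|exact: measurable_setY|exact: measurable_setY].
apply: le_prob; [exact: measurable_setY|apply: measurableU; exact: measurable_setY|].
by move=> y /=; have [] := pselect (B y); tauto.
Qed.

Lemma ler_sdist A B : measurable A -> measurable B -> prob A <= prob B + sdist A B.
Proof.
move=> mA mB; apply: le_trans (le_probU _ _) => //; last exact: measurable_setY.
apply: le_prob => //; first by apply: measurableU => //; exact: measurable_setY.
by move=> y /=; have [] := pselect (B y); tauto.
Qed.

Lemma sdistCC A B : sdist (~` A) (~` B) = sdist A B.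
Proof.
rewrite /sdist; congr prob; apply/seteqP; split => y /=;
  have [] := pselect (A y); have [] := pselect (B y); tauto.
Qed.

Lemma le_sdistU A B C D : measurable A -> measurable B -> measurable C ->
  measurable D -> sdist (A `|` B) (C `|` D) <= sdist A C + sdist B D.
Proof.
move=> mA mB mC mD; apply: le_trans (le_probU _ _);
  [|exact: measurable_setY|exact: measurable_setY].
apply: le_prob; [apply: measurable_setY; exact: measurableU|
  apply: measurableU; exact: measurable_setY|].
by move=> y /=; have [] := pselect (A y); have [] := pselect (B y);
  have [] := pselect (C y); have [] := pselect (D y); tauto.
Qed.

Lemma sdist_ae A B : measurable A -> measurable B ->
  {ae nu, forall y, A y <-> B y} <-> sdist A B = 0.
Proof.
move=> mA mB; rewrite -ae_prob0; last exact: measurable_setY.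
by split; apply: filterS => y /=;
  have [] := pselect (A y); have [] := pselect (B y); tauto.
Qed.

(** By continuity of the measure along increasing unions. *)
Lemma bigcup_approx (F : nat -> set Y) (e : R) : (forall n, measurable (F n)) ->
  0 < e -> exists N, sdist (\bigcup_k F k) (\big[setU/set0]_(i < N) F i) < e.
Proof.
move=> mF e0; pose G n := \big[setU/set0]_(i < n) F i.
have mG n : measurable (G n) by exact: bigsetU_measurable.
have UG : \bigcup_k F k = \bigcup_k G k.
  apply/seteqP; split => [y [k _ Fy]|y [k _]].
    by exists k.+1 => //; rewrite /G -bigcup_mkord; exists k => /=.
  by rewrite /G -bigcup_mkord => -[i _ Fy]; exists i.
have mU : measurable (\bigcup_k F k) by exact: bigcupT_measurable.
have := @nondecreasing_cvg_mu _ _ _ nu G mG _ _; rewrite -UG => /(_ mU) h.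
have {}h : (nu \o G) x @[x --> \oo] --> nu (\bigcup_k F k).
  by apply: h => m n mn; apply/subsetPset/subset_bigsetU.
have /fine_cvgP[_ /cvgrPdist_lt/(_ _ e0)[N _ /(_ N (leqnn N))]] :
    (nu \o G) x @[x --> \oo] --> (prob (\bigcup_k F k))%:E by rewrite probK.
move=> /= hN; exists N; apply: le_lt_trans hN; rewrite -/(G N) -/(prob _).
have GU : G N `<=` \bigcup_k F k by rewrite UG; exact: bigcup_sup.
have : prob (\bigcup_k F k) = prob (G N) + prob (\bigcup_k F k `\` G N).
  rewrite -prob_U//; first by rewrite setDUK.
    exact: measurableD.
  by rewrite setDIK.
rewrite /sdist; have -> : \bigcup_k F k `+` G N = \bigcup_k F k `\` G N.
  by rewrite /setY (_ : G N `\` _ = set0) ?setU0//; apply/seteqP; split => y // [/GU].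
by move=> ->; rewrite addrAC subrr add0r ler_norm.
Qed.

Lemma le_prob_bigcup (F : nat -> set Y) (c : R) : (forall n, measurable (F n)) ->
  (forall N, prob (\big[setU/set0]_(i < N) F i) <= c) -> prob (\bigcup_k F k) <= c.
Proof.
move=> mF Fc; apply/ler_addgt0Pr => e e0.
have [N hN] := bigcup_approx mF e0.
apply: le_trans (lerD (Fc N) (ltW hN)).
by apply: ler_sdist; [exact: bigcupT_measurable|exact: bigsetU_measurable].
Qed.

End measure_algebra.

Section measure_algebra_maps.
Context {R : realType}.

Lemma prob_mpres d1 d2 (Y : measurableType d1) (Z : measurableType d2)
    (nu : probability Y R) (rho : probability Z R) (phi : Y -> Z) A :
  mpres nu rho phi -> measurable A -> prob nu (phi @^-1` A) = prob rho A.
Proof. by move=> [_ h] mA; rewrite /prob h. Qed.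

Lemma sdist_mpres d1 d2 (Y : measurableType d1) (Z : measurableType d2)
    (nu : probability Y R) (rho : probability Z R) (phi : Y -> Z) A B :
  mpres nu rho phi -> measurable A -> measurable B ->
  sdist nu (phi @^-1` A) (phi @^-1` B) = sdist rho A B.
Proof.
move=> h mA mB; rewrite /sdist -(prob_mpres h)//; exact: measurable_setY.
Qed.

(** Convergence of phi_ k to phi in the weak topology. Since the maps preserve
    measure, the sets A that satisfy this are stable under approximation in
    measure, so a generating pi-system suffices. *)
Lemma weak_cvg_gen d1 d2 (Y : measurableType d1) (Z : measurableType d2)
    (nu : probability Y R) (rho : probability Z R) (phi_ : nat -> Y -> Z) phi
    (G : set (set Z)) :
  @measurable _ Z = <<s G >> -> setI_closed G ->
  (forall k, mpres nu rho (phi_ k)) -> mpres nu rho phi ->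
  (forall A, G A -> forall e, 0 < e ->
    exists N, forall k, (N <= k)%N -> sdist nu (phi_ k @^-1` A) (phi @^-1` A) < e) ->
  forall A, measurable A -> forall e, 0 < e ->
    exists N, forall k, (N <= k)%N -> sdist nu (phi_ k @^-1` A) (phi @^-1` A) < e.
Proof.
move=> mG GI mphi_ mphi hG A; rewrite [X in X A -> _]mG.
have [[mph _] mph_] := (mphi, fun k => proj1 (mphi_ k)).
move: A; apply: (dynkin_induction mG GI).
- by move=> e e0; exists 0%N => k _; rewrite !preimage_setT sdistxx.
- exact: hG.
- move=> S mS hS e e0; have [N hN] := hS _ e0; exists N => k /hN.
  by rewrite -!preimage_setC sdistCC.
- move=> F mF _ hF e e0.
  have [N hN] := bigcup_approx rho mF (divr_gt0 e0 (ltr0n _ 3)).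
  set U := \bigcup_k F k in hN *.
  pose G' n := \big[setU/set0]_(i < n) F i.
  have mG' n : measurable (G' n) by exact: bigsetU_measurable.
  have mU : measurable U by exact: bigcupT_measurable.
  have : forall e, 0 < e -> exists M, forall k, (M <= k)%N ->
      sdist nu (phi_ k @^-1` G' N) (phi @^-1` G' N) < e.
    elim: (N) => [|n IH] e1 e10.
      by exists 0%N => k _; rewrite /G' big_ord0 !preimage_set0 sdistxx.
    have [M1 h1] := IH _ (divr_gt0 e10 (ltr0n _ 2)).
    have [M2 h2] := hF n _ (divr_gt0 e10 (ltr0n _ 2)).
    exists (maxn M1 M2) => k; rewrite geq_max => /andP[/h1 {}h1 /h2 {}h2].
    rewrite {1 2}/G' big_ord_recr/= !preimage_setU -/(G' n).
    have m1 := measurable_preimage (mph_ k) (mG' n).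
    have m2 := measurable_preimage mph (mG' n).
    apply: le_lt_trans (le_sdistU _ m1 _ m2 _) _; [exact: measurable_preimage..|].
    by rewrite (splitr e1) ltrD.
  move=> /(_ _ (divr_gt0 e0 (ltr0n _ 3)))[M hM]; exists M => k /hM {}hM.
  have e1 : sdist nu (phi_ k @^-1` U) (phi_ k @^-1` G' N) < e / 3%:R.
    by rewrite (sdist_mpres (mphi_ k)).
  have e2 : sdist nu (phi @^-1` G' N) (phi @^-1` U) < e / 3%:R.
    by rewrite (sdist_mpres mphi)// sdistC.
  apply: le_lt_trans (sdist_triangle _ _ (measurable_preimage (mph_ k) (mG' N)) _) _.
  + exact: measurable_preimage.
  + exact: measurable_preimage.
  have := sdist_triangle nu (measurable_preimage (mph_ k) (mG' N))
    (measurable_preimage mph (mG' N)) (measurable_preimage mph mU).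
  by move: e1 e2 hM; lra.
Qed.

End measure_algebra_maps.

(** * The unit interval *)

Section unit_interval_facts.
Context {R : realType}.
Local Notation I := (I01 R).
Local Notation val := (@unit_itv_val R).
Local Notation lambda := (@lebesgue_I01 R).

Lemma val_ge0 (u : I) : 0 <= val u.
Proof. by have := set_mem (valP u); rewrite /= in_itv/= => /andP[]. Qed.

Lemma val_le1 (u : I) : val u <= 1.
Proof. by have := set_mem (valP u); rewrite /= in_itv/= => /andP[]. Qed.

(** Clipping makes mkI total; clip is also the distribution function of lambda,
    by prob_lt_set. *)
Definition clip (x : R) : R := Num.min 1 (Num.max 0 x).

Lemma clip_itv x : clip x \in (`[0, 1]%classic : set R).
Proof.
apply/mem_set; rewrite /= in_itv/= /clip.
by rewrite le_min ler01 le_max lexx/= ge_min lexx.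
Qed.

Definition mkI (x : R) : I := SigSub (clip_itv x).

Lemma val_mkI_clip x : val (mkI x) = clip x.
Proof. by []. Qed.

Lemma val_mkI x : 0 <= x <= 1 -> val (mkI x) = x.
Proof. by case/andP=> x0 x1; rewrite val_mkI_clip /clip max_r// min_r. Qed.

Lemma measurable_val : measurable_fun setT (val : I -> R).
Proof. by move=> _ B mB; exists B. Qed.

Lemma measurable_toI d (Y : measurableType d) (f : Y -> I) :
  measurable_fun setT (val \o f) -> measurable_fun setT f.
Proof.
move=> mf _ A [B mB <-]; rewrite setTI setTI.
by apply: (measurable_preimage mf).
Qed.

Lemma measurable_mkI : measurable_fun setT mkI.
Proof.
apply: measurable_toI; apply: measurable_minr => //.
exact: measurable_maxr.
Qed.

Definition lt_set (c : R) : set I := [set u | val u < c].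

Lemma measurable_lt_set c : measurable (lt_set c).
Proof.
have := measurable_preimage measurable_val (measurable_itv `]-oo, c[).
by congr measurable; apply/seteqP; split => u /=; rewrite in_itv.
Qed.

Lemma lambda_lt_set c : 0 <= c <= 1 -> lambda (lt_set c) = c%:E.
Proof.
case/andP=> c0 c1; rewrite /lebesgue_I01.
have -> : lt_set c = val @^-1` `]-oo, c[.
  by apply/seteqP; split => u /=; rewrite in_itv.
rewrite image_unit_itv_val.
have [->|cn1] := eqVneq c 1.
  have -> : (`]-oo, 1[ `&` `[0, 1])%classic = `[0, 1[%classic :> set R.
    apply/seteqP; split => x /=; rewrite !in_itv/=; first by move=> [-> /andP[->]].
    by case/andP=> -> x1; rewrite x1 ltW.
  by rewrite lebesgue_measure_itv/= lte_fin ltr01 oppr0 adde0.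
have c1' : c < 1 by rewrite lt_neqAle cn1.
have -> : (`]-oo, c[ `&` `[0, 1])%classic = `[0, c[%classic :> set R.
  apply/seteqP; split => x /=; rewrite !in_itv/=; first by move=> [-> /andP[->]].
  by case/andP=> -> xc; rewrite xc; split => //=; rewrite ltW// (lt_trans xc).
rewrite lebesgue_measure_itv/= lte_fin; case: ltP => [_|c0'].
  by rewrite oppr0 adde0.
by congr EFin; apply/eqP; rewrite eq_le c0 c0'.
Qed.

Lemma lt_set_out c : ~~ (0 <= c <= 1) -> lt_set c = set0 \/ lt_set c = setT.
Proof.
rewrite negb_and -!ltNge => /orP[c0|c1]; [left|right];
  apply/seteqP; split => u //=; rewrite /lt_set/=.
  by move=> uc; have := val_ge0 u; rewrite leNgt (lt_trans uc).
by move=> _; rewrite (le_lt_trans (val_le1 u)).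
Qed.

Lemma lt_set_gen : @measurable _ I = <<s range lt_set >>.
Proof.
have mE : @measurable _ I = preimage_set_system setT val (@measurable _ R) by [].
have gE : @measurable _ R = (@RGenInftyO.G R).-sigma.-measurable.
  exact: RGenInftyO.measurableE.
rewrite mE gE -g_sigma_preimageE; congr (<<s _ >>).
apply/seteqP; split => A.
  case=> _ [c ->] <-; exists c => //; rewrite setTI.
  by apply/seteqP; split => u /=; rewrite in_itv.
case=> c _ <-; exists `]-oo, c[%classic; first by exists c.
by rewrite setTI; apply/seteqP; split => u /=; rewrite in_itv.
Qed.

Lemma lt_setI b c : lt_set b `&` lt_set c = lt_set (Num.min b c).
Proof.
apply/seteqP; split => u /=; rewrite /lt_set/= lt_min; first by case=> -> ->.
by case/andP.
Qed.

Lemma mpres_I d (Y : measurableType d) (nu : probability Y R) (f : Y -> I) :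
  measurable_fun setT f ->
  (forall c, 0 <= c <= 1 -> nu (f @^-1` lt_set c) = c%:E) -> mpres nu lambda f.
Proof.
move=> mf fP; apply: (mpres_gen lt_set_gen) => //.
  by move=> _ _ [b _ <-] [c _ <-]; rewrite lt_setI; eexists.
move=> _ [c _ <-]; have [c01|/lt_set_out[|]->] := boolP (0 <= c <= 1).
- by rewrite fP//; exact/esym/lambda_lt_set.
- by rewrite preimage_set0 !measure0.
- by rewrite preimage_setT !probability_setT.
Qed.

(** By the sets [0, q[ with q rational. *)
Lemma countably_separated_I : countably_separated I.
Proof.
exists (fun i => if @unpickle rat i is Some q then lt_set (ratr q) else set0).
  by move=> i; case: unpickle => [q|//]; exact: measurable_lt_set.
move=> u v h; apply: unit_itv_val_inj; apply/eqP.
have lt_irr a b : (forall q : rat, val a < ratr q -> val b < ratr q) ->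
    val b <= val a.
  move=> ab; rewrite leNgt; apply/negP => /rat_in_itvoo[q].
  by rewrite in_itv/= => /andP[/ab qb bq]; have := lt_trans qb bq; rewrite ltxx.
by rewrite eq_le; apply/andP; split; apply: lt_irr => q;
  have := h (pickle q); rewrite pickleK /lt_set/= => -[].
Qed.

End unit_interval_facts.

Section product_with_unit_interval.
Context {R : realType}.
Local Notation I := (I01 R).
Local Notation val := (@unit_itv_val R).
Local Notation lambda := (@lebesgue_I01 R).
Context d (X : measurableType d).

Definition strips : set (set (X * I)) :=
  [set A `*` @lt_set R c | A in measurable & c in setT].

Lemma strips_gen : @measurable _ (X * I)%type = <<s strips >>.
Proof.
rewrite measurable_prod_measurableType; apply/seteqP; split; last first.
  apply: smallest_sub => [|_ [A mA [c _ <-]]]; first exact: smallest_sigma_algebra.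
  by apply: sub_sigma_algebra; exists A => //; exists (lt_set c) => //; exact: measurable_lt_set.
apply: smallest_sub => [|_ [A mA [B mB <-]]]; first exact: smallest_sigma_algebra.
pose GT := g_sigma_algebraType strips.
have H1 : <<s strips >> (A `*` setT).
  apply: sub_sigma_algebra; exists A => //; exists 2 => //; congr (_ `*` _).
  apply/seteqP; split => u //= _; rewrite /lt_set/=.
  by apply: le_lt_trans (val_le1 u) _; rewrite ltr1n.
have H2 : <<s strips >> (setT `*` B).
  move: B mB; rewrite lt_set_gen; apply: smallest_sub.
    split => [|C hC|F hF].
    - by rewrite setX0; exact: (@measurable0 _ GT).
    - have -> : setT `*` (setT `\` C) = ~` (setT `*` C) :> set (X * I).
        by apply/seteqP; split => -[x u] /=; [move=> [_ [_ Cu]] [_ /Cu]|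
          move=> h; split => //; split => // Cu; apply: h].
      exact: (@measurableC _ GT).
    - rewrite setX_bigcupr; exact: (@bigcupT_measurable _ GT).
  move=> _ [c _ <-]; apply: sub_sigma_algebra.
  by exists setT => //; exists c.
have -> : A `*` B = (A `*` setT) `&` (setT `*` B).
  by rewrite -setXI setIT setTI.
exact: (@measurableI _ GT).
Qed.

Lemma stripsI : setI_closed strips.
Proof.
move=> _ _ [A mA [b _ <-]] [B mB [c _ <-]]; rewrite -setXI lt_setI.
by exists (A `&` B); [exact: measurableI|eexists].
Qed.

End product_with_unit_interval.

(** * Convergence in measure of maps into the interval *)

Section convergence_in_measure.
Context {R : realType}.
Local Notation I := (I01 R).
Local Notation val := (@unit_itv_val R).
Local Notation lambda := (@lebesgue_I01 R).

Lemma prob_lt_set (c : R) : prob lambda (lt_set c) = clip c.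
Proof.
have [c01|c01] := boolP (0 <= c <= 1).
  apply: etrans (congr1 fine (lambda_lt_set c01)) _.
  by rewrite /= -[LHS](val_mkI c01) val_mkI_clip.
move: (c01); rewrite negb_and -!ltNge /clip => /orP[c0|c1].
  have [->|e] := lt_set_out c01.
    by rewrite prob0 max_l ?min_r// ltW.
  have : @lt_set R c (mkI 0) by rewrite e.
  by rewrite /lt_set/= val_mkI ?lexx ?ler01// ltNge ltW.
have [e|->] := lt_set_out c01.
  have : @lt_set R c (mkI 0) by rewrite /lt_set/= val_mkI ?lexx ?ler01// (lt_trans ltr01).
  by rewrite e.
by rewrite probT max_r ?min_l// ltW// (lt_trans ltr01).
Qed.

Lemma clip_cases (x : R) : [\/ x <= 0 /\ clip x = 0,
  0 <= x <= 1 /\ clip x = x | 1 <= x /\ clip x = 1].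
Proof.
rewrite /clip; case: (lerP 0 x) => x0; last first.
  by constructor 1; rewrite min_r// ltW.
by case: (lerP 1 x) => x1; [constructor 3|constructor 2; split=> //; exact: ltW].
Qed.

Lemma clip_add (c e : R) : 0 <= e -> clip c <= clip (c + e) <= clip c + e.
Proof.
by move=> e0; case: (clip_cases c) => -[h1 ->]; case: (clip_cases (c + e)) => -[h2 ->]; lra.
Qed.

Context d d' (X : measurableType d) (M : measurableType d').
Variables (mu : probability X R) (m : probability M R).
Variables (phi_ : nat -> M -> X * I) (phi : M -> X * I).

(** The strips A x [0, c[ form a generating pi-system, and their boundaries
    are null: off the set where the second coordinates of phi_ k and phi differ
    by eta, the preimages of a strip only differ over [c - eta, c + eta[. *)
Lemma weak_cvg_in_measure :
  (forall k, mpres m (mu \x lambda)%E (phi_ k)) -> measurable_fun setT phi ->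
  (forall k y, (phi_ k y).1 = (phi y).1) ->
  (forall eta e, 0 < eta -> 0 < e -> exists N, forall k, (N <= k)%N ->
     prob m [set y | eta <= `|val (phi_ k y).2 - val (phi y).2|] <= e) ->
  mpres m (mu \x lambda)%E phi /\
  forall A, measurable A -> forall e, 0 < e ->
    exists N, forall k, (N <= k)%N -> sdist m (phi_ k @^-1` A) (phi @^-1` A) < e.
Proof.
move=> mphi_ mph fstE cvgm.
have mph_ k : measurable_fun setT (phi_ k) by case: (mphi_ k).
pose D k eta := [set y | eta <= `|val (phi_ k y).2 - val (phi y).2|].
have mD k eta : measurable (D k eta).
  have mf : measurable_fun setT (fun y => `|val (phi_ k y).2 - val (phi y).2|).
    apply: measurableT_comp => //; apply: measurable_funB.
      apply: (measurableT_comp measurable_val).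
      exact: (measurableT_comp measurable_snd (mph_ k)).
    apply: (measurableT_comp measurable_val).
    exact: (measurableT_comp measurable_snd mph).
  have := measurable_preimage mf (measurable_itv `[eta, +oo[).
  by congr measurable; apply/seteqP; split => y /=; rewrite in_itv/= andbT.
have prect A c : measurable A -> prob (mu \x lambda)%E (A `*` lt_set c) =
    prob mu A * clip c.
  move=> mA; rewrite -prob_lt_set /prob -fineM ?fin_num_measure//; last first.
    exact: measurable_lt_set.
  by rewrite -(prodE mu lambda)//; exact: measurable_lt_set.
have ms A c : measurable A -> measurable (A `*` @lt_set R c).
  by move=> mA; apply: measurableX => //; exact: measurable_lt_set.
have pk k A c : measurable A -> prob m (phi_ k @^-1` (A `*` lt_set c)) =
    prob mu A * clip c.
  by move=> mA; rewrite (prob_mpres (mphi_ k)) ?prect//; exact: ms.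
have mpre A c : measurable A -> measurable (phi @^-1` (A `*` lt_set c)).
  by move=> mA; apply: measurable_preimage => //; exact: ms.
have mprek k A c : measurable A -> measurable (phi_ k @^-1` (A `*` lt_set c)).
  by move=> mA; apply: measurable_preimage => //; exact: ms.
have p A c : measurable A -> prob m (phi @^-1` (A `*` lt_set c)) =
    prob mu A * clip c.
  move=> mA; have a0 := prob_ge0 mu A; have a1 := prob_le1 mu mA.
  apply/eqP; rewrite eq_le; apply/andP; split; apply/ler_addgt0Pr => e e0;
      have e2 : 0 < e / 2 by [rewrite divr_gt0];
      have [N /(_ N (leqnn N)) hN] := cvgm _ _ e2 e2.
  - have h : phi @^-1` (A `*` lt_set c) `<=`
        phi_ N @^-1` (A `*` lt_set (c + e / 2)) `|` D N (e / 2).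
      move=> y [/= yA yc]; rewrite /D/=; case: leP => [h|h]; [by right|left].
      split; first by rewrite /= fstE.
      by move: yc h; rewrite /lt_set/= ltr_norml => ? /andP[]; lra.
    apply: le_trans (le_prob _ _ _ h) _ => //; first exact: mpre.
      by apply: measurableU => //; exact: mprek.
    apply: le_trans (le_probU _ _ _) _ => //; first exact: mprek.
    rewrite pk//; have /andP[_ h2] := clip_add c (ltW e2).
    have : prob mu A * clip (c + e / 2) <= prob mu A * clip c + e / 2.
      by apply: le_trans (ler_wpM2l a0 h2) _; rewrite mulrDr lerD2l ler_piMl// ltW.
    by move: hN; rewrite -/(D N (e / 2)); lra.
  - have h : phi_ N @^-1` (A `*` lt_set (c - e / 2)) `<=`
        phi @^-1` (A `*` lt_set c) `|` D N (e / 2).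
      move=> y [/= yA yc]; rewrite /D/=; case: leP => [h|h]; [by right|left].
      split; first by rewrite /= -(fstE N).
      by move: yc h; rewrite /lt_set/= ltr_norml => ? /andP[]; lra.
    have := le_prob m (mprek _ _ _ mA) _ h; rewrite pk//.
    have mU : measurable (phi @^-1` (A `*` lt_set c) `|` D N (e / 2)).
      by apply: measurableU => //; exact: mpre.
    move=> /(_ mU) h1; have h2 := le_probU m (mpre _ c mA) (mD N (e / 2)).
    have /andP[_] := clip_add (c - e / 2) (ltW e2).
    rewrite subrK => h3.
    have : prob mu A * clip c <= prob mu A * clip (c - e / 2) + e / 2.
      by apply: le_trans (ler_wpM2l a0 h3) _; rewrite mulrDr lerD2l ler_piMl// ltW.
    by move: hN h1 h2; rewrite -/(D N (e / 2)); lra.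
have mphi : mpres m (mu \x lambda)%E phi.
  apply: (mpres_gen (G := @strips R _ X)) => //;
    [exact: strips_gen|exact: stripsI|].
  move=> _ [A mA [c _ <-]].
  apply: etrans (esym (probK _ (mpre A c mA))) _.
  by rewrite p// -prect// probK//; exact: ms.
split => //; apply: (weak_cvg_gen (G := @strips R _ X) _ _ mphi_ mphi);
  [exact: strips_gen|exact: stripsI|].
move=> _ [A mA [c _ <-]] e e0.
have e4 : 0 < e / 4 by rewrite divr_gt0.
have [N hN] := cvgm _ _ e4 e4; exists N => k /hN {}hN.
pose W := lt_set (c + e / 4) `\` @lt_set R (c - e / 4).
have mW : measurable W by apply: measurableD; exact: measurable_lt_set.
have mS : measurable ((snd \o phi) @^-1` W).
  by apply: measurable_preimage => //; exact: (measurableT_comp measurable_snd mph).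
have h : (phi_ k @^-1` (A `*` lt_set c)) `+` (phi @^-1` (A `*` lt_set c)) `<=`
    D k (e / 4) `|` (snd \o phi) @^-1` W.
  move=> y hy; have [yD|yD] := pselect (D k (e / 4) y); [by left|right].
  move: yD hy; rewrite /D/= => /negP; rewrite -ltNge ltr_norml /W /lt_set/= fstE.
  move=> /andP[h1 h2] h3; split; last first.
    by move=> h4; apply: contrapT => _; case: h3 => -[[h5 h6] h7]; apply: h7; split => //; lra.
  case: h3 => -[[h5 h6] _]; lra.
apply: le_lt_trans (le_prob _ _ _ h) _.
- by apply: measurable_setY; [exact: mprek|exact: mpre].
- exact: measurableU.
apply: le_lt_trans (le_probU _ _ _) _ => //.
have -> : prob m ((snd \o phi) @^-1` W) = prob lambda W.
  by apply: (prob_mpres _ mW); exact: mpres_comp mphi (mpres_snd mu lambda).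
have : prob lambda (lt_set (c + e / 4)) = prob lambda (lt_set (c - e / 4)) + prob lambda W.
  rewrite -prob_U//.
  - by rewrite setDUK// => u; rewrite /lt_set/=; lra.
  - exact: measurable_lt_set.
  - exact: setDIK.
rewrite !prob_lt_set.
have /andP[_] := clip_add (c - e / 4) (ltW (addr_gt0 e4 e4)).
rewrite (_ : c - e / 4 + _ = c + e / 4); last by lra.
by move: hN; rewrite -/(D k (e / 4)); lra.
Qed.

End convergence_in_measure.

Section fast_cauchy_sequences.
Context {R : realType} d (M : measurableType d) (m : probability M R).
Local Notation I := (I01 R).
Local Notation val := (@unit_itv_val R).
Variable f : nat -> M -> I.
Hypothesis mf : forall k, measurable_fun setT (f k).
Let E k := [set y | (2^-1 : R) ^+ k < `|val (f k y) - val (f k.+1 y)|].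
Hypothesis Ele : forall k, prob m (E k) <= 2^-1 ^+ k.

Let mvf k : measurable_fun setT (val \o f k).
Proof. exact: (measurableT_comp measurable_val (mf k)). Qed.

Let mE k : measurable (E k).
Proof.
have mg : measurable_fun setT (fun y => `|val (f k y) - val (f k.+1 y)|).
  by apply: measurableT_comp => //; apply: measurable_funB; exact: mvf.
have := measurable_preimage mg (measurable_itv `]((2^-1 : R) ^+ k), +oo[).
by congr measurable; apply/seteqP; split => y /=; rewrite in_itv/= andbT.
Qed.

Let T k := \bigcup_i E (k + i).

Let mT k : measurable (T k).
Proof. by apply: bigcupT_measurable. Qed.

Let half_gt0 k : (0 : R) < 2^-1 ^+ k.
Proof. by rewrite exprn_gt0// invr_gt0. Qed.

Let Tle k : prob m (T k) <= 2 * 2^-1 ^+ k.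
Proof.
apply: le_prob_bigcup => // N.
suff : prob m (\big[setU/set0]_(i < N) E (k + i)) <=
   2 * 2^-1 ^+ k - 2 * 2^-1 ^+ (k + N).
  by have := half_gt0 (k + N); lra.
elim: N => [|N IH]; first by rewrite big_ord0 prob0 addn0 subrr.
rewrite big_ord_recr/=; apply: le_trans (le_probU _ _ _) _ => //.
  exact: bigsetU_measurable.
apply: le_trans (lerD IH (Ele _)) _.
by rewrite addnS exprS; lra.
Qed.

Let notT y k : ~ T k y -> forall j, (k <= j)%N ->
  `|val (f k y) - val (f j y)| <= 2 * 2^-1 ^+ k.
Proof.
move=> nT j /subnKC <-; move: (j - k)%N => {j} i.
suff : `|val (f k y) - val (f (k + i) y)| <= 2 * 2^-1 ^+ k - 2 * 2^-1 ^+ (k + i).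
  by have := half_gt0 (k + i); lra.
elim: i => [|i IH]; first by rewrite addn0 !subrr normr0.
have : `|val (f (k + i) y) - val (f (k + i.+1) y)| <= 2^-1 ^+ (k + i).
  by rewrite leNgt; apply/negP => h; apply: nT; exists i => //; rewrite /E/= -addnS.
move: IH; rewrite addnS exprS.
have := ler_normD (val (f k y) - val (f (k + i)%N y))
  (val (f (k + i)%N y) - val (f (k + i).+1 y)).
rewrite addrA subrK; lra.
Qed.

Let g y := limn_sup (fun k => val (f k y)).

Let cvg_g y : (exists k, ~ T k y) -> val (f k y) @[k --> \oo] --> g y.
Proof.
move=> [k0 nT].
have nT' k : (k0 <= k)%N -> ~ T k y.
  move=> kk [i _ Ei]; apply: nT; exists (k - k0 + i)%N => //.
  by rewrite addnA subnKC.
have : cvgn (fun k => val (f k y)).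
  apply/cauchy_cvgP/cauchy_exP => e e0.
  have [N hN] := half_exp_small (divr_gt0 e0 (ltr0n _ 4)).
  pose K := maxn N k0; have {}hN := hN K (leq_maxl _ _).
  exists (val (f K y)); exists K => // j /= Kj.
  have := notT (nT' K (leq_maxr _ _)) Kj; rewrite /ball/=.
  by have := half_gt0 K; lra.
move=> /cvg_ex[l hl].
have -> : g y = l by have /cvg_lim <- := cvg_sups hl.
exact: hl.
Qed.

(** The sets E k have summable measure, so almost every point lies outside of
    some T k by Borel-Cantelli, and there the sequence is Cauchy. The upper limit
    g is measurable and defined everywhere. *)
Lemma fast_cauchy_cvg : exists2 h : M -> I, measurable_fun setT h &
  forall eta e, 0 < eta -> 0 < e -> exists N, forall k, (N <= k)%N ->
     prob m [set y | eta <= `|val (f k y) - val (h y)|] <= e.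
Proof.
have mg : measurable_fun setT g.
  apply: measurable_fun_limn_sup => //.
    by move=> y _; exists 1 => _ [k _ <-]; exact: val_le1.
  by move=> y _; exists 0 => _ [k _ <-]; exact: val_ge0.
exists (mkI \o g); first exact: (measurableT_comp measurable_mkI mg).
move=> eta e eta0 e0.
have ee : 0 < Num.min (eta / 4) (e / 4) by rewrite lt_min !divr_gt0.
have [N hN] := half_exp_small ee; exists N => k /hN hk.
move: hk; rewrite lt_min => /andP[hk1 hk2].
suff h : [set y | eta <= `|val (f k y) - val ((mkI \o g) y)|] `<=` T k.
  apply: le_trans (le_prob _ _ _ h) _ => //; last first.
    by have := Tle k; have := half_gt0 k; lra.
  have mfg : measurable_fun setT (fun y => `|val (f k y) - val ((mkI \o g) y)|).
    apply: measurableT_comp => //; apply: measurable_funB; first exact: mvf.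
    exact: (measurableT_comp measurable_val (measurableT_comp measurable_mkI mg)).
  have := measurable_preimage mfg (measurable_itv `[eta, +oo[).
  by congr measurable; apply/seteqP; split => y /=; rewrite in_itv/= andbT.
move=> y; apply: contraPP => nT; rewrite /= -/(g y); apply/negP; rewrite -ltNge.
have cg := cvg_g (ex_intro _ k nT).
have g01 : 0 <= g y <= 1.
  have /cvg_lim <- := cg; last by [].
  have cvg : cvgn (fun k => val (f k y)) by apply/cvg_ex; eexists; exact: cg.
  apply/andP; split.
    by apply: limr_ge => //; apply: nearW => i; exact: val_ge0.
  by apply: limr_le => //; apply: nearW => i; exact: val_le1.
rewrite val_mkI//.
suff : `|val (f k y) - g y| <= 2 * 2^-1 ^+ k by have := half_gt0 k; lra.
have cg' : `|val (f k y) - val (f j y)| @[j --> \oo] --> `|val (f k y) - g y|.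
  by apply: cvg_norm; apply: cvgB => //; exact: cvg_cst.
have /cvg_lim <- := cg'; last by [].
apply: limr_le; first by apply/cvg_ex; eexists; exact: cg'.
by exists k => // j /= kj; exact: notT.
Qed.

End fast_cauchy_sequences.

(** * The weak topology *)

Section weak_topology.
Context {R : realType} d (Z : measurableType d) (nu : probability Z R).
Local Open Scope quotient_scope.

Lemma MPT_inverse (g : MPT nu) : exists g', mod0_inverse nu nu g g'.
Proof. by apply/mod0_inverseP; exact: mptP. Qed.

Lemma MPT_mpres (g : MPT nu) : mpres nu nu g.
Proof. exact: mod0_mpres (mptP _). Qed.

Lemma measurable_MPT_preimage (g : MPT nu) A :
  measurable A -> measurable (g @^-1` A).
Proof. by move=> mA; apply: measurable_preimage => //; case: (MPT_mpres g). Qed.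

Lemma MPT_fun_pi (g : mpt nu) :
  {ae nu, forall z, MPT_fun (\pi_(MPT nu) g) z = g z}.
Proof.
rewrite /MPT_fun; have /eqmodP/asboolP : repr (\pi_(MPT nu) g) = g %[mod MPT nu].
  by rewrite reprK.
exact.
Qed.

(** A basis of neighbourhoods of g, by nbhs_wball and wball_nbhs. *)
Definition wball (g : MPT nu) (AA : set (set Z)) (e : R) : set (MPT nu) :=
  [set h | forall A, AA A -> sdist nu (h @^-1` A) (g @^-1` A) < e].

Lemma nbhs_wball (g : MPT nu) AA e : finite_set AA -> AA `<=` measurable ->
  0 < e -> nbhs g (wball g AA e).
Proof.
move=> finA mAA e0.
have h1 A : measurable A ->
    nbhs g [set h : MPT nu | sdist nu (h @^-1` A) (g @^-1` A) < e].
  move=> mA.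
  have mgA : measurable (g @^-1` A) by exact: measurable_MPT_preimage.
  pose AB : (set_type (@measurable _ Z) * set_type (@measurable _ Z))%type :=
    (SigSub (mem_set mA), SigSub (mem_set mgA)).
  have cont : continuous (fun h : MPT nu => weak_coordinates h AB).
    move=> h; apply: (@continuous_comp _ _ _ (@weak_coordinates _ _ _ nu) (fun f => f AB)).
      exact: initial_continuous.
    exact: proj_continuous.
  have := cont g; move=> /(_ [set x | x < e]); apply.
  apply: open_nbhs_nbhs; split; first exact: open_lt.
  by change (sdist nu (g @^-1` A) (g @^-1` A) < e); rewrite sdistxx.
have -> : wball g AA e =
    \bigcap_(A in AA) [set h : MPT nu | sdist nu (h @^-1` A) (g @^-1` A) < e].
  by apply/seteqP; split => h /= hP A /hP.
have /finite_fsetP[F FE] := finA; rewrite FE in mAA *.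
apply: filter_bigI => A AF.
by move: (mAA A AF) => /h1.
Qed.

(** The coordinate of (A, B) is 1-Lipschitz in h^-1 A. *)
Lemma wball_nbhs (g : MPT nu) U : nbhs g U -> exists AA e,
  [/\ finite_set AA, AA `<=` measurable, 0 < e & wball g AA e `<=` U].
Proof.
pose F : set_system (MPT nu) := [set P | exists AA e,
  [/\ finite_set AA, AA `<=` measurable, 0 < e & wball g AA e `<=` P]].
have FF : Filter F.
  split.
  - by exists set0, 1; split => //.
  - move=> P Q [AA [e [fA mA e0 hP]]] [BB [e' [fB mB e0' hQ]]].
    exists (AA `|` BB), (Num.min e e'); split.
    + by rewrite finite_setU.
    + by move=> A [/mA|/mB].
    + by rewrite lt_min e0.
    + move=> h hh; split.
        by apply: hP => A AAA; have := hh A (or_introl AAA); rewrite lt_min => /andP[].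
      by apply: hQ => A AAA; have := hh A (or_intror AAA); rewrite lt_min => /andP[].
  - by move=> P Q PQ [AA [e [fA mA e0 hP]]]; exists AA, e; split => //; exact: subset_trans PQ.
suff : F --> g by apply.
suff H : (@weak_coordinates _ _ _ nu) @ F --> weak_coordinates g.
  move=> V; rewrite nbhsE => -[W [[V' oV' <-] Wg] WV].
  apply: filterS WV _; apply: H; exact: open_nbhs_nbhs.
apply/cvg_sup => -[A B] V; rewrite nbhsE => -[W [[C oC <-] Cg] WV].
apply: filterS WV _; rewrite /fmap /nbhs/=.
have mA : measurable (set_val A) by exact: set_mem (valP A).
have mB : measurable (set_val B) by exact: set_mem (valP B).
have /nbhs_ballP[e e0 he] : nbhs (weak_coordinates g (A, B)) C by exact: open_nbhs_nbhs.
exists [set set_val A], e; split => //; first by move=> _ ->.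
move=> h /(_ _ erefl) hh; apply: he; rewrite /ball/=.
change (`|sdist nu (g @^-1` set_val A) (set_val B) -
  sdist nu (h @^-1` set_val A) (set_val B)| < e).
have m1 := measurable_MPT_preimage g mA; have m2 := measurable_MPT_preimage h mA.
have := sdist_triangle nu m1 m2 mB; have := sdist_triangle nu m2 m1 mB.
rewrite (sdistC _ (g @^-1` _) (h @^-1` _)) ltr_norml; lra.
Qed.

End weak_topology.

(** * Countable generation *)

Section countably_generated.
Context {R : realType} d (Z : measurableType d) (U : nat -> set Z).

(** The vector of memberships in the first m sets; its fibres are the atoms of
    the algebra that these sets generate. *)
Definition signature m (z : Z) : {ffun 'I_m -> bool} := [ffun i : 'I_m => z \in U i].

Definition determined m (A : set Z) : Prop :=
  exists W : {set {ffun 'I_m -> bool}}, A = [set z | signature m z \in W].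

Lemma determinedP m A : determined m A <->
  forall x y, (forall i, (i < m)%N -> U i x <-> U i y) -> A x -> A y.
Proof.
split=> [[W ->] x y xy /=|h].
  suff -> : signature m x = signature m y by [].
  by apply/ffunP => i; rewrite !ffunE; apply/idP/idP => /set_mem/xy => /(_ (ltn_ord i))/mem_set.
exists [set b | `[< exists2 x, A x & signature m x = b >]]%SET.
apply/seteqP; split => [x Ax|y]/=; first by rewrite inE; apply/asboolP; exists x.
rewrite inE => /asboolP[x Ax xy]; apply: (h x) => // i im.
have := congr1 (fun b : {ffun 'I_m -> bool} => b (Ordinal im)) xy.
by rewrite !ffunE/= => e; split => /mem_set h'; apply: set_mem; [rewrite -e|rewrite e].
Qed.

Lemma determinedS m n A : (m <= n)%N -> determined m A -> determined n A.
Proof.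
move=> mn /determinedP h; apply/determinedP => x y xy; apply: h => i im.
by apply: xy; exact: leq_trans mn.
Qed.

Lemma determinedC m A : determined m A -> determined m (~` A).
Proof.
move=> /determinedP h; apply/determinedP => x y xy nAx Ay; apply: nAx.
by apply: (h y) => // i im; split => /(xy i im).
Qed.

Lemma determinedI m A B : determined m A -> determined m B -> determined m (A `&` B).
Proof.
move=> /determinedP hA /determinedP hB; apply/determinedP => x y xy [Ax Bx].
by split; [exact: hA Ax|exact: hB Bx].
Qed.

Lemma determinedU m A B : determined m A -> determined m B -> determined m (A `|` B).
Proof.
move=> dA dB; rewrite -[A `|` B]setCK setCU.
by apply: determinedC; apply: determinedI; exact: determinedC.
Qed.

Hypothesis mU : forall i, measurable (U i).

Lemma measurable_signature m b : measurable [set z | signature m z = b].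
Proof.
have -> : [set z | signature m z = b] =
    \bigcap_(i in [set: 'I_m]) (if b i then U i else ~` U i).
  apply/seteqP; split => [z /= <- i _|z /= h].
    by rewrite ffunE; case: ifPn => [/set_mem//|zU Uz]; rewrite mem_set in zU.
  apply/ffunP => i; rewrite ffunE; have := h i Logic.I.
  by case: (b i) => ?; [rewrite mem_set|rewrite memNset].
apply: fin_bigcap_measurable => [|i _]; first exact: finite_finset.
by case: ifP => _ //; exact: measurableC.
Qed.

Lemma measurable_determined m A : determined m A -> measurable A.
Proof.
move=> [W ->].
have -> : [set z | signature m z \in W] =
    \bigcup_(b in [set` W]) [set z | signature m z = b].
  by apply/seteqP; split => [z zW|z [b bW /= ->]] //; exists (signature m z).
apply: fin_bigcup_measurable => [|b _]; first exact: finite_finset.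
exact: measurable_signature.
Qed.

Hypothesis genU : @measurable _ Z = <<s range U >>.

Lemma determined_gen : @measurable _ Z = <<s [set A | exists m, determined m A] >>.
Proof.
apply/seteqP; split.
  rewrite genU; apply: smallest_sub; first exact: smallest_sigma_algebra.
  move=> _ [i _ <-]; apply: sub_sigma_algebra; exists i.+1; apply/determinedP => x y xy.
  by move=> /(xy i (ltnSn i)).
apply: smallest_sub; first exact: sigma_algebra_measurable.
by move=> A [m]; exact: measurable_determined.
Qed.

(** The sets that can be approximated form a sigma-algebra containing U. *)
Lemma determined_dense (nu : probability Z R) A e : measurable A -> 0 < e ->
  exists m S, determined m S /\ sdist nu A S < e.
Proof.
rewrite [X in X A -> _]determined_gen => mA; move: A mA e.
apply: (dynkin_induction determined_gen).
- move=> A B [m dA] [n dB]; exists (maxn m n); apply: determinedI.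
    exact: determinedS (leq_maxl _ _) dA.
  exact: determinedS (leq_maxr _ _) dB.
- by move=> e e0; exists 0%N, setT; rewrite sdistxx; split => //; apply/determinedP.
- by move=> A [m dA] e e0; exists m, A; rewrite sdistxx.
- move=> A mA hA e e0; have [m [S [dS hS]]] := hA e e0.
  by exists m, (~` S); rewrite sdistCC; split => //; exact: determinedC.
- move=> F mF _ hF e e0.
  have e2 : 0 < e / 2 by rewrite divr_gt0.
  have [N hN] := bigcup_approx nu mF e2.
  suff [m [S [dS hS]]] : exists m S, determined m S /\
      sdist nu (\big[setU/set0]_(i < N) F i) S < e / 2.
    exists m, S; split => //.
    apply: le_lt_trans (sdist_triangle (B := \big[setU/set0]_(i < N) F i) _ _ _ _) _.
    + exact: bigcupT_measurable.
    + exact: bigsetU_measurable.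
    + exact: measurable_determined dS.
    + by rewrite (splitr e) ltrD.
  move: (e / 2) e2 => {hN} {e e0}; elim: N => [|N IH] e e0.
    exists 0%N, set0; rewrite big_ord0 sdistxx; split => //.
    by apply/determinedP.
  have e2 : 0 < e / 2 by rewrite divr_gt0.
  have [m [S [dS hS]]] := IH _ e2; have [n [S' [dS' hS']]] := hF N _ e2.
  exists (maxn m n), (S `|` S'); rewrite big_ord_recr/=; split.
    by apply: determinedU; [exact: determinedS (leq_maxl _ _) dS|
      exact: determinedS (leq_maxr _ _) dS'].
  apply: le_lt_trans (le_sdistU _ _ _ _ _) _ => //.
  + exact: bigsetU_measurable.
  + exact: measurable_determined dS.
  + exact: measurable_determined dS'.
  + by rewrite (splitr e) ltrD.
Qed.

End countably_generated.

Definition countably_generated d (Z : measurableType d) : Prop :=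
  exists2 U : nat -> set Z, (forall i, measurable (U i)) &
    @measurable _ Z = <<s range U >>.

(** A family indexed by a countable type, as a sequence padded with set0. *)
Definition sequence_of (J : countType) (Z : Type) (V : J -> set Z) (i : nat) : set Z :=
  oapp V set0 (unpickle i).

Lemma sequence_of_pickle (J : countType) (Z : Type) (V : J -> set Z) j :
  sequence_of V (pickle j) = V j.
Proof. by rewrite /sequence_of pickleK. Qed.

Lemma sequence_of_ind (J : countType) (Z : Type) (V : J -> set Z) (P : set Z -> Prop) :
  P set0 -> (forall j, P (V j)) -> forall i, P (sequence_of V i).
Proof. by move=> P0 PV i; rewrite /sequence_of; case: unpickle. Qed.

Lemma bigcup_sequence_of (J : countType) (Z : Type) (V : J -> set Z) :
  \bigcup_i sequence_of V i = \bigcup_j V j.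
Proof.
apply/seteqP; split => z [i _]; last first.
  by move=> Vz; exists (pickle i) => //; rewrite sequence_of_pickle.
by rewrite /sequence_of; case: unpickle => //= j; exists j.
Qed.

(** By the sets [0, q[ with q rational. *)
Lemma countably_generated_I (R : realType) : countably_generated (I01 R).
Proof.
pose V (q : rat) : set (I01 R) := lt_set (ratr q).
pose U := sequence_of V.
have mU i : measurable (U i).
  by apply: sequence_of_ind => // q; exact: measurable_lt_set.
exists U => //; apply/seteqP; split; last first.
  apply: smallest_sub; first exact: sigma_algebra_measurable.
  by move=> _ [i _ <-].
rewrite [X in X `<=` _]lt_set_gen.
apply: smallest_sub; first exact: smallest_sigma_algebra.
move=> _ [c _ <-].
pose GT := g_sigma_algebraType (range U).
have -> : lt_set c = \bigcup_i sequence_of (fun q => if ratr q <= c then V q else set0) i.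
  rewrite bigcup_sequence_of; apply/seteqP; split => [u /= uc|u [q _]].
    have [q] := rat_in_itvoo uc; rewrite in_itv/= => /andP[uq qc].
    by exists q => //; rewrite ltW.
  case: ifP => // qc; rewrite /V /lt_set/= => h.
  exact: lt_le_trans qc.
apply: (@bigcupT_measurable _ GT) => i; apply: sequence_of_ind => [|q].
  exact: (@measurable0 _ GT).
case: ifP => _; last exact: (@measurable0 _ GT).
by apply: sub_sigma_algebra; exists (pickle q) => //; rewrite /U sequence_of_pickle.
Qed.

(** Take the preimages of a countable basis of the topology. *)
Lemma standard_borel_generated (R : realType) d (X : measurableType d) :
  standard_borel R X -> exists U : nat -> set X,
    [/\ forall i, measurable (U i), @measurable _ X = <<s range U >> &
        forall x y, (forall i, U i x <-> U i y) -> x = y].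
Proof.
move=> [P [f [hP [B cB [Bop Bbasis]] bijf mP]]].
have /countable_injP[n ninj] := cB.
pose V i := \bigcup_(b in [set b | B b /\ n b = i]) b.
have VB b : B b -> V (n b) = b.
  move=> Bb; apply/seteqP; split => [p [b' [Bb' nb'] b'p]|p bp]; last by exists b.
  by rewrite -(ninj _ _ _ _ nb')// mem_set.
have Vop i : open (V i) by apply: bigcup_open => b [/Bop].
have mU i : measurable (f @^-1` V i).
  by apply/mP; exists (V i) => //; exact: sub_sigma_algebra.
have VO x O : open O -> O (f x) -> exists i, V i `<=` O /\ V i (f x).
  move=> oO Ox; have /Bbasis[b [Bb bx] bO] : nbhs (f x) O by exact: open_nbhs_nbhs.
  by exists (n b); rewrite VB.
exists (fun i => f @^-1` V i); split => //.
- apply/seteqP; split; last first.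
    apply: smallest_sub; first exact: sigma_algebra_measurable.
    by move=> _ [i _ <-].
  pose GT := g_sigma_algebraType (range (fun i => f @^-1` V i)).
  move=> _ /mP[D sD ->]; move: D sD; apply: smallest_sub.
    split => [|D hD|F hF].
    + by rewrite preimage_set0; exact: (@measurable0 _ GT).
    + by rewrite setTD preimage_setC; exact: (@measurableC _ GT).
    + by rewrite preimage_bigcup; exact: (@bigcupT_measurable _ GT).
  move=> O oO /=.
  have -> : f @^-1` O = \bigcup_i (if `[< V i `<=` O >] then f @^-1` V i else set0).
    apply/seteqP; split => [x Ox|x [i _]].
      by have [i [iO ix]] := VO x O oO Ox; exists i => //; rewrite asboolT.
    by case: asboolP => // sub /sub.
  apply: (@bigcupT_measurable _ GT) => i; case: ifP => _; last exact: (@measurable0 _ GT).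
  by apply: sub_sigma_algebra; exists i.
- move=> x y xy; apply: (bij_inj bijf); apply: contrapT => fxy.
  have /hausdorff_accessible/(_ (f x) (f y)) := hP.
  have fxy' : f x != f y by exact/eqP.
  move=> /(_ fxy') [W [oW Wx Wy]].
  have [i [iW ix]] := VO x W oW (set_mem Wx).
  by move: Wy; rewrite inE; apply; apply: iW; apply/xy.
Qed.

(** * Rokhlin cocycles and skew products *)

Section null_sections.
Context {R : realType} d1 d2 (Y : measurableType d1) (Z : measurableType d2).
Variables (nu : probability Y R) (rho : probability Z R).

Lemma null_xsection (A : set (Y * Z)) : measurable A ->
  (nu \x rho)%E A = 0%E <-> {ae nu, forall y, rho (xsection A y) = 0%E}.
Proof.
move=> mA; have mf : measurable_fun setT (rho \o xsection A).
  exact: measurable_fun_xsection.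
have -> : (nu \x rho)%E A = (\int[nu]_y `|(rho \o xsection A) y|)%E.
  by apply: eq_integral => y _; rewrite gee0_abs.
rewrite (ae_eq_integral_abs nu measurableT mf).
by split; apply: filterS => y /= h; [exact: h|move=> _].
Qed.

Lemma ae_xsection (P : Y * Z -> Prop) : {ae (nu \x rho)%E, forall p, P p} ->
  {ae nu, forall y, {ae rho, forall z, P (y, z)}}.
Proof.
move=> [A [mA A0 PA]]; have h := (null_xsection mA).1 A0.
apply: filterS h => y Ay; exists (xsection A y); split => //.
  exact: measurable_xsection.
by move=> z /= nP; apply/xsectionP/PA.
Qed.

Lemma xsection_ae (P : Y * Z -> Prop) : measurable [set p | P p] ->
  {ae nu, forall y, {ae rho, forall z, P (y, z)}} ->
  {ae (nu \x rho)%E, forall p, P p}.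
Proof.
move=> mP h; have mC := measurableC mP.
apply/negligibleP => //; apply/(null_xsection mC).
apply: filterS h => y hy.
apply: measure_negligible; first exact: measurable_xsection.
by apply: negligibleS hy => z /xsectionP.
Qed.

End null_sections.

Lemma ae_forall_countType (R : realType) d (Y : measurableType d)
    (nu : probability Y R) (J : countType) (P : J -> Y -> Prop) :
  (forall j, {ae nu, forall y, P j y}) -> {ae nu, forall y, forall j, P j y}.
Proof.
move=> h; pose Q n y := if @unpickle J n is Some j then P j y else True.
have : {ae nu, forall y, forall n, Q n y}.
  apply: ae_foralln => n; rewrite /Q; case: unpickle => [j|]; first exact: h.
  exact: aeW.
by apply: filterS => y hy j; have := hy (pickle j); rewrite /Q pickleK.
Qed.

Section second_countability.
Context {R : realType} d (Z : measurableType d) (nu : probability Z R).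
Variables (J : countType) (D : J -> set Z).
Hypothesis mD : forall j, measurable (D j).
Hypothesis denseD : forall A e, measurable A -> 0 < e -> exists j, sdist nu A (D j) < e.

(** A countable basis of the weak topology, from a dense family D in the
    measure algebra. *)
Definition basic_set (b : seq (J * J) * nat) : set (MPT nu) :=
  [set h | forall p, p \in b.1 -> sdist nu (h @^-1` D p.1) (D p.2) < b.2.+1%:R^-1].

Lemma basic_set_basis (g : MPT nu) (U : set (MPT nu)) : open U -> U g ->
  exists2 b, basic_set b g & basic_set b `<=` U.
Proof.
move=> oU Ug; have /wball_nbhs[AA [e [finA mA e0 AU]]] : nbhs g U.
  exact: open_nbhs_nbhs.
have e4 : 0 < e / 4 by rewrite divr_gt0.
have [k hk] : exists k : nat, (k.+1%:R^-1 : R) < e / 4.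
  exists (Num.truncn (e / 4)^-1); rewrite invf_plt ?posrE//.
  by rewrite Num.Theory.truncnS_gt.
have k0 : (0 : R) < k.+1%:R^-1 by rewrite invr_gt0 ltr0n.
have /choice[c hc] : forall A : set Z, exists p : J * J, AA A ->
    sdist nu A (D p.1) < e / 4 /\ sdist nu (g @^-1` D p.1) (D p.2) < k.+1%:R^-1.
  move=> A; have [AAA|nA] := pselect (AA A); last first.
    have [j _] := denseD measurableT ltr01.
    by exists (j, j).
  have [i hi] := denseD (mA _ AAA) e4.
  have [j hj] := denseD (measurable_MPT_preimage g (mD i)) k0.
  by exists (i, j).
have /finite_fsetP[F FE] := finA.
exists ([seq c A | A <- finmap.enum_fset F], k).
  by move=> p /= /mapP[A AF ->]; have [] := hc A _; rewrite ?FE.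
move=> h hh; apply: AU => A AAA; have [h1 h2] := hc A AAA.
have h3 := hh (c A); rewrite /= map_f in h3; last by move: AAA; rewrite FE.
have {}h3 := h3 isT.
have mAA := mA _ AAA; have mi := mD (c A).1; have mj := mD (c A).2.
have mhi := measurable_MPT_preimage h mi; have mhA := measurable_MPT_preimage h mAA.
have mgi := measurable_MPT_preimage g mi; have mgA := measurable_MPT_preimage g mAA.
have d1 := sdist_triangle nu mhA mhi mgA.
have d2 := sdist_triangle nu mhi mj mgA.
have d3 := sdist_triangle nu mj mgi mgA.
have e1 : sdist nu (h @^-1` A) (h @^-1` D (c A).1) < e / 4.
  by rewrite (sdist_mpres (MPT_mpres h)).
have e2 : sdist nu (g @^-1` D (c A).1) (g @^-1` A) < e / 4.
  by rewrite (sdist_mpres (MPT_mpres g))// sdistC.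
rewrite (sdistC _ (D _) (g @^-1` D _)) in d3.
by move: hk h2 h3 d1 d2 d3 e1 e2; rewrite /=; move: (_^-1) => t; lra.
Qed.

End second_countability.

(** The distribution function of f is monotone and clip is continuous. Rational
    test points are needed because there are only countably many of them, as
    must be for conditions that hold almost everywhere. *)
Lemma mpres_I_rat (R : realType) d (Y : measurableType d) (nu : probability Y R)
    (f : Y -> I01 R) : measurable_fun setT f ->
  (forall q : rat, prob nu (f @^-1` lt_set (ratr q)) = clip (ratr q)) ->
  mpres nu (@lebesgue_I01 R) f.
Proof.
move=> mf fq; have mlt c : measurable (f @^-1` lt_set c).
  by apply: measurable_preimage => //; exact: measurable_lt_set.
apply: mpres_I => // c c01; rewrite -probK//; congr EFin.
have {2}-> : c = clip c by rewrite -val_mkI_clip val_mkI.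
have lt_setS b b' : b <= b' -> f @^-1` lt_set b `<=` f @^-1` lt_set b'.
  by move=> bb' y /= h; exact: lt_le_trans bb'.
apply/eqP; rewrite eq_le; apply/andP; split; apply/ler_addgt0Pr => e e0.
  have [q] : exists q, ratr q \in `]c, (c + e)[ by apply: rat_in_itvoo; lra.
  rewrite in_itv/= => /andP[cq qc].
  apply: le_trans (le_prob _ _ _ (lt_setS _ _ (ltW cq))) _ => //; rewrite fq.
  have e1 : 0 <= ratr q - c by lra.
  have /andP[_] := clip_add c e1; rewrite (addrC c) subrK; lra.
have [q] : exists q, ratr q \in `](c - e), c[ by apply: rat_in_itvoo; lra.
rewrite in_itv/= => /andP[cq qc].
have := le_prob nu (mlt _) (mlt _) (lt_setS _ _ (ltW qc)); rewrite fq.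
have e1 : 0 <= c - ratr q by lra.
have /andP[_] := clip_add (ratr q) e1; rewrite (addrC (ratr q)) subrK; lra.
Qed.

Section skew_products_facts.
Context {R : realType} d (X : measurableType d) (mu : probability X R).
Variable T : X -> X.
Local Notation I := (I01 R).
Local Notation lambda := (@lebesgue_I01 R).
Local Notation nu := (mu \x lambda)%E.
Hypothesis sX : countably_separated X.
Hypothesis hT : invertible_mpt mu T.

Let mT : measurable_fun setT T. Proof. by case: hT. Qed.

Lemma skew_fst (F : MPT nu) : @skew_products R d X mu T F ->
  {ae nu, forall y, (F y).1 = T y.1}.
Proof.
move=> [S _ FS]; apply: xsection_ae.
  apply: measurable_eq_fun => //.
    exact: (measurableT_comp measurable_fst (proj1 (MPT_mpres F))).
  exact: (measurableT_comp mT measurable_fst).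
by apply: filterS FS => x; apply: filterS => u /= ->.
Qed.

Lemma integral_xsection (E : set (X * I)) C : measurable E -> measurable C ->
  (\int[mu]_(x in C) lambda (xsection E x))%E = nu (E `&` (C `*` setT)).
Proof.
move=> mE mC; rewrite integral_mkcond; apply: eq_integral => x _ /=.
rewrite patchE; case: ifPn => xC; congr (lambda _) || (rewrite -[LHS](measure0 lambda); congr (lambda _)).
  apply/seteqP; split => u /=; rewrite /xsection/= !inE/=; last by case.
  by move=> Exu; split => //; split => //; exact: set_mem.
apply/seteqP; split => u //=; rewrite /xsection/= inE/= => -[_ [xC' _]].
by rewrite mem_set in xC.
Qed.

(** If a map over T preserves mu x lambda, almost all of its fibre maps
    preserve lambda: test on sets C x [0, c[, using that every C is the
    preimage under T of a measurable set. *)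
Lemma fibre_mpres (phi : X * I -> X * I) : mpres nu nu phi ->
  {ae nu, forall y, (phi y).1 = T y.1} ->
  {ae mu, forall x, mpres lambda lambda (fun u => (phi (x, u)).2)}.
Proof.
move=> mphi phi1; have [mph phiP] := mphi.
have [psi [Tp psip psiT Tpsi]] := (mod0_inverseP mu mu T).1 hT.
have ms : measurable_fun setT (snd \o phi) by exact: (measurableT_comp measurable_snd).
pose E c := (snd \o phi) @^-1` lt_set c.
have mE c : measurable (E c) by apply: measurable_preimage => //; exact: measurable_lt_set.
have H (q : rat) : {ae mu, forall x, prob lambda (xsection (E (ratr q)) x) = clip (ratr q)}.
  set c : R := ratr q.
  have mg : measurable_fun setT (lambda \o xsection (E c)).
    exact: measurable_fun_xsection.
  have : ae_eq mu setT (cst (clip c)%:E) (lambda \o xsection (E c)).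
    apply: integral_ae_eq => //; first exact: finite_measure_integrable_cst.
    move=> C _ mC; rewrite integral_xsection//.
    rewrite integral_cst//.
    have mpC : measurable (psi @^-1` C) by apply: measurable_preimage => //; case: psip.
    transitivity (nu (phi @^-1` ((psi @^-1` C) `*` lt_set c))).
      rewrite (phiP ((psi @^-1` C) `*` lt_set c)); last first.
        by apply: measurableX => //; exact: measurable_lt_set.
      apply: esym; apply: etrans (prodE mu lambda _ _) _ => //.
        exact: measurable_lt_set.
      rewrite (proj2 psip)// muleC; congr (_ * _)%E.
      by rewrite -prob_lt_set; apply/esym/probK; exact: measurable_lt_set.
    apply: (@ae_eq_measure _ _ _ nu).
    - apply: measurable_preimage => //; apply: measurableX => //.
      exact: measurable_lt_set.
    - by apply: measurableI => //; exact: measurableX.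
    - have h := mpres_ae (mpres_fst mu lambda) psiT.
      apply: filterS2 phi1 h => -[x u] /= -> ->; rewrite /E/=.
      by split => [[]|[? []]].
  by apply: filterS => x /= /(_ Logic.I) h; exact: (congr1 fine (esym h)).
have := ae_forall_countType H.
apply: filterS => x hx; apply: mpres_I_rat => [|q].
  exact: (measurableT_comp ms (pair1_measurable x)).
by rewrite -hx; congr prob; apply/seteqP; split => u; rewrite /xsection/= inE.
Qed.

(** The fibre maps of F and of its inverse are inverse to each other. The converse
    is skew_fst. *)
Lemma skew_products_of_fst (F : MPT nu) : {ae nu, forall y, (F y).1 = T y.1} ->
  @skew_products R d X mu T F.
Proof.
move=> F1; have [G [Fp Gp GF FG]] := MPT_inverse F.
have mF : measurable_fun setT F by case: Fp.
have mG : measurable_fun setT G by case: Gp.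
pose f x u := (F (x, u)).2.
have [N [mN N0 hN]] : {ae mu, forall x, invertible_mpt lambda (f x)}.
  have h1 := fibre_mpres Fp F1.
  have h2 : {ae nu, forall y, G (T y.1, (F y).2) = y}.
    by apply: filterS2 F1 GF => y <-; rewrite -surjective_pairing.
  have := ae_xsection h2; apply: filterS2 h1 => x hx gx.
  apply/mod0_inverseP; exists (fun u => (G (T x, u)).2).
  apply: mod0_inverse_left => //; first exact: countably_separated_I.
    apply: (measurableT_comp measurable_snd).
    exact: (measurableT_comp mG (pair1_measurable _)).
  by apply: filterS gx => u /= ->.
have mptN x : ~ N x -> invertible_mpt lambda (f x).
  by move=> Nx; apply: contrapT => h; apply: Nx; exact: hN.
have id_mpt : invertible_mpt lambda (@id I).
  apply/mod0_inverseP; exists id; exact: mod0_inverse_id.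
pose h x : mpt lambda := match pselect (N x) with
  | left _ => Mpt id_mpt | right Nx => Mpt (mptN x Nx) end.
pose S x : MPT lambda := \pi_(MPT lambda)%qT (h x).
have hE x : ~ N x -> mpt_fun (h x) = f x by rewrite /h; case: pselect.
have hN' x : N x -> h x = Mpt id_mpt by rewrite /h; case: pselect.
exists S; last first.
  have h1 := ae_xsection F1.
  have h2 : {ae mu, forall x, ~ N x} by apply/(ae_prob0 mu mN); rewrite /prob N0.
  apply: filterS2 h1 h2 => x Fx Nx.
  have := MPT_fun_pi (h x); rewrite -/(S x) hE//.
  by apply: filterS2 Fx => u /= h1 ->; rewrite -h1 -surjective_pairing.
(* S is measurable: U is a countable union of basic sets, and S x lies in a
   basic set if finitely many measures of sections at x are small. *)
move=> U oU.
have [V mV gV] := countably_generated_I R.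
pose J := {m : nat & {set {ffun 'I_m -> bool}}}.
pose D (j : J) : set I := [set z | signature V (tag j) z \in tagged j].
have mD j : measurable (D j) by apply: (measurable_determined mV (m := tag j)); exists (tagged j).
have denseD A e : measurable A -> 0 < e -> exists j, sdist lambda A (D j) < e.
  move=> mA e0; have [m [_ [[W ->] h']]] := determined_dense mV gV lambda mA e0.
  by exists (Tagged (fun m => {set {ffun 'I_m -> bool}}) W).
have mW A A' : measurable A -> measurable A' ->
    measurable (((snd \o F) @^-1` A) `+` (snd @^-1` A') : set (X * I)).
  move=> mA mA'; apply: measurable_setY; apply: measurable_preimage => //.
  exact: (measurableT_comp measurable_snd mF).
have SE x A A' e : ~ N x -> measurable A -> measurable A' ->
    sdist lambda (S x @^-1` A) A' < e <->
    (lambda (xsection (((snd \o F) @^-1` A) `+` (snd @^-1` A')) x) < e%:E)%E.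
  move=> Nx mA mA'.
  rewrite -lte_fin /sdist probK; last first.
    by apply: measurable_setY => //; exact: measurable_MPT_preimage.
  suff h0 : lambda ((S x @^-1` A) `+` A') =
      lambda (xsection (((snd \o F) @^-1` A) `+` (snd @^-1` A')) x).
    by split; apply: le_lt_trans; move/eqP: h0; rewrite eq_le => /andP[].
  apply: (@ae_eq_measure _ _ _ lambda).
  - by apply: measurable_setY => //; exact: measurable_MPT_preimage.
  - by apply: measurable_xsection; exact: mW.
  - have := MPT_fun_pi (h x); rewrite -/(S x) hE//.
    by apply: filterS => u /= ->; rewrite /xsection/= inE/= /f.
pose B b := ~` N `&` S @^-1` (basic_set D b).
have -> : S @^-1` U = (N `&` S @^-1` U) `|`
    \bigcup_i (sequence_of (fun b => if `[< basic_set D b `<=` U >] then B b else set0) i).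
  rewrite bigcup_sequence_of; apply/seteqP; split => [x Ux|x [[]//|[b _]]].
    have [Nx|Nx] := pselect (N x); [by left|right].
    have [b bx bU] := basic_set_basis mD denseD oU Ux.
    by exists b => //; rewrite asboolT.
  by case: asboolP => // bU [_ /bU].
apply: measurableU.
  have [h0|h0] := pselect (U (\pi_(MPT lambda)%qT (Mpt id_mpt))).
    rewrite (_ : _ `&` _ = N)//; apply/seteqP; split => [x []//|x Nx]; split => //.
    by rewrite /S/= hN'.
  rewrite (_ : _ `&` _ = set0)//; apply/seteqP; split => [x [Nx]|//].
  by rewrite /S/= hN'.
apply: bigcupT_measurable => i; apply: sequence_of_ind => // b.
case: ifP => _ //; rewrite /B.
have -> : ~` N `&` S @^-1` basic_set D b = ~` N `&`
   \bigcap_(p in [set` b.1]) [set x | (lambda (xsection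
     (((snd \o F) @^-1` D p.1) `+` (snd @^-1` D p.2)) x) < (b.2.+1%:R^-1)%:E)%E].
  apply/seteqP; split => x [Nx hx]; split => //.
    by move=> p /= pb; apply/SE => //; exact: hx.
  by move=> p pb; apply/SE => //; exact: (hx p pb).
apply: measurableI; first exact: measurableC.
apply: fin_bigcap_measurable => [|p _]; first exact: finite_seq.
set E := _ `+` _.
have mk : measurable_fun setT (lambda \o xsection E).
  by apply: measurable_fun_xsection; exact: mW.
have := measurable_preimage mk (emeasurable_itv `]-oo, ((b.2.+1%:R^-1)%:E)[).
by congr measurable; apply/seteqP; split => x /=; rewrite in_itv.
Qed.

End skew_products_facts.

(** * Baire's theorem for skew products *)

Section weak_limits.
Context {R : realType} d (X : measurableType d) (mu : probability X R).
Local Notation I := (I01 R).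
Local Notation val := (@unit_itv_val R).
Local Notation lambda := (@lebesgue_I01 R).
Local Notation nu := (mu \x lambda)%E.

(** Two points of the interval more than 2^-k apart are separated by one of the
    2^k + 1 strips of level k. *)
Definition dyadic_strip (k i : nat) : set (X * I) :=
  snd @^-1` lt_set (i%:R * 2^-1 ^+ k).

Lemma measurable_dyadic_strip k i : measurable (dyadic_strip k i).
Proof. by apply: measurable_preimage => //; exact: measurable_lt_set. Qed.

Lemma dyadic_separation k (u v : I) : 2^-1 ^+ k < `|val u - val v| ->
  exists2 i, (i < (2 ^ k).+1)%N & (val u < i%:R * 2^-1 ^+ k) <> (val v < i%:R * 2^-1 ^+ k).
Proof.
have H (a b : I) : 2^-1 ^+ k < val b - val a ->
    exists2 i, (i < (2 ^ k).+1)%N & (val a < i%:R * 2^-1 ^+ k) /\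
      ~ (val b < i%:R * 2^-1 ^+ k).
  move=> ab; have k0 : (0 : R) < 2 ^+ k by rewrite exprn_gt0.
  have b0 : 0 <= val b * 2 ^+ k by rewrite mulr_ge0 ?val_ge0// ltW.
  have /andP[h1 h2] := truncn_itv b0.
  exists (Num.truncn (val b * 2 ^+ k)).
    rewrite ltnS -(ler_nat R); apply: le_trans h1 _.
    by rewrite natrX ler_piMl ?val_le1// ltW.
  rewrite exprVn !ltr_pdivlMr//; split; last by apply/negP; rewrite -leNgt.
  move: ab; rewrite exprVn -subr_gt0 -(pmulr_lgt0 _ k0) !mulrBl mulVf ?gt_eqF//.
  by move: h2; rewrite -natr1; lra.
move=> uv; have [h|h] := lerP (val u) (val v).
  have [|i ik [h1 h2]] := H u v; first by move: uv; rewrite ler0_norm ?subr_le0// opprB.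
  by exists i => // e; apply: h2; rewrite -e.
have [|i ik [h1 h2]] := H v u; first by move: uv; rewrite gtr0_norm ?subr_gt0.
by exists i => // e; apply: h2; rewrite e.
Qed.

(** The second coordinates converge in measure: they are more than 2^-(k+1)
    apart with probability at most (2^(k+1) + 1) 8^-(k+1) <= 2^-(k+1). *)
Lemma weak_cauchy_limit (a : X -> X) (Phi : nat -> X * I -> X * I) :
  measurable_fun setT a -> (forall k, mpres nu nu (Phi k)) ->
  (forall k, {ae nu, forall y, (Phi k y).1 = a y.1}) ->
  (forall k i, (i < (2 ^ k.+1).+1)%N ->
    sdist nu (Phi k.+1 @^-1` dyadic_strip k.+1 i) (Phi k.+2 @^-1` dyadic_strip k.+1 i)
      <= 8^-1 ^+ k.+1) ->
  exists phi, [/\ mpres nu nu phi, forall y, (phi y).1 = a y.1 &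
    forall A, measurable A -> forall e, 0 < e -> exists N, forall k, (N <= k)%N ->
      sdist nu (Phi k @^-1` A) (phi @^-1` A) < e].
Proof.
move=> ma mPhi fstPhi cauchyPhi.
have mph k : measurable_fun setT (Phi k) by case: (mPhi k).
pose f k := snd \o Phi k.
have mf k : measurable_fun setT (f k).
  exact: (measurableT_comp measurable_snd (mph k)).
have [|h mh fh] := @fast_cauchy_cvg _ _ _ nu f mf.
  case=> [|k].
    rewrite expr0; apply: prob_le1.
    have mg : measurable_fun setT (fun y => `|val (f 0%N y) - val (f 1%N y)|).
      apply: measurableT_comp => //; apply: measurable_funB;
        exact: (measurableT_comp measurable_val).
    have := measurable_preimage mg (measurable_itv `]((2^-1 : R) ^+ 0), +oo[).
    by congr measurable; apply/seteqP; split => y /=; rewrite in_itv/= andbT.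
  set E := [set _ | _].
  pose D i := (Phi k.+1 @^-1` dyadic_strip k.+1 i) `+` (Phi k.+2 @^-1` dyadic_strip k.+1 i).
  have mD i : measurable (D i).
    by apply: measurable_setY; apply: measurable_preimage => //; exact: measurable_dyadic_strip.
  have mE : measurable E.
    have mg : measurable_fun setT (fun y => `|val (f k.+1 y) - val (f k.+2 y)|).
      apply: measurableT_comp => //; apply: measurable_funB;
        exact: (measurableT_comp measurable_val).
    have := measurable_preimage mg (measurable_itv `]((2^-1 : R) ^+ k.+1), +oo[).
    by congr measurable; apply/seteqP; split => y /=; rewrite in_itv/= andbT.
  have ED : E `<=` \big[setU/set0]_(i < (2 ^ k.+1).+1) D i.
    move=> y /dyadic_separation[i ik hi]; rewrite -bigcup_mkord; exists i => //.
    rewrite /D /dyadic_strip /lt_set/=.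
    have [] := boolP (val (Phi k.+1 y).2 < i%:R * 2^-1 ^+ k.+1) => h1;
      have [] := boolP (val (Phi k.+2 y).2 < i%:R * 2^-1 ^+ k.+1) => h2.
    - by exfalso; apply: hi; rewrite /f/= h1 h2.
    - by left; split => //; exact/negP.
    - by right; split => //; exact/negP.
    - by exfalso; apply: hi; rewrite /f/= (negbTE h1) (negbTE h2).
  apply: le_trans (le_prob _ _ _ ED) _ => //; first exact: bigsetU_measurable.
  apply: le_trans (le_prob_bigsetU mD (cauchyPhi k)) _.
  (* 2 ^ (k + 1) + 1 <= 4 ^ (k + 1) *)
  have -> : (8^-1 : R) ^+ k.+1 = 2^-1 ^+ k.+1 * (4 ^+ k.+1)^-1.
    rewrite -exprVn -exprMn; congr (_ ^+ _); lra.
  rewrite mulrCA ler_piMr ?exprn_ge0// ?invr_ge0// ler_pdivrMr ?exprn_gt0// mul1r.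
  rewrite -natrX ler_nat (_ : 4 = 2 ^ 2)%N// -expnM mulnC expnM -mulnn.
  have : (2 <= 2 ^ k.+1)%N by rewrite -{1}(expn1 2) leq_exp2l.
  move: (2 ^ k.+1)%N => m m2; apply: (@leq_trans (m * 2)).
    by rewrite muln2 -addnn -addn1 leq_add2l (leq_trans _ m2).
  by rewrite leq_mul2l m2 orbT.
pose phi (y : X * I) : X * I := (a y.1, h y).
pose Phi' k (y : X * I) : X * I := (a y.1, f k y).
have ma1 : measurable_fun setT (fun y : X * I => a y.1).
  exact: (measurableT_comp ma measurable_fst).
have PhiE k : {ae nu, forall y, Phi k y = Phi' k y}.
  by apply: filterS (fstPhi k) => y h1; rewrite /Phi' -h1 [LHS]surjective_pairing.
have mPhi' k : mpres nu nu (Phi' k).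
  apply: (mpres_ae_eq (mPhi k)) (PhiE k).
  exact: measurable_fun_pair.
have [||mphi cvgphi] := @weak_cvg_in_measure R _ _ X _ mu nu Phi' phi mPhi' _ _ fh.
- exact: measurable_fun_pair.
- by [].
exists phi; split => // A mA e e0.
have [N hN] := cvgphi A mA e e0; exists N => k /hN.
apply: le_lt_trans; apply: le_trans (sdist_triangle (B := Phi' k @^-1` A) _ _ _ _) _;
  [exact: measurable_preimage|by apply: measurable_preimage => //; case: (mPhi' k)|
   by apply: measurable_preimage => //; case: mphi|].
rewrite (_ : sdist _ (Phi k @^-1` A) _ = 0) ?add0r//.
apply/sdist_ae; [exact: measurable_preimage|
  by apply: measurable_preimage => //; case: (mPhi' k)|].
by apply: filterS (PhiE k) => y /= ->.
Qed.

End weak_limits.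

Section baire_category.
Context {R : realType} d (X : measurableType d) (mu : probability X R).
Variable T : X -> X.
Local Notation I := (I01 R).
Local Notation lambda := (@lebesgue_I01 R).
Local Notation nu := (mu \x lambda)%E.
Local Notation K := (set_type (@skew_products R d X mu T)).
Hypothesis sX : countably_separated X.
Hypothesis hT : invertible_mpt mu T.

Definition skew_val (F : K) : MPT nu := set_val F.

Lemma skew_of_iso phi : mod0_isomorphism nu nu phi ->
  {ae nu, forall y, (phi y).1 = T y.1} ->
  exists F : K, {ae nu, forall y, skew_val F y = phi y}.
Proof.
move=> iphi phi1; pose g : mpt nu := Mpt iphi.
have h := MPT_fun_pi g.
have hs : @skew_products R d X mu T (\pi_(MPT nu)%qT g).
  apply: skew_products_of_fst => //.
  by apply: filterS2 h phi1 => y -> /= ->.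
by exists (SigSub (mem_set hs)).
Qed.

Lemma open_skew_wball (O : set K) (F : K) : open O -> O F -> exists AA e,
  [/\ finite_set AA, AA `<=` measurable, 0 < e &
     forall F' : K, wball (skew_val F) AA e (skew_val F') -> O F'].
Proof.
move=> [V oV <-] VF.
have [AA [e [h1 h2 h3 h4]]] := wball_nbhs (open_nbhs_nbhs (conj oV VF)).
by exists AA, e; split => // F' /h4.
Qed.

Lemma dense_skew_wball (W : set K) (F : K) AA e : dense W ->
  finite_set AA -> AA `<=` measurable -> 0 < e ->
  exists2 F' : K, W F' & wball (skew_val F) AA e (skew_val F').
Proof.
move=> dW finA mA e0.
have := nbhs_wball (skew_val F) finA mA e0; rewrite nbhsE => -[V [oV VF] VA].
have V0 : (skew_val @^-1` V : set K) !=set0 by exists F.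
have oV' : open (skew_val @^-1` V : set K) by exists V.
by have [F' [VF' WF']] := dW _ V0 oV'; exists F' => //; exact: VA.
Qed.

(** A weak limit of bijections need not be invertible, which is why the inverses
    G k are required to converge as well: the limits are inverse to each other. *)
Lemma skew_limit (F : nat -> K) (G : nat -> X * I -> X * I) :
  (forall k, mod0_inverse nu nu (skew_val (F k)) (G k)) ->
  (forall k i, (i < (2 ^ k.+1).+1)%N ->
    sdist nu (skew_val (F k.+1) @^-1` (@dyadic_strip R d X k.+1 i))
      (skew_val (F k.+2) @^-1` (@dyadic_strip R d X k.+1 i)) <= 8^-1 ^+ k.+1) ->
  (forall k i, (i < (2 ^ k.+1).+1)%N ->
    sdist nu (G k.+1 @^-1` (@dyadic_strip R d X k.+1 i))
      (G k.+2 @^-1` (@dyadic_strip R d X k.+1 i)) <= 8^-1 ^+ k.+1) ->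
  exists F0 : K, forall A, measurable A -> forall e, 0 < e ->
    exists N, forall k, (N <= k)%N ->
      sdist nu (skew_val (F k) @^-1` A) (skew_val F0 @^-1` A) < e.
Proof.
move=> FG cF cG.
have mT : measurable_fun setT T by case: hT.
have [psi [Tp psip psiT Tpsi]] := (mod0_inverseP mu mu T).1 hT.
have mpsi : measurable_fun setT psi by case: psip.
have F1 k : {ae nu, forall y, (skew_val (F k) y).1 = T y.1}.
  by apply: skew_fst => //; exact: set_mem (valP (F k)).
have G1 k : {ae nu, forall y, (G k y).1 = psi y.1}.
  have [Fp Gp GF FG'] := FG k.
  have h1 := mpres_ae Gp (F1 k).
  have h2 := mpres_ae Gp (mpres_ae (mpres_fst mu lambda) psiT).
  near=> y.
  have e1 : T (G k y).1 = y.1.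
    transitivity (skew_val (F k) (G k y)).1; first by apply/esym; near: y.
    by congr fst; near: y.
  by rewrite -e1; apply/esym; near: y.
have mF k : mpres nu nu (skew_val (F k)) by exact: MPT_mpres.
have mG k : mpres nu nu (G k) by case: (FG k).
have [f [mf f1 cvgf]] := weak_cauchy_limit mT mF F1 cF.
have [g [mg g1 cvgg]] := weak_cauchy_limit mpsi mG G1 cG.
have gfS S : measurable S -> {ae nu, forall y, S (g (f y)) <-> S y}.
  move=> mS.
  have mgS : measurable (g @^-1` S) by apply: measurable_preimage => //; case: mg.
  have mGS k : measurable (G k @^-1` S) by apply: measurable_preimage => //; case: (mG k).
  have m0 : measurable (f @^-1` (g @^-1` S)) by apply: measurable_preimage => //; case: mf.
  have m1 k : measurable (skew_val (F k) @^-1` (g @^-1` S)).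
    exact: measurable_MPT_preimage.
  have m2 k : measurable (skew_val (F k) @^-1` (G k @^-1` S)).
    exact: measurable_MPT_preimage.
  apply/(sdist_ae nu m0 mS)/eqP; rewrite eq_le sdist_ge0 andbT.
  apply/ler_addgt0Pr => e e0; rewrite add0r.
  have e2 : 0 < e / 2 by rewrite divr_gt0.
  have [N1 h1] := cvgf _ mgS _ e2; have [N2 h2] := cvgg _ mS _ e2.
  pose k := maxn N1 N2; have {}h1 := h1 k (leq_maxl _ _); have {}h2 := h2 k (leq_maxr _ _).
  have d1 := sdist_triangle nu m0 (m1 k) mS.
  have d2 := sdist_triangle nu (m1 k) (m2 k) mS.
  have d3 : sdist nu (skew_val (F k) @^-1` (G k @^-1` S)) S = 0.
    by apply/sdist_ae => //; case: (FG k) => _ _ h _; apply: filterS h => y /= ->.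
  move: d1 d2; rewrite d3 addr0 (sdist_mpres (mF k))//.
  by move: h1 h2; rewrite [X in X < _ -> _]sdistC [X in _ -> X < _ -> _]sdistC; clear; lra.
have [U mU sU] := countably_separated_I (R := R).
have gf : {ae nu, forall y, g (f y) = y}.
  have hU : {ae nu, forall y i, U i (g (f y)).2 <-> U i y.2}.
    by apply: ae_foralln => i; apply: (gfS (snd @^-1` U i)); exact: measurable_preimage.
  have hpsi := mpres_ae (mpres_fst mu lambda) psiT.
  apply: filterS2 hU hpsi => y hy psiy; rewrite [RHS]surjective_pairing.
  rewrite [LHS]surjective_pairing g1 f1 psiy; congr pair.
  exact: sU.
have [F0 hF0] : exists F0 : K, {ae nu, forall y, skew_val F0 y = f y}.
  apply: skew_of_iso; last by apply: aeW.
  apply/mod0_inverseP; exists g; apply: mod0_inverse_left => //; last by case: mg.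
  by apply: countably_separated_prod => //; exact: countably_separated_I.
exists F0 => A mA e e0; have [N hN] := cvgf A mA e e0; exists N => k /hN.
have mfA : measurable (f @^-1` A) by apply: measurable_preimage => //; case: mf.
have mFA (F' : K) : measurable (skew_val F' @^-1` A) by exact: measurable_MPT_preimage.
apply: le_lt_trans; apply: le_trans (sdist_triangle _ (mFA _) mfA (mFA _)) _.
rewrite (_ : sdist _ (f @^-1` A) _ = 0) ?addr0//.
by apply/sdist_ae => //; apply: filterS hF0 => y /= ->.
Unshelve. all: by end_near.
Qed.

Lemma skew_products_nonempty : exists F : K, True.
Proof.
have [||F _] := @skew_of_iso (fun y => (T y.1, y.2)); last by exists F.
- have [psi hpsi] := (mod0_inverseP mu mu T).1 hT.
  apply/mod0_inverseP; exists (fprod_map psi id); apply: (mod0_inverse_fprod_map (f := T) (g := id)) => //.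
  exact: mod0_inverse_id.
- exact: aeW.
Qed.

End baire_category.

Section baire_category_theorem.
Context {R : realType} d (X : measurableType d) (mu : probability X R).
Variable T : X -> X.
Local Notation I := (I01 R).
Local Notation lambda := (@lebesgue_I01 R).
Local Notation nu := (mu \x lambda)%E.
Local Notation K := (set_type (@skew_products R d X mu T)).
Hypothesis sX : countably_separated X.
Hypothesis hT : invertible_mpt mu T.

Let tail_arith (x z a b c : R) : z < b -> c <= b / 2 -> x <= 2 * a - 2 * b ->
  z + x <= 2 * a - 2 * c.
Proof. lra. Qed.

Let end_arith (x z a b : R) : z < a -> x <= 2 * a - 2 * b -> 0 < b -> 0 < a ->
  z + x < 4 * a.
Proof. lra. Qed.

(** The proof of Baire's theorem with weak balls, given by a finite family AA of
    sets and a radius. The families contain the dyadic strips and their preimages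
    under the inverse of F k. Testing F (k + 1) on the latter controls the inverse
    of F (k + 1), so that F k and its inverse are fast Cauchy sequences. *)
Lemma skew_products_baire (W : nat -> set K) :
  (forall k, open (W k)) -> (forall k, dense (W k)) -> exists F, forall k, W k F.
Proof.
move=> oW dW.
have /choice[inv hinv] := @MPT_inverse R _ (X * I)%type nu.
pose RR k (F : MPT nu) : set (set (X * I)) :=
  [set @dyadic_strip R d X k i | i in `I_(2 ^ k).+1] `|`
  [set inv F @^-1` (@dyadic_strip R d X k i) | i in `I_(2 ^ k).+1].
have finRR k F : finite_set (RR k F).
  by rewrite finite_setU; split; apply: finite_image; exact: finite_II.
have mRR k F : RR k F `<=` measurable.
  move=> _ [[i _ <-]|[i _ <-]]; first exact: measurable_dyadic_strip.
  apply: measurable_preimage; last exact: measurable_dyadic_strip.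
  by have [_ []] := hinv F.
pose St := (K * set (set (X * I)) * R)%type.
pose valid (s : St) := [/\ finite_set s.1.2, s.1.2 `<=` measurable & 0 < s.2].
have step (p : nat * St) : exists s' : St, valid p.2 -> valid s' /\
    [/\ wball (skew_val p.2.1.1) p.2.1.2 p.2.2 (skew_val s'.1.1),
        p.2.1.2 `<=` s'.1.2, s'.2 <= p.2.2 / 2 /\ s'.2 <= 8^-1 ^+ p.1.+1,
        RR p.1.+1 (skew_val s'.1.1) `<=` s'.1.2 &
        forall F', (forall A, s'.1.2 A -> sdist nu (skew_val F' @^-1` A)
           (skew_val s'.1.1 @^-1` A) < 4 * s'.2) -> W p.1 F'].
  case: p => k [[F AA] e] /=.
  have [[finA mA e0]|nv] := pselect (valid (F, AA, e)); last by exists (F, AA, e).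
  have [F' WF' FF'] := dense_skew_wball F (dW k) finA mA e0.
  have [BB [h [finB mB h0 hB]]] := open_skew_wball (oW k) WF'.
  have e80 : (0 : R) < 8^-1 ^+ k.+1 by rewrite exprn_gt0// invr_gt0.
  pose e' := Num.min (e / 2) (Num.min (h / 4) (8^-1 ^+ k.+1)).
  have e'0 : 0 < e' by rewrite !lt_min !divr_gt0.
  have l1 : e' <= e / 2 by rewrite /e' ge_min lexx.
  have l2 : e' <= h / 4 by rewrite /e' !ge_min lexx orbT.
  have l3 : e' <= 8^-1 ^+ k.+1 by rewrite /e' !ge_min lexx !orbT.
  exists (F', AA `|` BB `|` RR k.+1 (skew_val F'), e') => _; split.
    split => //=.
      by rewrite finite_setU; split; [rewrite finite_setU|exact: finRR].
    by move=> A [[/mA|/mB]|/mRR].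
  split.
  - exact: FF'.
  - by move=> A AA'; left; left.
  - by split.
  - by move=> A AA'; right.
  - move=> F'' hF''; apply: hB => A BA; apply: lt_le_trans (hF'' A _) _.
      by left; right.
    by move: (e') l2 => /= t; lra.
have /choice[next hnext] := step.
have [F0 _] := skew_products_nonempty hT.
pose fix s n : St := if n is m.+1 then next (m, s m) else (F0, set0, 1).
have vs n : valid (s n).
  elim: n => [|n IH]; first by split.
  by have [] := hnext (n, s n) IH.
pose F n := (s n).1.1; pose AA n := (s n).1.2; pose e n := (s n).2.
have hs n := (hnext (n, s n) (vs n)).2.
have near_s n A : AA n A ->
    sdist nu (skew_val (F n.+1) @^-1` A) (skew_val (F n) @^-1` A) < e n.
  by have [h _ _ _ _] := hs n; move=> /h.
have AAS n : AA n `<=` AA n.+1 by have [_ + _ _ _] := hs n.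
have eS n : e n.+1 <= e n / 2 by have [_ _ [+ _] _ _] := hs n.
have e8 n : e n.+1 <= 8^-1 ^+ n.+1 by have [_ _ [_ +] _ _] := hs n.
have RRA n : RR n.+1 (skew_val (F n.+1)) `<=` AA n.+1 by have [_ _ _ + _] := hs n.
have mAA n : AA n `<=` measurable by have [_ + _] := vs n.
have e0 n : 0 < e n by have [_ _] := vs n.
have mFA n A : measurable A -> measurable (skew_val (F n) @^-1` A).
  exact: measurable_MPT_preimage.
have tail n i A : AA n A ->
    AA (n + i)%N A /\
    sdist nu (skew_val (F (n + i)%N) @^-1` A) (skew_val (F n) @^-1` A) <=
      2 * e n - 2 * e (n + i)%N.
  move=> AnA; elim: i => [|i [IH1 IH2]]; first by rewrite addn0 subrr sdistxx.
  have mA := mAA _ _ AnA; rewrite addnS; split; first exact: AAS.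
  apply: le_trans (sdist_triangle _ (mFA _ _ mA) (mFA (n + i)%N _ mA) (mFA _ _ mA)) _.
  exact: tail_arith (near_s _ _ IH1) (eS _) IH2.
pose G n := inv (skew_val (F n)).
have FG n : mod0_inverse nu nu (skew_val (F n)) (G n) by exact: hinv.
have [|k i ik|Finf cvgF] := skew_limit sX hT FG.
- move=> k i ik; rewrite sdistC; apply: ltW; apply: lt_le_trans (e8 k).
  by apply: near_s; apply: RRA; left; exists i.
- have [Fp Gp GF FG'] := FG k.+2; have [_ Gp' GF' _] := FG k.+1.
  have mS := @measurable_dyadic_strip R _ X k.+1 i.
  have mGS : measurable (G k.+1 @^-1` (@dyadic_strip R d X k.+1 i)).
    by apply: measurable_preimage => //; case: Gp'.
  have mGS' : measurable (G k.+2 @^-1` (@dyadic_strip R d X k.+1 i)).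
    by apply: measurable_preimage => //; case: Gp.
  rewrite -(sdist_mpres Fp)//.
  set C := G k.+1 @^-1` _.
  have h := near_s k.+1 C; have {}h : sdist nu (skew_val (F k.+2) @^-1` C)
      (skew_val (F k.+1) @^-1` C) < e k.+1.
    by apply: h; apply: RRA; right; exists i.
  have e1 : sdist nu (skew_val (F k.+1) @^-1` C) (@dyadic_strip R d X k.+1 i) = 0.
    by apply/sdist_ae => //; [exact: mFA|apply: filterS GF' => y; rewrite /C/= => ->].
  have e2 : sdist nu (@dyadic_strip R d X k.+1 i)
      (skew_val (F k.+2) @^-1` (G k.+2 @^-1` (@dyadic_strip R d X k.+1 i))) = 0.
    by apply/sdist_ae => //; [exact: mFA|apply: filterS GF => y /= ->].
  have d1 := sdist_triangle nu (mFA k.+2 _ mGS) (mFA k.+1 _ mGS) (mFA k.+2 _ mGS').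
  have d2 := sdist_triangle nu (mFA k.+1 _ mGS) mS (mFA k.+2 _ mGS').
  rewrite e2 addr0 in d2; rewrite e1 in d2.
  apply: le_trans d1 _; apply: le_trans (lerD (ltW h) d2) _.
  by rewrite addr0; exact: e8.
exists Finf => k; have [_ _ _ _] := hs k; apply => A AA'.
have mA := mAA k.+1 A AA'.
have [N hN] := cvgF A mA (e k.+1) (e0 _).
have {}hN := hN (k.+1 + N)%N (leq_addl _ _).
have [_ ht] := tail k.+1 N A AA'.
have mInf : measurable (skew_val Finf @^-1` A) by exact: measurable_MPT_preimage.
have d1 := sdist_triangle nu mInf (mFA (k.+1 + N)%N _ mA) (mFA k.+1 _ mA).
rewrite sdistC in hN; apply: le_lt_trans d1 _.
exact: end_arith hN ht (e0 _) (e0 _).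
Qed.

End baire_category_theorem.

(** * Names and Hamming balls *)

Section finite_sums.
Context {R : realType} d (Y : measurableType d) (nu : probability Y R).

Lemma prob_bigcup_fin (I : finType) (F : I -> set Y) :
  (forall i, measurable (F i)) -> (forall i j, i != j -> F i `&` F j = set0) ->
  prob nu (\bigcup_i F i) = \sum_i prob nu (F i).
Proof.
move=> mF dF.
have H (s : seq I) : uniq s -> measurable (\bigcup_(i in [set` s]) F i) /\
    prob nu (\bigcup_(i in [set` s]) F i) = \sum_(i <- s) prob nu (F i).
  elim: s => [_|i s IH /= /andP[is_ us]].
    by rewrite big_nil (_ : [set` [::]] = set0) ?bigcup_set0 ?prob0//; apply/seteqP; split.
  have [mU IHs] := IH us.
  have -> : \bigcup_(j in [set` i :: s]) F j = F i `|` \bigcup_(j in [set` s]) F j.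
    apply/seteqP; split => [y [j /=]|y [Fi|[j /= js Fj]]].
    - by rewrite inE => /predU1P[->|js Fj]; [left|right; exists j].
    - by exists i => //=; rewrite mem_head.
    - by exists j => //=; rewrite inE js orbT.
  rewrite big_cons; split; first exact: measurableU.
  rewrite prob_U// ?IHs//; rewrite setI_bigcupr bigcup0// => j /= js.
  by apply: dF; apply: contraNneq is_ => ->.
have [_] := H (enum I) (enum_uniq I); rewrite big_enum/= => <-.
congr prob; apply/seteqP; split => y [i _ Fy]; exists i => //=.
by rewrite mem_enum.
Qed.

(** Markov's inequality. *)
Lemma markov_count (D : nat -> set Y) n (c : R) : (forall i, measurable (D i)) ->
  0 <= c ->
  c * prob nu [set y | c <= \sum_(i < n) \1_(D i) y] <= \sum_(i < n) prob nu (D i).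
Proof.
move=> mD c0; set E := [set y | _].
have mf : measurable_fun setT (fun y => \sum_(i < n) \1_(D i) y : R).
  by apply: measurable_sum => i; exact: measurable_indic.
have mE : measurable E.
  have := measurable_preimage mf (measurable_itv `[c, +oo[).
  by congr measurable; apply/seteqP; split => y /=; rewrite in_itv/= andbT.
rewrite -lee_fin EFinM probK// -sumEFin.
under eq_bigr do rewrite probK//.
have -> : (c%:E * nu E = \int[nu]_y (c%:E * (\1_E y)%:E))%E.
  rewrite ge0_integralZl//; last by apply/measurable_EFinP; exact: measurable_indic.
  by rewrite integral_indic// setIT.
have -> : (\sum_(i < n) nu (D i) = \int[nu]_y (\sum_(i < n) (\1_(D i) y)%:E))%E.
  rewrite ge0_integral_sum//; last first.
    by move=> i; apply/measurable_EFinP; exact: measurable_indic.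
  by apply: eq_bigr => i _; rewrite integral_indic// setIT.
apply: ge0_le_integral => //.
- by move=> y _; rewrite -EFinM lee_fin mulr_ge0.
- by apply/measurable_EFinP; apply: measurable_funM => //; exact: measurable_indic.
- apply: (eq_measurable_fun (fun y => (\sum_(i < n) \1_(D i) y)%:E)).
    by move=> y _; rewrite sumEFin.
  exact/measurable_EFinP.
- move=> y _; rewrite -EFinM sumEFin lee_fin.
  have [yE|yE] := boolP (y \in E).
    by rewrite indicE yE mulr1; exact: set_mem.
  by rewrite indicE (negbTE yE) mulr0; apply: sumr_ge0.
Qed.

End finite_sums.

Section names.
Context (Y : Type).
Implicit Types (F : Y -> Y) (A : set Y) (w : nat -> bool).

(** The Hamming distance between w and the A-name of y under F, in time n. *)
Definition mismatch F A w n (y : Y) : nat :=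
  \sum_(i < n) ((iter i F y \in A) != w i).

(** A Hamming ball in the space of names, of radius n / 8. *)
Definition near_word F A w n : set Y := [set y | (8 * mismatch F A w n y <= n)%N].

End names.

Section names_measure.
Context {R : realType} d (Y : measurableType d).
Implicit Types (F : Y -> Y) (A : set Y) (w : nat -> bool) (y : Y).

Lemma measurable_iter (F : Y -> Y) n :
  measurable_fun setT F -> measurable_fun setT (iter n F).
Proof.
by move=> mF; elim: n => [|n IH]; [exact: measurable_id|exact: measurableT_comp].
Qed.

Definition mismatch_at (F : Y -> Y) (A : set Y) (w : nat -> bool) (i : nat) : set Y :=
  [set y | (iter i F y \in A) != w i].

Lemma measurable_mismatch_at F A w i : measurable_fun setT F -> measurable A ->
  measurable (mismatch_at F A w i).
Proof.
move=> mF mA; have mi := measurable_preimage (measurable_iter i mF) mA.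
have [wi|wi] := boolP (w i).
  have -> : mismatch_at F A w i = ~` (iter i F @^-1` A).
    apply/seteqP; split => y; rewrite /mismatch_at/= wi.
      by move=> h Ay; rewrite mem_set in h.
    by move=> h; rewrite memNset.
  exact: measurableC.
have -> : mismatch_at F A w i = iter i F @^-1` A.
  apply/seteqP; split => y; rewrite /mismatch_at/= (negbTE wi).
    by rewrite eqbF_neg negbK => /set_mem.
  by move=> h; rewrite mem_set.
by [].
Qed.

Lemma mismatchE F A w n y :
  (mismatch F A w n y)%:R = \sum_(i < n) \1_(mismatch_at F A w i) y :> R.
Proof.
rewrite natr_sum; apply: eq_bigr => i _; rewrite indicE; congr (_%:R).
congr nat_of_bool; apply/idP/idP; first exact: mem_set.
exact: set_mem.
Qed.

Lemma near_wordE F A w n y :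
  near_word F A w n y <-> 8 * \sum_(i < n) \1_(mismatch_at F A w i) y <= n%:R :> R.
Proof. by rewrite -mismatchE -natrM ler_nat. Qed.

Lemma measurable_near_word F A w n : measurable_fun setT F -> measurable A ->
  measurable (near_word F A w n).
Proof.
move=> mF mA.
have mf : measurable_fun setT (fun y => 8 * \sum_(i < n) \1_(mismatch_at F A w i) y : R).
  apply: measurable_funM => //; apply: measurable_sum => i.
  by apply: measurable_indic; exact: measurable_mismatch_at.
have := measurable_preimage mf (measurable_itv `]-oo, n%:R]).
congr measurable; apply/seteqP; split => y /=; rewrite in_itv/=.
  by move=> /near_wordE.
by move=> h; apply/near_wordE.
Qed.

Lemma eq_mismatch F F' A A' w n (y : Y) :
  (forall i, (i < n)%N -> iter i F y \in A = (iter i F' y \in A')) ->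
  mismatch F A w n y = mismatch F' A' w n y.
Proof. by move=> h; apply: eq_bigr => i _; rewrite h. Qed.

End names_measure.

(** * Zero entropy forces heavy Hamming balls *)

Section entropy_lower_bound.
Context {R : realType} d (X : measurableType d) (mu : probability X R).
Variable T : X -> X.
Hypothesis mT : mpres mu mu T.
Variables (k : nat) (xi : X -> 'I_k).
Hypothesis mxi : finite_partition xi.

Let mTf : measurable_fun setT T. Proof. by case: mT. Qed.

Lemma measurable_label (P : pred 'I_k) : measurable [set x | P (xi x)].
Proof.
have -> : [set x | P (xi x)] = \bigcup_(j in [set j | P j]) (xi @^-1` [set j]).
  by apply/seteqP; split => [x Px|x [j /= Pj ->]] //; exists (xi x).
apply: fin_bigcup_measurable => //; exact: sub_finite_set (@finite_finset _ setT).
Qed.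

Lemma measurable_join_cell n (w : {ffun 'I_n -> 'I_k}) : measurable (join_cell T xi w).
Proof.
have -> : join_cell T xi w = \bigcap_(i in [set: 'I_n]) (iter i T @^-1` (xi @^-1` [set w i])).
  by apply/seteqP; split => [x h i _|x h i] /=; [exact: h|exact: (h i Logic.I)].
apply: fin_bigcap_measurable => [|i _]; first exact: finite_finset.
by apply: measurable_preimage; [exact: measurable_iter|exact: mxi].
Qed.

Lemma sum_join_cell n (G : set X) : measurable G ->
  \sum_(w : {ffun 'I_n -> 'I_k}) prob mu (join_cell T xi w `&` G) = prob mu G.
Proof.
move=> mG; rewrite -prob_bigcup_fin.
- congr prob; apply/seteqP; split => [x [w _ []]//|x Gx].
  by exists [ffun i : 'I_n => xi (iter i T x)] => //; split => // i; rewrite ffunE.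
- by move=> w; apply: measurableI => //; exact: measurable_join_cell.
- move=> w w' ww'; apply/seteqP; split => // x [[h _] [h' _]].
  by move/eqP: ww'; apply; apply/ffunP => i; rewrite -h -h'.
Qed.

Lemma join_entropyE n : join_entropy mu T xi n =
  \sum_(w : {ffun 'I_n -> 'I_k})
    prob mu (join_cell T xi w) * - ln (prob mu (join_cell T xi w)).
Proof. by rewrite /join_entropy -sumrN; apply: eq_bigr => w _; rewrite mulrN. Qed.

Let mln_ge0 (p : R) : p <= 1 -> 0 <= - ln p.
Proof. by move=> p1; rewrite oppr_ge0; exact: ln_le0. Qed.

Lemma join_entropy_ge0 n : 0 <= join_entropy mu T xi n.
Proof.
rewrite join_entropyE; apply: sumr_ge0 => w _; apply: mulr_ge0; first exact: prob_ge0.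
by apply: mln_ge0; apply: prob_le1; exact: measurable_join_cell.
Qed.

(** From ln t <= t - 1 at t = p / q. *)
Let ln_ineq (q p c : R) : 0 <= q -> q <= p -> p <= 1 -> 0 < c -> q < c ->
  q * - ln c <= p * - ln p + (p - q).
Proof.
move=> q0 qp p1 c0 qc; have p0 : 0 <= p by exact: le_trans qp.
move: q0; rewrite le_eqVlt => /predU1P[<-|q0].
  by rewrite mul0r subr0; apply: addr_ge0 => //; apply: mulr_ge0 => //; exact: mln_ge0.
have {}p0 : 0 < p by exact: lt_le_trans qp.
have h1 : q * - ln c <= q * - ln q.
  by apply: ler_wpM2l; [exact: ltW|rewrite lerN2 ler_ln ?posrE// ltW].
have h2 : ln (p / q) <= p / q - 1.
  have := @le_ln1Dx R (p / q - 1); rewrite (addrC 1) subrK; apply.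
  by have : 0 < p / q by [exact: divr_gt0]; lra.
have h3 : q * ln (p / q) <= p - q.
  have := ler_wpM2l (ltW q0) h2; rewrite mulrBr mulr1 mulrCA divff ?gt_eqF//.
  by rewrite mulr1.
have h4 : q * - ln p <= p * - ln p by rewrite ler_wpM2r// mln_ge0.
apply: le_trans h1 _; move: h3; rewrite ln_div ?posrE// mulrBr.
by move: h4; rewrite !mulrN; lra.
Qed.

(** The labelling xi predicts membership in A up to an error B of measure at most
    1/16. By Markov's inequality the orbit meets B at most n / 8 times, except on
    a set E of measure at most 1/2. Off E, points of one cell of the join have
    names near the same word. If all cells had measure less than
    exp (- 2 (H + 1)) off E, where H is the entropy of the join, then summing
    ln_ineq over the cells would give H + 1 <= H + 1/2. *)
Lemma heavy_word (A : set X) (a : 'I_k -> bool) n :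
  measurable A -> (0 < n)%N ->
  16 * prob mu [set x | (x \in A) != a (xi x)] <= 1 ->
  exists w, expR (- (2 * (join_entropy mu T xi n + 1))) <= prob mu (near_word T A w n).
Proof.
move=> mA n0 hB; set B := [set x | _] in hB; set H := join_entropy mu T xi n.
have mB : measurable B.
  have mY := measurable_setY mA (measurable_label a).
  move: mY; congr measurable; apply/seteqP; split => x; rewrite /B/=.
    by case=> -[h1 h2]; [rewrite mem_set//; case: (a _) h2|rewrite memNset// h1].
  have [/set_mem h1|/negP h1] := boolP (x \in A); case: (a _) => //= _; [left|right];
    split => //; by move=> h; apply: h1; exact: mem_set.
pose D i := iter i T @^-1` B.
have mD i : measurable (D i) by apply: measurable_preimage => //; exact: measurable_iter.
pose E := [set x | n%:R / 8 <= \sum_(i < n) \1_(D i) x :> R].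
have n0R : (0 : R) < n%:R by rewrite ltr0n.
have mE : measurable E.
  have mf : measurable_fun setT (fun y => \sum_(i < n) \1_(D i) y : R).
    by apply: measurable_sum => i; exact: measurable_indic.
  have := measurable_preimage mf (measurable_itv `[n%:R / 8, +oo[).
  by congr measurable; apply/seteqP; split => y /=; rewrite in_itv/= andbT.
have pE : prob mu E <= 1 / 2.
  have := markov_count mu n mD (ltW (divr_gt0 n0R (ltr0n _ 8))).
  have -> : \sum_(i < n) prob mu (D i) = n%:R * prob mu B.
    rewrite -[n in RHS]card_ord -sum1_card natr_sum mulr_suml; apply: eq_bigr => i _.
    by rewrite mul1r (prob_mpres (mpres_iter i mT)).
  rewrite -/E mulrAC ler_pdivrMr// -mulrA ler_pM2l// => h; lra.
pose G := ~` E; have mG : measurable G by exact: measurableC.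
have pG : 1 / 2 <= prob mu G by rewrite prob_C//; lra.
have [w hw] : exists w : {ffun 'I_n -> 'I_k},
    expR (- (2 * (H + 1))) <= prob mu (join_cell T xi w `&` G).
  apply: contrapT => /forallNP hw.
  have hlt (w : {ffun 'I_n -> 'I_k}) :
      prob mu (join_cell T xi w `&` G) < expR (- (2 * (H + 1))).
    by rewrite ltNge; apply/negP; exact: hw.
  have mC w := @measurable_join_cell n w.
  have hs : \sum_(w : {ffun 'I_n -> 'I_k}) prob mu (join_cell T xi w `&` G) * (2 * (H + 1)) <=
      \sum_(w : {ffun 'I_n -> 'I_k}) (prob mu (join_cell T xi w) * - ln (prob mu (join_cell T xi w))
        + (prob mu (join_cell T xi w) - prob mu (join_cell T xi w `&` G))).
    apply: ler_sum => w _.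
    have := @ln_ineq (prob mu (join_cell T xi w `&` G)) (prob mu (join_cell T xi w))
      (expR (- (2 * (H + 1)))).
    rewrite expRK opprK; apply => //.
    - exact: prob_ge0.
    - by apply: le_prob => //; exact: measurableI.
    - exact: prob_le1.
    - exact: expR_gt0.
  move: hs; rewrite -mulr_suml big_split/= -join_entropyE -/H sumrB sum_join_cell//.
  have -> : \sum_(w : {ffun 'I_n -> 'I_k}) prob mu (join_cell T xi w) = 1.
    rewrite -(probT mu) -(sum_join_cell n measurableT).
    by apply: eq_bigr => w _; rewrite setIT.
  have H0 := join_entropy_ge0 n; rewrite -/H in H0.
  have : 1 / 2 * (2 * (H + 1)) <= prob mu G * (2 * (H + 1)).
    by rewrite ler_wpM2r//; lra.
  by move: pG; lra.
(* The word of the cell w; its values beyond n do not matter. *)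
pose w' i := if insub i is Some j then a (w j) else false.
exists w'; apply: le_trans hw _; apply: le_prob.
- by apply: measurableI => //; exact: measurable_join_cell.
- exact: measurable_near_word.
move=> x [xw /negP]; rewrite /= -ltNge => Gx; apply/(near_wordE (R := R)).
have -> : \sum_(i < n) \1_(mismatch_at T A w' i) x = \sum_(i < n) \1_(D i) x :> R.
  apply: eq_bigr => i _; rewrite !indicE; congr (_%:R); congr nat_of_bool.
  have e : a (xi (iter i T x)) = w' i.
    by rewrite xw /w' valK.
  by apply/idP/idP => /set_mem h; apply/mem_set; move: h; rewrite /mismatch_at /D /B/= e.
by move: Gx; rewrite ltr_pdivlMr// mulrC => /ltW.
Qed.

Lemma zero_entropy_small : entropy mu T = 0%E -> forall c : R, 0 < c ->
  exists N, forall n, (N <= n)%N -> (0 < n)%N -> join_entropy mu T xi n < c * n%:R.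
Proof.
move=> h0 c c0.
have h : (partition_entropy mu T xi < c%:E)%E.
  apply: (@le_lt_trans _ _ 0%E); last by rewrite lte_fin.
  by rewrite -h0; apply: ereal_sup_ubound; exists k, xi.
have [_ [V [N _ NV] <-] hV] := ereal_inf_lt h.
exists N => n Nn n0; have n0R : (0 : R) < n%:R by rewrite ltr0n.
rewrite -ltr_pdivrMr// -lte_fin; apply: le_lt_trans hV.
by apply: ereal_sup_ubound; exists n => //; exact: NV.
Qed.

End entropy_lower_bound.

(** * Skew products with light Hamming balls *)

(** The image of an orbit of F is an orbit of G, and both have the same name. *)
Lemma near_word_factor (R : realType) d1 d2 (Y : measurableType d1)
    (Z : measurableType d2) (nu : probability Y R) (rho : probability Z R)
    (phi : Y -> Z) (F : Y -> Y) (G : Z -> Z) (A : set Y) (A' : set Z) w n :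
  mpres nu rho phi -> mpres nu nu F -> measurable_fun setT G ->
  measurable A -> measurable A' ->
  {ae nu, forall y, phi (F y) = G (phi y)} -> {ae nu, forall y, A y <-> A' (phi y)} ->
  prob nu (near_word F A w n) = prob rho (near_word G A' w n).
Proof.
move=> mphi mF mG mA mA' phiF AA'.
have mN := measurable_near_word (R := R) w n mG mA'.
have mphi' : measurable_fun setT phi by case: mphi.
have mF' : measurable_fun setT F by case: mF.
rewrite -(prob_mpres mphi mN); apply: (congr1 fine); apply: ae_eq_measure.
- exact: (measurable_near_word (R := R)).
- exact: measurable_preimage.
have h i := mpres_ae (mpres_iter i mF) phiF.
have h' i := mpres_ae (mpres_iter i mF) AA'.
have := ae_foralln h'; have := ae_foralln h; apply: filterS2 => y hy hy'.
have it i : phi (iter i F y) = iter i G (phi y).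
  by elim: i => // i IH; rewrite [in LHS]iterS hy IH.
suff : mismatch F A w n y = mismatch G A' w n (phi y) by rewrite /near_word/= => ->.
apply: eq_bigr => i _; rewrite -it; congr (nat_of_bool (_ != _)).
by apply/idP/idP => /set_mem h0; apply/mem_set/hy'.
Qed.

Section complex_skew_products.
Context {R : realType} d (X : measurableType d) (mu : probability X R).
Variable T : X -> X.
Local Notation I := (I01 R).
Local Notation lambda := (@lebesgue_I01 R).
Local Notation nu := (mu \x lambda)%E.
Local Notation K := (set_type (@skew_products R d X mu T)).
Variable U : nat -> set X.

Definition lower_half : set (X * I) := snd @^-1` lt_set 2^-1.

Lemma measurable_lower_half : measurable lower_half.
Proof. by apply: measurable_preimage => //; exact: measurable_lt_set. Qed.

Definition level_partition m (x : X) : 'I_#|{ffun 'I_m -> bool}| :=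
  enum_rank (signature U m x).

(** The measure that heavy_word finds in some ball. *)
Definition ball_threshold m n : R :=
  expR (- (2 * (join_entropy mu T (level_partition m) n + 1))).

(** The balls of some time n are too light for a system isomorphic to T, if the
    names of T can be read off from the m-th partition. The bound c, which is the
    same for all words, leaves room to perturb F, so that the condition is open. *)
Definition complex_at m : set K := [set F | exists n c,
  [/\ (0 < n)%N, c < ball_threshold m n &
      forall w, prob nu (near_word (skew_val F) lower_half w n) <= c]].

Lemma iter_preimage (Y : Type) (F : Y -> Y) n (A : set Y) :
  iter n.+1 F @^-1` A = F @^-1` (iter n F @^-1` A).
Proof. by apply/seteqP; split => y /=; rewrite -iterS iterSr. Qed.

(** The preimages F'^-i A and F^-i A are close for all i < n, by induction on i,
    since the preimages of F^-i A under F' and F are. *)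
Lemma near_word_perturb (F F' : MPT nu) (A : set (X * I)) n e w : measurable A ->
  wball F [set iter i F @^-1` A | i in `I_n] e F' ->
  prob nu (near_word F' A w n) <= prob nu (near_word F A w n) + n%:R * (n%:R * e).
Proof.
move=> mA hF'.
have mF : measurable_fun setT F by case: (MPT_mpres F).
have mF' : measurable_fun setT F' by case: (MPT_mpres F').
have mi i : measurable (iter i F @^-1` A) by apply: measurable_preimage => //; exact: measurable_iter.
have mi' i : measurable (iter i F' @^-1` A) by apply: measurable_preimage => //; exact: measurable_iter.
case: (posnP n) => [->|n0].
  rewrite mul0r addr0 (_ : near_word F' A w 0 = near_word F A w 0)//.
  by apply/seteqP; split => y; rewrite /near_word/= /mismatch !big_ord0.
have e0 : 0 <= e.
  have h := hF' _ (ex_intro2 _ _ 0%N n0 erefl).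
  exact: ltW (le_lt_trans (sdist_ge0 _ _ _) h).
have close i : (i <= n)%N -> sdist nu (iter i F' @^-1` A) (iter i F @^-1` A) <= i%:R * e.
  elim: i => [|i IH] ni; first by rewrite sdistxx mul0r.
  rewrite !iter_preimage -natr1 mulrDl mul1r.
  apply: le_trans (sdist_triangle (B := F' @^-1` (iter i F @^-1` A)) _ _ _ _) _;
    [exact: measurable_MPT_preimage..|].
  apply: lerD; first by rewrite (sdist_mpres (MPT_mpres F'))// IH// ltnW.
  by apply/ltW/hF'; exists i.
pose D i := (iter i F' @^-1` A) `+` (iter i F @^-1` A).
have mD i : measurable (D i) by exact: measurable_setY.
have sub : near_word F' A w n `<=` near_word F A w n `|` \big[setU/set0]_(i < n) D i.
  move=> y hy; have [yD|yD] := pselect ((\big[setU/set0]_(i < n) D i) y); [by right|left].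
  rewrite /near_word/= (eq_mismatch (F' := F') (A' := A))// => i ni.
  apply/idP/idP => /set_mem h; apply/mem_set; apply: contrapT => h';
    apply: yD; rewrite -bigcup_mkord; exists i => //; [right|left]; by split.
have mN := measurable_near_word (R := R) w n mF mA.
have mU : measurable (\big[setU/set0]_(i < n) D i) by exact: bigsetU_measurable.
have mNU := measurableU _ _ mN mU.
apply: le_trans (le_prob nu (measurable_near_word (R := R) w n mF' mA) mNU sub) _.
apply: le_trans (le_probU _ mN mU) _; rewrite lerD2l.
apply: le_prob_bigsetU => // i /ltnW ni; apply: le_trans (close i ni) _.
by rewrite ler_wpM2r// ler_nat.
Qed.

Lemma nbhs_skew_val (F : K) (A : set (MPT nu)) : nbhs (skew_val F) A ->
  nbhs F [set F' : K | A (skew_val F')].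
Proof.
rewrite nbhsE => -[V [oV VF] VA].
have oV' : open [set F' : K | V (skew_val F')] by exists V.
by apply: filterS (open_nbhs_nbhs (conj oV' VF)) => F' /VA.
Qed.

Lemma open_complex_at m : open (complex_at m).
Proof.
rewrite openE => F [n [c [n0 cn hF]]].
have n0R : (0 : R) < n%:R by rewrite ltr0n.
pose e := (ball_threshold m n - c) / 2 / (n%:R * n%:R).
have e0 : 0 < e by rewrite !divr_gt0 ?mulr_gt0// subr_gt0.
pose AA := [set iter i (skew_val F) @^-1` lower_half | i in `I_n].
have mF : measurable_fun setT (skew_val F) by case: (MPT_mpres (skew_val F)).
have nA : nbhs (skew_val F) (wball (skew_val F) AA e).
  apply: nbhs_wball => //; first by apply: finite_image; exact: finite_II.
  move=> _ [i _ <-]; apply: measurable_preimage; first exact: measurable_iter.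
  exact: measurable_lower_half.
have : nbhs F [set F' : K | wball (skew_val F) AA e (skew_val F')].
  exact: nbhs_skew_val.
apply: filterS => F' hF'.
exists n, (c + (ball_threshold m n - c) / 2); split => //; first by lra.
move=> w; apply: le_trans (near_word_perturb w measurable_lower_half hF') _.
apply: lerD; first exact: hF.
by rewrite mulrA /e mulrCA divff ?mulr1// gt_eqF// mulr_gt0.
Qed.

Hypothesis mU : forall i, measurable (U i).

Lemma finite_level_partition m : finite_partition (level_partition m).
Proof.
move=> j; have -> : level_partition m @^-1` [set j] = [set x | signature U m x = enum_val j].
  apply/seteqP; split => x; rewrite /level_partition/=; first by move=> <-; rewrite enum_rankK.
  by move=> ->; rewrite enum_valK.
exact: measurable_signature.
Qed.

Lemma determined_label m (S : set X) : determined U m S ->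
  exists a, forall x, (x \in S) = a (level_partition m x).
Proof.
move=> [W ->]; exists (fun j => enum_val j \in W) => x.
rewrite /level_partition enum_rankK; apply/idP/idP; first exact: set_mem.
exact: mem_set.
Qed.

Hypothesis genU : @measurable _ X = <<s range U >>.
Hypothesis hT : invertible_mpt mu T.

(** An isomorphism carries the lower half to a set A of X. Up to measure 1/16, A
    is a union of cells of some partition m of the sequence, so that heavy_word
    contradicts complex_at m. *)
Lemma not_isomorphic (F : K) : (forall m, complex_at m F) ->
  ~ isomorphic nu (skew_val F) mu T.
Proof.
move=> hF [phi iphi phiF].
have [psi [phip psip psiphi phipsi]] := (mod0_inverseP nu mu phi).1 iphi.
have mT := mod0_mpres hT.
have mTf : measurable_fun setT T by case: mT.
have mpF := MPT_mpres (skew_val F); have mF := proj1 mpF.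
pose A := psi @^-1` lower_half.
have mA : measurable A.
  by apply: measurable_preimage; [case: psip|exact: measurable_lower_half].
have e16 : (0 : R) < 16^-1 by rewrite invr_gt0 ltr0n.
have [m [S [dS hS]]] := determined_dense mU genU mu mA e16.
have [a ha] := determined_label dS.
have mS : measurable S by exact: measurable_determined dS.
have [n [c [n0 cn hc]]] := hF m.
have [|w hw] := heavy_word mT (@finite_level_partition m) (a := a) mA n0.
  have -> : [set x | (x \in A) != a (level_partition m x)] = A `+` S.
    apply/seteqP; split => x /=; rewrite -ha.
      have [/set_mem h1|/negP h1] := boolP (x \in A);
        have [/set_mem h2|/negP h2] := boolP (x \in S) => //= _; [left|right]; split => //.
        by move=> h; apply: h2; exact: mem_set.
      by move=> h; apply: h1; exact: mem_set.
    by move=> [[h1 h2]|[h1 h2]]; rewrite (mem_set h1) (memNset h2).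
  by move: hS; rewrite /sdist; move: (prob _ _) => p; lra.
have e : prob nu (near_word (skew_val F) lower_half w n) = prob mu (near_word T A w n).
  apply: (near_word_factor _ _ phip mpF mTf) => //; first exact: measurable_lower_half.
  by apply: filterS psiphi => y /= h; rewrite /A/= h.
by have := lt_le_trans cn hw; rewrite -e ltNge hc.
Qed.

End complex_skew_products.

(** * Binary digits: isomorphisms between cubes and the interval *)

Lemma ler_half_dist (R : realFieldType) (a b e : R) :
  `|a - b| <= e -> `|a / 2 - b / 2| <= 2^-1 * e.
Proof. by rewrite !ler_norml; lra. Qed.

Section binary_digits.
Context {R : realType}.
Local Notation I := (I01 R).
Local Notation val := (@unit_itv_val R).
Local Notation lambda := (@lebesgue_I01 R).
Local Notation kappa := (bernoulli_prob (2^-1 : R)).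

Lemma prob_coin (b : bool) : prob kappa [set b] = 2^-1.
Proof.
have half01 : 0 <= (2^-1 : R) <= 1 by lra.
apply: etrans (congr1 fine (bernoulli_probE half01 _)) _.
rewrite !diracE /mathcomp.classical.unstable.onem; case: b.
  by rewrite mem_set// memNset//= mulr0 addr0 mulr1.
by rewrite memNset// mem_set//= mulr0 add0r mulr1; lra.
Qed.

(** Dyadic numbers have two expansions; these definitions choose the one that
    ends in zeros, except for the point 1, all of whose digits are 1. So cons_digit
    is a right inverse everywhere, and a left inverse away from 1. *)
Definition hd_digit (u : I) : bool := 2^-1 <= val u.
Definition tl_digits (u : I) : I := mkI (2 * val u - (hd_digit u)%:R).
Definition cons_digit (b : bool) (u : I) : I := mkI ((b%:R + val u) / 2).

Lemma val_cons_digit b u : val (cons_digit b u) = (b%:R + val u) / 2.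
Proof.
by rewrite /cons_digit val_mkI//; have := val_ge0 u; have := val_le1 u; case: b => /=; lra.
Qed.

Lemma val_tl_digits u : val (tl_digits u) = 2 * val u - (hd_digit u)%:R.
Proof.
rewrite /tl_digits val_mkI// /hd_digit; have := val_ge0 u; have := val_le1 u.
by case: (lerP 2^-1 (val u)) => /=; lra.
Qed.

Lemma cons_hd_tl u : cons_digit (hd_digit u) (tl_digits u) = u.
Proof.
by apply: unit_itv_val_inj; rewrite val_cons_digit val_tl_digits addrC subrK mulrAC divff ?mul1r.
Qed.

Lemma hd_cons_digit b u : val u < 1 -> hd_digit (cons_digit b u) = b.
Proof.
move=> u1; rewrite /hd_digit val_cons_digit; have := val_ge0 u.
case: b => /= u0; first by apply/idP; lra.
by apply/negbTE; rewrite -ltNge; lra.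
Qed.

Lemma tl_cons_digit b u : val u < 1 -> tl_digits (cons_digit b u) = u.
Proof.
move=> u1; apply: unit_itv_val_inj; rewrite val_tl_digits hd_cons_digit// val_cons_digit; lra.
Qed.

Lemma tl_digits_lt1 u : val u < 1 -> val (tl_digits u) < 1.
Proof. by rewrite val_tl_digits /hd_digit; case: (lerP 2^-1 (val u)) => /=; lra. Qed.

Lemma measurable_hd_digit : measurable_fun setT hd_digit.
Proof.
apply: (measurable_fun_bool true); rewrite setTI.
have -> : hd_digit @^-1` [set true] = ~` lt_set 2^-1.
  apply/seteqP; split => u; rewrite /hd_digit/= /lt_set/=.
    by move=> h; apply/negP; rewrite -leNgt.
  by move/negP; rewrite -leNgt.
by apply: measurableC; exact: measurable_lt_set.
Qed.

Lemma measurable_bool_natr d (Y : measurableType d) (c : Y -> bool) :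
  measurable_fun setT c -> measurable_fun setT (fun y => (c y)%:R : R).
Proof.
move=> mc; apply: (eq_measurable_fun (fun y => if c y then 1 else 0 : R)).
  by move=> y _; case: (c y).
by apply: measurable_fun_ifT.
Qed.

Lemma measurable_tl_digits : measurable_fun setT tl_digits.
Proof.
apply: (measurableT_comp measurable_mkI); apply: measurable_funB.
  by apply: measurable_funM => //; exact: measurable_val.
exact: measurable_bool_natr measurable_hd_digit.
Qed.

Lemma measurable_cons_digit : measurable_fun setT (fun p : bool * I => cons_digit p.1 p.2).
Proof.
apply: (measurableT_comp measurable_mkI); apply: measurable_funM => //.
apply: measurable_funD.
  by apply: measurable_bool_natr; exact: measurable_fst.
exact: (measurableT_comp measurable_val measurable_snd).
Qed.

Lemma clip_half : clip 2^-1 = 2^-1 :> R.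
Proof. by case: (clip_cases (2^-1 : R)) => -[h1 ->]; lra. Qed.

Lemma clip_min_half (c : R) : clip (Num.min 2^-1 (c / 2)) = clip c / 2.
Proof.
case: (lerP 2^-1 (c / 2)) => h; first by rewrite clip_half; case: (clip_cases c) => -[h1 ->]; lra.
by case: (clip_cases c) => -[h1 ->]; case: (clip_cases (c / 2)) => -[h2 ->]; lra.
Qed.

Lemma clip_max_half (c : R) :
  clip (Num.max 2^-1 ((c + 1) / 2)) = 2^-1 + clip c / 2.
Proof.
case: (lerP 2^-1 ((c + 1) / 2)) => h; last first.
  by rewrite clip_half; case: (clip_cases c) => -[h1 ->]; lra.
by case: (clip_cases c) => -[h1 ->]; case: (clip_cases ((c + 1) / 2)) => -[h2 ->]; lra.
Qed.

Lemma set_bool_cases (A : set bool) :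
  [\/ A = set0, A = setT, A = [set true] | A = [set false]].
Proof.
have [t|t] := pselect (A true); have [f|f] := pselect (A false).
- by apply: Or42; apply/seteqP; split => -[].
- by apply: Or43; apply/seteqP; split => -[].
- by apply: Or44; apply/seteqP; split => -[].
- by apply: Or41; apply/seteqP; split => -[].
Qed.

(** The points with a given first digit form a half of the interval, on which
    tl_digits is affine of slope 2. *)
Lemma mpres_hd_tl : mpres lambda (kappa \x lambda)%E (fun u => (hd_digit u, tl_digits u)).
Proof.
have mf : measurable_fun setT (fun u => (hd_digit u, tl_digits u)).
  by apply: measurable_fun_pair; [exact: measurable_hd_digit|exact: measurable_tl_digits].
have mlt c := @measurable_lt_set R c.
have half b c : prob lambda ((fun u => (hd_digit u, tl_digits u)) @^-1` ([set b] `*` lt_set c)) =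
    clip c / 2.
  case: b.
    have -> : (fun u => (hd_digit u, tl_digits u)) @^-1` ([set true] `*` lt_set c) =
        lt_set (Num.max 2^-1 ((c + 1) / 2)) `\` lt_set 2^-1.
      apply/seteqP; split => u; rewrite /hd_digit /lt_set/=.
        case=> h1; rewrite val_tl_digits /hd_digit h1 lt_max => h2; split.
          by apply/orP; right; move: h2 => /=; lra.
        by apply/negP; rewrite -leNgt.
      case=> + /negP; rewrite -leNgt lt_max => + h1.
      by rewrite val_tl_digits /hd_digit h1 ltNge h1/= => h2; split => //; move: h2; lra.
    have := @prob_U _ _ _ lambda (lt_set 2^-1)
      (lt_set (Num.max 2^-1 ((c + 1) / 2)) `\` lt_set 2^-1) (mlt _)
      (measurableD (mlt _) (mlt _)) (setDIK _ _).
    rewrite setDUK; last by move=> u; rewrite /lt_set/= lt_max => ->.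
    rewrite !prob_lt_set => h.
    by move: h; rewrite clip_max_half clip_half => /addrI.
  have -> : (fun u => (hd_digit u, tl_digits u)) @^-1` ([set false] `*` lt_set c) =
      lt_set (Num.min 2^-1 (c / 2)).
    apply/seteqP; split => u; rewrite /hd_digit /lt_set/=.
      by case=> h1; rewrite val_tl_digits /hd_digit h1 lt_min/= subr0 ltNge h1/=; lra.
    rewrite lt_min => /andP[h1 h2]; have h3 : (2^-1 <= val u) = false.
      by apply/negbTE; rewrite -ltNge.
    by rewrite h3; split => //; rewrite val_tl_digits /hd_digit h3/=; lra.
  by rewrite prob_lt_set clip_min_half.
apply: (mpres_gen (G := @strips R _ bool)) => //; [exact: strips_gen|exact: stripsI|].
move=> _ [A mA [c _ <-]].
have mAc : measurable (A `*` lt_set c) by exact: measurableX.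
have mP : measurable ((fun u => (hd_digit u, tl_digits u)) @^-1` (A `*` lt_set c)).
  exact: measurable_preimage.
have mb b : measurable ((fun u => (hd_digit u, tl_digits u)) @^-1` ([set b] `*` lt_set c)).
  by apply: measurable_preimage => //; exact: measurableX.
apply: etrans (esym (probK _ mP)) _; apply: etrans (esym (prodE kappa lambda mA (mlt c))).
have -> : (kappa A * lambda (lt_set c) = (prob kappa A * clip c)%:E)%E.
  by rewrite EFinM -prob_lt_set !probK.
congr EFin; case: (set_bool_cases A) => ->.
- by rewrite set0X preimage_set0 !prob0 mul0r.
- have -> : (fun u => (hd_digit u, tl_digits u)) @^-1` ([set: bool] `*` lt_set c) =
      (fun u => (hd_digit u, tl_digits u)) @^-1` ([set true] `*` lt_set c) `|`
      (fun u => (hd_digit u, tl_digits u)) @^-1` ([set false] `*` lt_set c).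
    apply/seteqP; split => u /=; last by case=> -[_].
    by case=> _ h; case: (hd_digit u); [left|right].
  rewrite prob_U// ?half ?probT; first by lra.
  by apply/seteqP; split => u //= [[-> _] []].
- by rewrite half prob_coin mulrC.
- by rewrite half prob_coin mulrC.
Qed.

Lemma countably_separated_bool : countably_separated bool.
Proof.
exists (fun=> [set true]) => // x y h; have := h 0%N.
by case: x y {h} => -[] //= [h1 h2]; [have := h1 erefl|have := h2 erefl].
Qed.

Lemma mod0_inverse_hd_tl : mod0_inverse lambda (kappa \x lambda)%E
  (fun u => (hd_digit u, tl_digits u)) (fun p => cons_digit p.1 p.2).
Proof.
apply: mod0_inverse_left.
- exact: countably_separated_prod countably_separated_bool countably_separated_I.
- exact: mpres_hd_tl.
- exact: measurable_cons_digit.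
- by apply: aeW => u; exact: cons_hd_tl.
Qed.

Lemma ae_lt1 : {ae lambda, forall u, val u < 1}.
Proof.
have h : {ae lambda, forall u, ~ (~` lt_set 1) u}.
  apply/ae_prob0; first by apply: measurableC; exact: measurable_lt_set.
  rewrite prob_C; last exact: measurable_lt_set.
  by rewrite prob_lt_set; case: (clip_cases (1 : R)) => -[h ->]; lra.
by apply: filterS h => u; rewrite /lt_set/= notK.
Qed.

End binary_digits.

Section coding.
Context {R : realType} d (Y : measurableType d) (rho : probability Y R).
Local Notation I := (I01 R).
Local Notation val := (@unit_itv_val R).
Local Notation lambda := (@lebesgue_I01 R).
Local Notation kappa := (bernoulli_prob (2^-1 : R)).
Variables (c : Y -> bool) (sigma : Y -> Y).
Hypotheses (mc : measurable_fun setT c) (msigma : measurable_fun setT sigma).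

Fixpoint expansion_approx n (y : Y) : I :=
  if n is m.+1 then cons_digit (c y) (expansion_approx m (sigma y)) else mkI 0.

Lemma measurable_expansion_approx n : measurable_fun setT (expansion_approx n).
Proof.
elim: n => [|n IH] /=; first exact: measurable_cst.
have mp : measurable_fun setT (fun y => (c y, expansion_approx n (sigma y))).
  by apply: measurable_fun_pair => //; exact: measurableT_comp.
exact: (measurableT_comp measurable_cons_digit mp).
Qed.

Lemma expansion_approx_mono n y : val (expansion_approx n y) <= val (expansion_approx n.+1 y).
Proof.
elim: n y => [|n IH] y; first by rewrite [X in X <= _]val_mkI ?lexx ?ler01// val_ge0.
change (val (cons_digit (c y) (expansion_approx n (sigma y))) <=
  val (cons_digit (c y) (expansion_approx n.+1 (sigma y)))).
by rewrite 2!val_cons_digit ler_wpM2r// lerD2l; exact: IH.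
Qed.

(** The point with digits c y, c (sigma y), c (sigma (sigma y)), and so on. *)
Definition expansion y : I := mkI (limn (fun n => val (expansion_approx n y))).

Lemma cvg_expansion y : val (expansion_approx n y) @[n --> \oo] --> val (expansion y).
Proof.
have nd : nondecreasing_seq (fun n => val (expansion_approx n y)).
  by apply/nondecreasing_seqP => n; exact: expansion_approx_mono.
have cv : cvgn (fun n => val (expansion_approx n y)).
  by apply: nondecreasing_is_cvgn => //; exists 1 => _ [n _ <-]; exact: val_le1.
rewrite /expansion val_mkI//; apply/andP; split.
  by apply: limr_ge => //; apply: nearW => n; exact: val_ge0.
by apply: limr_le => //; apply: nearW => n; exact: val_le1.
Qed.

Lemma measurable_expansion : measurable_fun setT expansion.
Proof.
apply: measurable_toI; apply: (measurable_fun_cvg (h := fun n y => val (expansion_approx n y))).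
  by move=> n; exact: (measurableT_comp measurable_val (measurable_expansion_approx n)).
by move=> y _; exact: cvg_expansion.
Qed.

Lemma expansionE y : expansion y = cons_digit (c y) (expansion (sigma y)).
Proof.
apply: unit_itv_val_inj; rewrite val_cons_digit.
pose g n := ((c y)%:R + val (expansion_approx n (sigma y))) / 2.
have ge : (fun n => val (expansion_approx n.+1 y)) = g.
  by apply/funext => n; rewrite /g -val_cons_digit.
have h1 : g n @[n --> \oo] --> val (expansion y).
  rewrite -ge; have := @cvg_expansion y.
  by rewrite -(cvg_shiftS (fun n => val (expansion_approx n y))).
have h2 : g n @[n --> \oo] --> ((c y)%:R + val (expansion (sigma y))) / 2.
  apply: cvgM; last exact: cvg_cst.
  by apply: cvgD; [exact: cvg_cst|exact: cvg_expansion].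
by apply: (cvg_unique _ h1 h2); exact: norm_hausdorff.
Qed.

(** The distribution function F of the expansion is 0 below 0 and 1 above 1, and
    F x = (F (2 x) + F (2 x - 1)) / 2. These hold for clip too, and the equation halves the
    distance of two solutions. *)
Lemma mpres_expansion : mpres rho (kappa \x rho)%E (fun y => (c y, sigma y)) ->
  mpres rho lambda expansion.
Proof.
move=> [mcs csP].
pose F x := prob rho (expansion @^-1` lt_set x).
have mlt x : measurable (expansion @^-1` lt_set x).
  by apply: (measurable_preimage measurable_expansion); exact: measurable_lt_set.
have F0 x : x <= 0 -> F x = 0.
  move=> x0; rewrite /F (_ : _ @^-1` _ = set0) ?prob0//.
  by apply/seteqP; split => y //; rewrite /lt_set/=; have := val_ge0 (expansion y); lra.
have F1 x : 1 < x -> F x = 1.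
  move=> x1; rewrite /F (_ : _ @^-1` _ = setT) ?probT//.
  by apply/seteqP; split => y //; rewrite /lt_set/=; have := val_le1 (expansion y); lra.
have F01 x : 0 <= F x <= 1 by rewrite prob_ge0 prob_le1.
have half b A : measurable A ->
    prob rho ((fun y => (c y, sigma y)) @^-1` ([set b] `*` A)) = prob rho A / 2.
  move=> mA; rewrite (prob_mpres (conj mcs csP)); last exact: measurableX.
  have mb : measurable [set b] by [].
  apply: etrans (congr1 fine (prodE kappa rho mb mA)) _.
  rewrite fineM ?fin_num_measure// mulrC; congr (_ * _); exact: prob_coin.
have FE x : F x = F (2 * x) / 2 + F (2 * x - 1) / 2.
  rewrite /F -(half false _ (mlt (2 * x))) -(half true _ (mlt (2 * x - 1))) -prob_U.
  - congr prob; apply/seteqP; split => y; rewrite /lt_set/= (expansionE y) val_cons_digit.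
      by case: (c y) => /= h; [right|left]; split => //; lra.
    by case=> -[-> /=]; lra.
  - by apply: (measurable_preimage mcs); exact: measurableX.
  - by apply: (measurable_preimage mcs); exact: measurableX.
  - by apply/seteqP; split => y //= [[-> _] []].
have close n x : `|F x - clip x| <= 2^-1 ^+ n.
  elim: n x => [|n IH] x.
    rewrite expr0 ler_norml; have := F01 x.
    by case: (clip_cases x) => -[h ->]; lra.
  have IH1 := IH (2 * x); have IH2 := IH (2 * x - 1).
  rewrite FE exprS; have [x0|x0] := leP x 2^-1.
    rewrite (F0 (2 * x - 1)) ?mul0r ?addr0; last by lra.
    have -> : clip x = clip (2 * x) / 2.
      by case: (clip_cases x) => -[h ->]; case: (clip_cases (2 * x)) => -[h' ->]; lra.
    exact: ler_half_dist.
  rewrite (F1 (2 * x)); last by lra.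
  have -> : clip x = 2^-1 + clip (2 * x - 1) / 2.
    by case: (clip_cases x) => -[h ->]; case: (clip_cases (2 * x - 1)) => -[h' ->]; lra.
  rewrite mul1r opprD addrACA subrr add0r; exact: ler_half_dist.
apply: mpres_I => [|x x01]; first exact: measurable_expansion.
rewrite -probK//; congr EFin; rewrite -/(F x).
have {2}-> : x = clip x by rewrite -val_mkI_clip val_mkI.
apply/eqP; rewrite -subr_eq0 -normr_le0; apply/ler_addgt0Pr => e e0; rewrite add0r.
have [N /(_ N (leqnn N))/ltW] := half_exp_small e0; apply: le_trans.
exact: close.
Qed.

End coding.

Definition lswap (Y Z W : Type) (p : Y * (Z * W)) : Z * (Y * W) :=
  (p.2.1, (p.1, p.2.2)).

Lemma mod0_inverse_lswap (R : realType) d1 d2 d3 (Y : measurableType d1)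
    (Z : measurableType d2) (W : measurableType d3) (nu : probability Y R)
    (rho : probability Z R) (tau : probability W R) :
  mod0_inverse (nu \x (rho \x tau))%E (rho \x (nu \x tau))%E
    (@lswap Y Z W) (@lswap Z Y W).
Proof.
have h1 := mod0_inverse_sym (mod0_inverse_assoc nu rho tau).
have h2 := mod0_inverse_fprod_map (mod0_inverse_swap nu rho) (mod0_inverse_id tau).
have h3 := mod0_inverse_assoc rho nu tau.
exact: mod0_inverse_comp (mod0_inverse_comp h1 h2) h3.
Qed.

Section cube_isomorphisms.
Context {R : realType}.
Local Notation I := (I01 R).
Local Notation val := (@unit_itv_val R).
Local Notation lambda := (@lebesgue_I01 R).
Local Notation kappa := (bernoulli_prob (2^-1 : R)).
Local Notation lambda2 := (lambda \x lambda)%E.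

(** The digits of u and v, interleaved. *)
Definition interleave : I * I -> I :=
  expansion (fun p => hd_digit p.1) (fun p => (p.2, tl_digits p.1)).

(** The digits of u with even index. *)
Definition evens : I -> I := expansion hd_digit (tl_digits \o tl_digits).

Definition deal (u : I) : I * I := (evens u, evens (tl_digits u)).

Lemma interleaveE u v : interleave (u, v) = cons_digit (hd_digit u) (interleave (v, tl_digits u)).
Proof. exact: expansionE. Qed.

Lemma evensE u : evens u = cons_digit (hd_digit u) (evens (tl_digits (tl_digits u))).
Proof. exact: expansionE. Qed.

Let mbit1 : measurable_fun setT (fun p : I * I => hd_digit p.1).
Proof. exact: (measurableT_comp measurable_hd_digit measurable_fst). Qed.

Let mshift : measurable_fun setT (fun p : I * I => (p.2, tl_digits p.1)).
Proof.
apply: measurable_fun_pair; first exact: measurable_snd.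
exact: (measurableT_comp measurable_tl_digits measurable_fst).
Qed.

Lemma mpres_interleave : mpres lambda2 lambda interleave.
Proof.
apply: mpres_expansion => //.
have h1 := mpres_fprod_map mpres_hd_tl (mpres_id lambda).
have h2 := mpres_assoc kappa lambda lambda.
have [h3 _ _ _] := mod0_inverse_swap lambda lambda.
have h4 := mpres_fprod_map (mpres_id kappa) h3.
exact: mpres_comp (mpres_comp h1 h2) h4.
Qed.

Lemma measurable_evens : measurable_fun setT evens.
Proof.
apply: measurable_expansion; first exact: measurable_hd_digit.
exact: (measurableT_comp measurable_tl_digits measurable_tl_digits).
Qed.

Lemma measurable_deal : measurable_fun setT deal.
Proof.
apply: measurable_fun_pair; first exact: measurable_evens.
exact: (measurableT_comp measurable_evens measurable_tl_digits).
Qed.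

Let cons_digit_eq1 b u : val (cons_digit b u) = 1 -> b = true /\ val u = 1.
Proof.
by rewrite val_cons_digit; have := val_le1 u; have := val_ge0 u; case: b => /=; split => //; lra.
Qed.

(** A point less than 1 has infinitely many digits 0. *)
Lemma interleave_lt1 u v : val u < 1 -> val (interleave (u, v)) < 1.
Proof.
move=> u1; rewrite lt_neqAle val_le1 andbT; apply/eqP => h.
have close n : forall u v, val (interleave (u, v)) = 1 -> 1 - val u <= 2^-1 ^+ n.
  elim: n => [|n IH] {u1 h}u {}v h; first by rewrite expr0; have := val_ge0 u; lra.
  move: h; rewrite interleaveE => /cons_digit_eq1[bu].
  rewrite interleaveE => /cons_digit_eq1[_ /IH].
  by rewrite val_tl_digits bu exprS /=; lra.
have u0 : 0 < 1 - val u by rewrite subr_gt0.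
have [N /(_ N (leqnn N)) hN] := half_exp_small u0.
by have := le_lt_trans (close N _ _ h) hN; rewrite ltxx.
Qed.

Lemma tl_interleave u v : val u < 1 -> val v < 1 ->
  tl_digits (interleave (u, v)) = interleave (v, tl_digits u).
Proof. by move=> u1 v1; rewrite interleaveE tl_cons_digit//; exact: interleave_lt1. Qed.

(** Both points have the same first n digits, for every n. *)
Lemma evens_interleave u v : val u < 1 -> val v < 1 -> evens (interleave (u, v)) = u.
Proof.
move=> u1 v1; apply: unit_itv_val_inj; apply/eqP.
rewrite -subr_eq0 -normr_le0; apply/ler_addgt0Pr => e e0; rewrite add0r.
have close n : forall u v, val u < 1 -> val v < 1 ->
    `|val (evens (interleave (u, v))) - val u| <= 2^-1 ^+ n.
  elim: n => [|n IH] {u1}u {v1}v u1 v1.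
    rewrite expr0 ler_norml; have := val_ge0 u; have := val_le1 u.
    by have := val_ge0 (evens (interleave (u, v)));
      have := val_le1 (evens (interleave (u, v))); lra.
  have Du := tl_digits_lt1 u1; have Dv := tl_digits_lt1 v1.
  rewrite evensE tl_interleave// tl_interleave// interleaveE.
  rewrite hd_cons_digit; last exact: interleave_lt1.
  rewrite -[X in _ - val X](cons_hd_tl u) !val_cons_digit exprS.
  by apply: ler_half_dist; rewrite opprD addrACA subrr add0r; exact: IH.
have [N /(_ N (leqnn N))/ltW] := half_exp_small e0; apply: le_trans.
exact: close.
Qed.

Lemma mod0_inverse_interleave : mod0_inverse lambda2 lambda interleave deal.
Proof.
apply: mod0_inverse_left.
- exact: countably_separated_I.
- exact: mpres_interleave.
- exact: measurable_deal.
have h1 := mpres_ae (mpres_fst lambda lambda) ae_lt1.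
have h2 := mpres_ae (mpres_snd lambda lambda) ae_lt1.
apply: filterS2 h1 h2 => -[u v] /= u1 v1.
by rewrite /deal evens_interleave// tl_interleave// evens_interleave// tl_digits_lt1.
Qed.

(** theta p packs a point u and a pair into one point that has the same first p
    digits as u. *)
Fixpoint theta p : I * (I * I) -> I :=
  if p is p'.+1 then fun q => cons_digit (hd_digit q.1) (theta p' (tl_digits q.1, q.2))
  else fun q => interleave (q.1, interleave q.2).

Lemma mod0_inverse_theta p : exists g, mod0_inverse (lambda \x lambda2)%E lambda (theta p) g.
Proof.
elim: p => [|p [g IH]].
  have h := mod0_inverse_interleave.
  have h1 := mod0_inverse_fprod_map (mod0_inverse_id lambda) h.
  by eexists; exact: mod0_inverse_comp h1 h.
have h0 := mod0_inverse_hd_tl (R := R).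
have h1 := mod0_inverse_fprod_map h0 (mod0_inverse_id lambda2).
have h2 := mod0_inverse_assoc kappa lambda lambda2.
have h3 := mod0_inverse_fprod_map (mod0_inverse_id kappa) IH.
have h4 := mod0_inverse_sym h0.
by eexists; exact: mod0_inverse_comp (mod0_inverse_comp (mod0_inverse_comp h1 h2) h3) h4.
Qed.

Lemma theta_close p q : `|val (theta p q) - val q.1| <= 2^-1 ^+ p.
Proof.
elim: p q => [|p IH] q.
  rewrite expr0 ler_norml; have := val_ge0 q.1; have := val_le1 q.1.
  by have := val_ge0 (theta 0 q); have := val_le1 (theta 0 q); lra.
rewrite -[X in _ - val X](cons_hd_tl q.1) /= !val_cons_digit exprS.
apply: ler_half_dist; rewrite opprD addrACA subrr add0r.
exact: (IH (tl_digits q.1, q.2)).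
Qed.

(** The lower half is read off from the first digit, which theta p.+1 keeps. *)
Lemma theta_lower p : {ae (lambda \x lambda2)%E, forall q,
  lt_set 2^-1 (theta p.+1 q) <-> lt_set 2^-1 q.1}.
Proof.
have [g [h _ _ _]] := mod0_inverse_theta p.
have md : mpres lambda lambda tl_digits.
  exact: mpres_comp mpres_hd_tl (mpres_snd kappa lambda).
have := mpres_ae (mpres_comp (mpres_fprod_map md (mpres_id lambda2)) h) ae_lt1.
apply: filterS => q /=; rewrite /fprod_map/= => h1.
rewrite /lt_set/= val_cons_digit; rewrite /hd_digit; have := val_ge0 (theta p (tl_digits q.1, q.2)).
move: h1; move: (val (theta _ _)) => x.
by case: (lerP 2^-1 (val q.1)) => /= h2 h3 h4; split; lra.
Qed.

(** Take a fresh point from the reservoir r, and put the used one, u, on the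
    stack s. *)
Definition refresh (q : I * (I * I)) : I * (I * I) :=
  (evens q.2.1, (evens (tl_digits q.2.1), interleave (q.1, q.2.2))).

Lemma mod0_inverse_refresh :
  exists g, mod0_inverse (lambda \x lambda2)%E (lambda \x lambda2)%E refresh g.
Proof.
have h := mod0_inverse_interleave.
have h1 := mod0_inverse_lswap lambda lambda lambda.
have h2 := mod0_inverse_fprod_map (mod0_inverse_sym h) h.
have h3 := mod0_inverse_assoc lambda lambda lambda.
by eexists; exact: mod0_inverse_comp (mod0_inverse_comp h1 h2) h3.
Qed.

End cube_isomorphisms.

(** * Refreshing the fibre on visits to a small set *)

Section return_sets.
Context {R : realType} d (X : measurableType d) (mu : probability X R).
Variable T : X -> X.
Hypotheses (mT : mpres mu mu T) (eT : ergodic mu T) (naT : nonatomic mu).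

Let mTf : measurable_fun setT T. Proof. by case: mT. Qed.

Lemma small_sets n : exists A, [/\ measurable A, 0 < prob mu A & prob mu A <= 2^-1 ^+ n].
Proof.
elim: n => [|n [A [mA A0 An]]].
  by exists setT; rewrite probT expr0.
have [|B [mB BA B0 BA']] := naT mA; first by rewrite -probK// lte_fin.
rewrite -probK// lte_fin in B0; rewrite -!probK// lte_fin in BA'.
have mD : measurable (A `\` B) by exact: measurableD.
have e : prob mu A = prob mu B + prob mu (A `\` B).
  by rewrite -prob_U// ?setDUK// setDIK.
rewrite exprS; have [h|h] := lerP (prob mu B) (prob mu A / 2).
  by exists B; split => //; move: An h; lra.
by exists (A `\` B); split => //; move: An h e BA'; lra.
Qed.

(** By ergodicity almost every point visits A; add to A the few points that do
    not visit it soon. *)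
Lemma return_set (e : R) : 0 < e -> exists B L, [/\ measurable B, prob mu B < e, (0 < L)%N &
  forall x, exists2 i, (i < L)%N & B (iter i T x)].
Proof.
move=> e0; have e2 : 0 < e / 2 by rewrite divr_gt0.
have [n /(_ n (leqnn n)) hn] := half_exp_small e2.
have [A [mA A0 An]] := small_sets n.
pose F i := iter i T @^-1` A.
have mF i : measurable (F i) by apply: measurable_preimage => //; exact: measurable_iter.
pose C := \bigcup_i F i.
have mC : measurable C by exact: bigcupT_measurable.
pose Cn k := iter k T @^-1` C.
have mCn k : measurable (Cn k) by apply: measurable_preimage => //; exact: measurable_iter.
have CnC k : Cn k `<=` C.
  by move=> x [i _ h]; exists (i + k)%N => //; rewrite /F/= iterD.
have CnS k : Cn k.+1 `<=` Cn k.
  by move=> x [i _ h]; exists i.+1 => //; move: h; rewrite /F/= -iterSr.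
pose C' := \bigcap_k Cn k.
have mC' : measurable C' by exact: bigcapT_measurable.
have TC' : T @^-1` C' = C'.
  apply/seteqP; split => x h k _; last by have := h k.+1 Logic.I; rewrite /Cn/= -iterS iterSr.
  by apply: CnS; have := h k Logic.I; rewrite /Cn/= -iterSr.
have C'C : prob mu C' = prob mu C.
  have h k : {ae mu, forall x, C x <-> Cn k x}.
    apply/sdist_ae => //.
    have -> : sdist mu C (Cn k) = prob mu (C `\` Cn k).
      by rewrite /sdist /setY (_ : Cn k `\` C = set0) ?setU0//; apply/seteqP; split => x // [/CnC].
    have := @prob_U _ _ _ mu (Cn k) (C `\` Cn k) (mCn k) (measurableD mC (mCn k)) (setDIK _ _).
    rewrite setDUK//; rewrite (prob_mpres (mpres_iter k mT))//.
    by move/eqP; rewrite -subr_eq0 opprD addrA subrr add0r oppr_eq0 => /eqP.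
  apply: (congr1 fine); apply: ae_eq_measure => //.
  have h' := ae_foralln h; apply: filterS h' => x hx; split => [/(_ 0%N Logic.I)//|Cx k _].
  exact/hx.
have C1 : prob mu C = 1.
  have [h|h] := eT mC' TC'; last by rewrite -C'C /prob h.
  have : prob mu A <= prob mu C by apply: le_prob => //; exact: (bigcup_sup (i := 0%N)).
  by rewrite -C'C /prob h /= leNgt A0.
have [N hN] := bigcup_approx mu mF e2.
pose G := \big[setU/set0]_(i < N) F i.
have mG : measurable G by exact: bigsetU_measurable.
exists (A `|` ~` G), N.+1; split => //.
- by apply: measurableU => //; exact: measurableC.
- apply: le_lt_trans (le_probU _ mA (measurableC mG)) _.
  have := ler_sdist mu mC mG; rewrite -/C -/G in hN *; rewrite C1 prob_C//.
  by move: hN An hn; lra.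
- move=> x; have [|nG] := pselect (G x); last by exists 0%N => //; right.
  by rewrite /G -bigcup_mkord => -[i /= iN Fx]; exists i; [exact: ltnW|left].
Qed.

End return_sets.

Section integrals.
Context {R : realType}.
Local Open Scope ereal_scope.

Lemma mpres_integral d1 d2 (Y : measurableType d1) (Z : measurableType d2)
    (nu : probability Y R) (rho : probability Z R) (phi : Y -> Z) (h : Z -> \bar R) :
  mpres nu rho phi -> measurable_fun setT h -> (forall z, 0 <= h z) ->
  \int[nu]_y h (phi y) = \int[rho]_z h z.
Proof.
move=> [mphi phiP] mh h0.
have := @ge0_integral_pushforward _ _ _ _ R phi mphi nu setT h measurableT mh (fun z _ => h0 z).
rewrite preimage_setT => <-; apply: eq_measure_integral => A mA _.
exact: phiP.
Qed.

Lemma integral_separated d1 d2 (Y : measurableType d1) (Z : measurableType d2)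
    (nu : probability Y R) (rho : probability Z R) (a : Y -> \bar R) (b : Z -> \bar R) :
  measurable_fun setT a -> measurable_fun setT b ->
  (forall y, 0 <= a y) -> (forall z, 0 <= b z) ->
  \int[nu \x rho]_p (a p.1 * b p.2) = (\int[nu]_y a y) * (\int[rho]_z b z).
Proof.
move=> ma mb a0 b0; rewrite fubini_tonelli1/=; last 2 first.
- apply: emeasurable_funM; first exact: (measurableT_comp ma measurable_fst).
  exact: (measurableT_comp mb measurable_snd).
- by move=> p; exact: mule_ge0.
rewrite /fubini_F; under eq_integral do rewrite /= ge0_integralZl//.
under eq_integral do rewrite muleC.
rewrite ge0_integralZl//; last by apply: integral_ge0.
exact: muleC.
Qed.

Lemma integral_probability_cst d (Y : measurableType d) (nu : probability Y R)
    (c : R) : \int[nu]_y c%:E = c%:E.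
Proof.
rewrite integral_cst//; apply: etrans (congr1 (mule c%:E) (probability_setT nu)) _.
exact: mule1.
Qed.

Lemma integral_prod_le d1 d2 (Y : measurableType d1) (Z : measurableType d2)
    (nu : probability Y R) (rho : probability Z R) (h : Y * Z -> \bar R) (c : R) :
  measurable_fun setT h -> (forall p, 0 <= h p) ->
  (forall y, \int[rho]_z h (y, z) <= c%:E) -> \int[nu \x rho]_p h p <= c%:E.
Proof.
move=> mh h0 hc; rewrite fubini_tonelli1//.
rewrite -(integral_probability_cst nu c); apply: ge0_le_integral => //.
- by move=> y _; exact: integral_ge0.
- exact: measurable_fun_fubini_tonelli_F.
- by move=> y _; exact: hc.
Qed.

(** Markov's inequality. *)
Lemma markov_integral d (Y : measurableType d) (nu : probability Y R)
    (N : set Y) (g : Y -> R) (a c : R) :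
  measurable N -> measurable_fun setT g -> (0 <= a)%R -> (forall y, 0 <= g y)%R ->
  (forall y, N y -> a <= g y)%R -> \int[nu]_y (g y)%:E <= c%:E ->
  (a * prob nu N <= c)%R.
Proof.
move=> mN mg a0 g0 Ng; rewrite -lee_fin; apply: le_trans.
rewrite EFinM probK//.
have -> : a%:E * nu N = \int[nu]_y (a%:E * (\1_N y)%:E).
  rewrite ge0_integralZl//; last by apply/measurable_EFinP; exact: measurable_indic.
  by rewrite integral_indic// setIT.
apply: ge0_le_integral => //.
- by move=> y _; rewrite -EFinM lee_fin mulr_ge0.
- by apply/measurable_EFinP; apply: measurable_funM => //; exact: measurable_indic.
- exact/measurable_EFinP.
move=> y _; rewrite -EFinM lee_fin indicE.
have [/set_mem yN|yN] := boolP (y \in N); last by rewrite mulr0.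
by rewrite mulr1; exact: Ng.
Qed.

End integrals.

Lemma mismatch_add (Y : Type) (F : Y -> Y) A w m n y :
  mismatch F A w (m + n) y =
  (mismatch F A w m y + mismatch F A (fun i => w (m + i)) n (iter m F y))%N.
Proof.
rewrite /mismatch big_split_ord/=; congr addn; apply: eq_bigr => i _.
by rewrite -iterD addnC.
Qed.

Section refreshed_names.
Context {R : realType} d (X : measurableType d) (mu : probability X R).
Local Notation I := (I01 R).
Local Notation val := (@unit_itv_val R).
Local Notation lambda := (@lebesgue_I01 R).
Local Notation lambda2 := (lambda \x lambda)%E.
Variables (T : X -> X) (f : X * I -> I) (B : set X) (L : nat).
Hypotheses (mT : measurable_fun setT T) (mf : measurable_fun setT f).
Hypothesis fp : forall x, mpres lambda lambda (fun u => f (x, u)).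
Hypotheses (mB : measurable B) (L0 : (0 < L)%N).
Hypothesis visits : forall x, exists2 i, (i < L)%N & B (iter i T x).

(** The current point is refreshed from the reservoir on each arrival in B. The
    stack, which has no influence on the names, is left out. *)
Definition refreshed (p : X * (I * I)) : X * (I * I) :=
  (T p.1, if T p.1 \in B then deal p.2.2 else (f (p.1, p.2.1), p.2.2)).

Definition low : set (X * (I * I)) := [set p | lt_set 2^-1 p.2.1].

Lemma measurable_refreshed : measurable_fun setT refreshed.
Proof.
have mT1 : measurable_fun setT (fun p : X * (I * I) => T p.1).
  exact: (measurableT_comp mT measurable_fst).
apply: measurable_fun_pair => //; apply: measurable_fun_if => //.
- exact: measurable_mem_preimage mT1 mB.
- apply: measurable_funTS; apply: (measurableT_comp measurable_deal).
  exact: (measurableT_comp measurable_snd measurable_snd).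
- apply: measurable_funTS; apply: measurable_fun_pair.
    apply: (measurableT_comp mf); apply: measurable_fun_pair; first exact: measurable_fst.
    exact: (measurableT_comp measurable_fst measurable_snd).
  exact: (measurableT_comp measurable_snd measurable_snd).
Qed.

Lemma measurable_low : measurable low.
Proof.
have m1 : measurable (fst @^-1` lt_set 2^-1 : set (I * I)).
  by apply: measurable_preimage; [exact: measurable_fst|exact: measurable_lt_set].
exact: (measurable_preimage (@measurable_snd _ _ X (I * I)%type) m1).
Qed.

(** The fibre coordinate after n steps without a visit of B. *)
Fixpoint fibre_iter n x (u : I) : I :=
  if n is m.+1 then f (iter m T x, fibre_iter m x u) else u.

Lemma mpres_fibre_iter n x : mpres lambda lambda (fibre_iter n x).
Proof.
elim: n => [|n IH] /=; first exact: mpres_id.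
exact: (mpres_comp IH (fp _)).
Qed.

Lemma iter_refreshed m x u r : (forall i, (0 < i <= m)%N -> ~ B (iter i T x)) ->
  iter m refreshed (x, (u, r)) = (iter m T x, (fibre_iter m x u, r)).
Proof.
elim: m => // m IH h; rewrite iterS IH => [|i /andP[i0 im]]; last first.
  by apply: h; rewrite i0 ltnW.
rewrite /refreshed/= memNset//; have := h m.+1; apply; exact: leqnn.
Qed.

Lemma iter_refreshed_visit m x u r : (forall i, (0 < i <= m)%N -> ~ B (iter i T x)) ->
  B (iter m.+1 T x) -> iter m.+1 refreshed (x, (u, r)) = (iter m.+1 T x, deal r).
Proof.
by move=> h Bm; rewrite iterS iter_refreshed// /refreshed/= mem_set.
Qed.

Let s : R := L%:R^-1.

Let s0 : 0 < s.
Proof. by rewrite invr_gt0 ltr0n. Qed.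

(** From exp x >= 1 + x. *)
Let expN_le (x : R) : 0 <= x <= 1 -> expR (- x) <= 1 - x / 2.
Proof.
case/andP=> x0 x1; rewrite expRN.
have h1 : (1 + x)^-1 <= 1 - x / 2.
  by rewrite -[X in X <= _]mul1r ler_pdivrMr; nra.
apply: le_trans h1; rewrite lef_pV2 ?posrE ?expR_gt0//; last by lra.
exact: expR_ge1Dx.
Qed.

Let mismatch_fibreE i x (w : nat -> bool) :
  [set u | (fibre_iter i x u \in lt_set 2^-1) != w i] =
  if w i then ~` (fibre_iter i x @^-1` lt_set 2^-1) else fibre_iter i x @^-1` lt_set 2^-1.
Proof.
case: (w i); apply/seteqP; split => u.
- by move=> /eqP h h'; apply: h; exact: mem_set.
- by move=> h; apply/eqP => /set_mem.
- have [/set_mem//|/negbTE h'] := boolP (fibre_iter i x u \in lt_set 2^-1).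
  by rewrite /mkset h'.
- move=> h; apply/eqP => h'.
  by have : fibre_iter i x u \in lt_set 2^-1 by [exact: mem_set]; rewrite h'.
Qed.

Let measurable_mismatch_fibre i x (w : nat -> bool) :
  measurable [set u | (fibre_iter i x u \in lt_set 2^-1) != w i].
Proof.
have mpre : measurable (fibre_iter i x @^-1` lt_set 2^-1).
  by apply: measurable_preimage; [case: (mpres_fibre_iter i x)|exact: measurable_lt_set].
by rewrite mismatch_fibreE; case: (w i) => //; exact: measurableC.
Qed.

(** Each fibre map preserves lambda, so that at each time the mismatch has
    probability 1/2, and the expected number of mismatches is m / 2. As m <= L and
    s = 1 / L, the exponent lies in [0, 1], where expN_le makes the exponential
    linear: the integral is at most 1 - s m / 4. *)
Let segment_integral x m (w : nat -> bool) : (m <= L)%N ->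
  (\int[lambda]_u (expR (- (s * \sum_(i < m)
     \1_[set u | (fibre_iter i x u \in lt_set 2^-1) != w i] u)))%:E
   <= (expR (- (s * m%:R / 4)))%:E)%E.
Proof.
move=> mL; pose D i := [set u : I | (fibre_iter i x u \in lt_set 2^-1) != w i].
have mD i : measurable (D i) by exact: measurable_mismatch_fibre.
have D_E i : D i = if w i then ~` (fibre_iter i x @^-1` lt_set 2^-1)
    else fibre_iter i x @^-1` lt_set 2^-1 by exact: mismatch_fibreE.
have mpre i : measurable (fibre_iter i x @^-1` lt_set 2^-1).
  by apply: measurable_preimage; [case: (mpres_fibre_iter i x)|exact: measurable_lt_set].
have mlt : measurable (@lt_set R 2^-1) by exact: measurable_lt_set.
have pD i : prob lambda (D i) = 2^-1.
  have h : prob lambda (fibre_iter i x @^-1` lt_set 2^-1) = 2^-1.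
    by rewrite (prob_mpres (mpres_fibre_iter i x))// prob_lt_set clip_half.
  rewrite D_E; case: (w i) => //; rewrite prob_C// h; lra.
have Sle u : 0 <= s * \sum_(i < m) \1_(D i) u <= 1.
  apply/andP; split; first by apply: mulr_ge0; [exact: ltW|exact: sumr_ge0].
  rewrite mulrC ler_pdivrMr ?ltr0n// mul1r.
  have : \sum_(i < m) \1_(D i) u <= \sum_(i < m) (1 : R).
    by apply: ler_sum => i _; rewrite indicE; case: (_ \in _).
  by move/le_trans; apply; rewrite sumr_const card_ord ler_nat.
have mS : measurable_fun setT (fun u => s * \sum_(i < m) \1_(D i) u).
  by apply: measurable_funM => //; apply: measurable_sum => i; exact: measurable_indic.
have h1 : (\int[lambda]_u (expR (- (s * \sum_(i < m) \1_(D i) u)))%:E <=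
    \int[lambda]_u (1 - (s * \sum_(i < m) \1_(D i) u) / 2)%:E)%E.
  apply: ge0_le_integral => //.
  - apply/measurable_EFinP; apply: measurableT_comp => //.
    by apply: measurableT_comp.
  - by apply/measurable_EFinP; apply: measurable_funB => //; apply: measurable_funM.
  - by move=> u _; rewrite lee_fin expN_le.
apply: le_trans h1 _.
have iD i : (\int[lambda]_u (\1_(D i) u)%:E = (2^-1 : R)%:E)%E.
  rewrite integral_indic// setIT; apply: etrans (esym (probK lambda (mD i))) _.
  by rewrite pD.
have intS : (\int[lambda]_u ((s * \sum_(i < m) \1_(D i) u) / 2)%:E = (s * m%:R / 4)%:E)%E.
  transitivity (\int[lambda]_u ((s / 2)%:E * \sum_(i < m) (\1_(D i) u)%:E))%E.
    by apply: eq_integral => u _; rewrite sumEFin -EFinM mulrAC.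
  rewrite ge0_integralZl//; last 3 first.
  - apply: (eq_measurable_fun (fun u => (\sum_(i < m) \1_(D i) u)%:E)).
      by move=> u _; rewrite sumEFin.
    by apply/measurable_EFinP; apply: measurable_sum => i; exact: measurable_indic.
  - by move=> u _; apply: sume_ge0.
  - by rewrite lee_fin divr_ge0// ltW.
  rewrite ge0_integral_sum//; last first.
    by move=> i; apply/measurable_EFinP; exact: measurable_indic.
  under eq_bigr => i _ do rewrite iD.
  rewrite sumEFin -EFinM sumr_const card_ord; congr EFin.
  by rewrite -mulr_natl; field.
have int1 : (\int[lambda]_u (1 - (s * \sum_(i < m) \1_(D i) u) / 2)%:E +
    (s * m%:R / 4)%:E = 1)%E.
  rewrite -intS -ge0_integralD//.
  - under eq_integral do rewrite -EFinD subrK.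
    by rewrite integral_probability_cst.
  - by move=> u _; rewrite lee_fin; have := Sle u; lra.
  - by apply/measurable_EFinP; apply: measurable_funB => //; apply: measurable_funM.
  - by move=> u _; rewrite lee_fin; have := Sle u; lra.
  - by apply/measurable_EFinP; apply: measurable_funM.
have -> : (\int[lambda]_u (1 - (s * \sum_(i < m) \1_(D i) u) / 2)%:E =
    (1 - s * m%:R / 4)%:E)%E.
  by rewrite EFinB -int1 addeK.
rewrite lee_fin; have := @expR_ge1Dx R (- (s * m%:R / 4)); lra.
Qed.

Let mmismatch w n : measurable_fun setT (fun p => (mismatch refreshed low w n p)%:R : R).
Proof.
apply: (eq_measurable_fun (fun p => \sum_(i < n) \1_(mismatch_at refreshed low w i) p : R)).
  by move=> p _; rewrite mismatchE.
apply: measurable_sum => i; apply: measurable_indic.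
by apply: measurable_mismatch_at; [exact: measurable_refreshed|exact: measurable_low].
Qed.

Let weight w n (p : X * (I * I)) : R := expR (- (s * (mismatch refreshed low w n p)%:R)).

Let measurable_weight w n : measurable_fun setT (weight w n).
Proof.
apply: measurableT_comp => //; apply: measurableT_comp => //.
by apply: measurable_funM => //; exact: mmismatch.
Qed.

Let weight0 w p : weight w 0 p = 1.
Proof. by rewrite /weight /mismatch big_ord0 mulr0 oppr0 expR0. Qed.

(** The end m of the first segment: a visit of B, or the time n. *)
Let first_return x n : (0 < n)%N -> exists m,
  [/\ (0 < m <= n)%N, (m <= L)%N, forall i, (0 < i < m)%N -> ~ B (iter i T x) &
      m = n \/ B (iter m T x)].
Proof.
move=> n0; have [i0 i0L Bi0] := visits (T x).
have exP : exists j, `[< B (iter j.+1 T x) >] by exists i0; apply/asboolP; rewrite iterSr.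
case: (ex_minnP exP) => j /asboolP Bj jmin.
have jL : (j < L)%N.
  by apply: leq_ltn_trans i0L; apply: jmin; apply/asboolP; rewrite iterSr.
have nB i : (0 < i <= j)%N -> ~ B (iter i T x).
  case: i => // i /= ij Bi; have := jmin i; rewrite leqNgt ij => /(_ _)/negP.
  by apply => //; exact/asboolP.
have [jn|nj] := leqP j.+1 n.
  by exists j.+1; split; [rewrite /= jn|exact: jL|exact: nB|right].
exists n; split; [by rewrite n0 leqnn|exact/ltnW/(leq_trans nj jL)| |by left].
by move=> i /andP[i0' im]; apply: nB; rewrite i0' -ltnS (leq_trans im)// ltnW.
Qed.

(** Induction over the visits of B: the segment of the name before the first
    visit is a function a of u, and the rest is a function b of deal r. As u and
    deal r are independent, the integral factors. *)
Lemma names_integral n x w :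
  (\int[lambda2]_q (weight w n (x, q))%:E <= (expR (- (s * n%:R / 4)))%:E)%E.
Proof.
elim/ltn_ind: n x w => n IH x w.
have [->|n0] := posnP n.
  under eq_integral do rewrite weight0.
  rewrite integral_probability_cst mulr0 mul0r oppr0 expR0; exact: lexx.
have [m [/andP[m0 mn] mL nB mend]] := first_return x n0.
pose k := (n - m)%N; have nE : n = (m + k)%N by rewrite subnKC.
pose w' i := w (m + i)%N.
pose a (u : I) : R := expR (- (s * \sum_(i < m)
     \1_[set u | (fibre_iter i x u \in lt_set 2^-1) != w i] u)).
pose b (q : I * I) : R := weight w' k (iter m T x, q).
have mw n' w1 x' : measurable_fun setT (fun q => weight w1 n' (x', q)).
  exact: (measurableT_comp (measurable_weight w1 n') (pair1_measurable x')).
have E q : weight w n (x, q) = a q.1 * b (deal q.2).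
  case: q => u r; rewrite /weight nE mismatch_add natrD mulrDr opprD expRD; congr (_ * _).
    congr expR; congr (- (_ * _)); rewrite natr_sum; apply: eq_bigr => i _.
    rewrite indicE iter_refreshed; last first.
      by move=> j /andP[j0 ji]; apply: nB; rewrite j0 (leq_ltn_trans ji).
    congr (_%:R); congr nat_of_bool; apply/idP/idP.
      move=> h; apply/mem_set; move: h; rewrite /mkset; apply: contra => /eqP <-.
      by apply/eqP; apply/idP/idP => /set_mem h; exact: mem_set.
    move=> /set_mem; rewrite /mkset; apply: contra => /eqP <-.
    by apply/eqP; apply/idP/idP => /set_mem h; exact: mem_set.
  rewrite /b /weight; congr expR; congr (- (_ * _%:R)).
  have [k0|k0] := posnP k; first by rewrite k0 /mismatch !big_ord0.
  case: mend => [mn'|Bm]; first by move: k0; rewrite /k mn' subnn.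
  have := @iter_refreshed_visit m.-1 x u r; rewrite prednK// => -> // i /andP[i0 im].
  by apply: nB; rewrite i0 -(prednK m0) ltnS.
have ma : measurable_fun setT a.
  apply: measurableT_comp => //; apply: measurableT_comp => //.
  apply: measurable_funM => //; apply: measurable_sum => i; apply: measurable_indic.
  exact: (measurable_mismatch_fibre i x w).
have mb : measurable_fun setT b by exact: mw.
under eq_integral do rewrite E EFinM.
rewrite (integral_separated lambda lambda (a := EFin \o a) (b := fun r => (b (deal r))%:E)).
- have -> : (\int[lambda]_z (b (deal z))%:E = \int[lambda2]_q (b q)%:E)%E.
    have [_ md _ _] := mod0_inverse_interleave (R := R).
    apply: (mpres_integral (h := EFin \o b) md) => [|q]; first exact/measurable_EFinP.
    by rewrite lee_fin expR_ge0.
  have -> : expR (- (s * n%:R / 4)) = expR (- (s * m%:R / 4)) * expR (- (s * k%:R / 4)).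
    by rewrite -expRD; congr expR; rewrite nE natrD; lra.
  rewrite EFinM; apply: lee_pmul.
  + by apply: integral_ge0 => u _; rewrite lee_fin expR_ge0.
  + by apply: integral_ge0 => u _; rewrite lee_fin expR_ge0.
  + exact: segment_integral.
  + by apply: IH; rewrite /k ltn_subrL m0.
- exact/measurable_EFinP.
- apply/measurable_EFinP; apply: (measurableT_comp mb); exact: measurable_deal.
- by move=> u; rewrite lee_fin expR_ge0.
- by move=> r; rewrite lee_fin expR_ge0.
Qed.

(** Chernoff's bound: on the ball the weight is at least exp (- s n / 8). *)
Lemma near_word_refreshed n w :
  prob (mu \x lambda2)%E (near_word refreshed low w n) <= expR (- (s * n%:R / 8)).
Proof.
have mN : measurable (near_word refreshed low w n).
  apply: (measurable_near_word (R := R)); [exact: measurable_refreshed|exact: measurable_low].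
have mwE : measurable_fun setT (EFin \o weight w n).
  by apply/measurable_EFinP; exact: measurable_weight.
have h1 : (\int[(mu \x lambda2)%E]_p (weight w n p)%:E <= (expR (- (s * n%:R / 4)))%:E)%E.
  apply: (@integral_prod_le _ _ _ X (I * I)%type mu lambda2 (EFin \o weight w n)).
  - exact: mwE.
  - by move=> p; rewrite lee_fin expR_ge0.
  - by move=> x; exact: names_integral.
have := markov_integral mN (measurable_weight w n) (expR_ge0 (- (s * n%:R / 8)))
  (fun p => expR_ge0 _) _ h1.
have h2 p : near_word refreshed low w n p -> expR (- (s * n%:R / 8)) <= weight w n p.
  move=> pN; rewrite ler_expR lerN2 -mulrA; apply: ler_wpM2l; first exact: ltW.
  by rewrite ler_pdivlMr// -natrM ler_nat mulnC.
move=> /(_ h2).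
have -> : expR (- (s * n%:R / 4)) = expR (- (s * n%:R / 8)) * expR (- (s * n%:R / 8)).
  by rewrite -expRD; congr expR; lra.
by rewrite ler_pM2l// expR_gt0.
Qed.

End refreshed_names.

(** * Density of the skew products with light balls *)

Section packing.
Context {R : realType} d (X : measurableType d) (mu : probability X R).
Local Notation I := (I01 R).
Local Notation val := (@unit_itv_val R).
Local Notation lambda := (@lebesgue_I01 R).
Local Notation nu := (mu \x lambda)%E.
Local Notation lambda2 := (lambda \x lambda)%E.
Local Notation M := (X * (I * (I * I)))%type.
Local Notation mm := (mu \x (lambda \x lambda2))%E.

(** The fibre of M consists of the current point, the reservoir and the stack.
    packed p is an isomorphism with X x I that moves the current point by at most
    2^-p; shadow forgets the reservoir and the stack. *)
Definition packed p : M -> X * I := fprod_map id (theta p).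

Definition shadow (z : M) : X * I := (z.1, z.2.1).

Lemma mod0_inverse_packed p : exists g, mod0_inverse mm nu (packed p) g.
Proof.
have [g hg] := mod0_inverse_theta (R := R) p.
by eexists; exact: mod0_inverse_fprod_map (mod0_inverse_id mu) hg.
Qed.

Lemma mpres_packed p : mpres mm nu (packed p).
Proof. by have [g [h _ _ _]] := mod0_inverse_packed p; exact: h. Qed.

Lemma mpres_shadow : mpres mm nu shadow.
Proof. exact: (mpres_fprod_map (mpres_id mu) (mpres_fst lambda lambda2)). Qed.

Lemma measurable_shadow : measurable_fun setT shadow.
Proof.
apply: measurable_fun_pair; first exact: measurable_fst.
exact: (measurableT_comp measurable_fst measurable_snd).
Qed.

Lemma packed_cvg A e : measurable A -> 0 < e -> exists N, forall p, (N <= p)%N ->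
  sdist mm (packed p @^-1` A) (shadow @^-1` A) < e.
Proof.
move=> mA e0.
have [||_ h] := weak_cvg_in_measure mpres_packed measurable_shadow.
- by [].
- move=> eta e' eta0 e'0.
  have [N hN] := half_exp_small eta0; exists N => k /hN hk.
  rewrite (_ : [set y | _] = set0) ?prob0 ?ltW//.
  apply/seteqP; split => // y /= hy.
  by have := le_lt_trans (le_trans hy (theta_close k y.2)) hk; rewrite ltxx.
- exact: h.
Qed.

Lemma packed_cvg_finite (AA : set (set (X * I))) e : finite_set AA ->
  AA `<=` measurable -> 0 < e -> \forall p \near \oo, forall A, AA A ->
  sdist mm (packed p @^-1` A) (shadow @^-1` A) < e.
Proof.
move=> finA mAA e0.
suff : \forall p \near \oo, (\bigcap_(A in AA)
    [set p | sdist mm (packed p @^-1` A) (shadow @^-1` A) < e]) p.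
  by apply: filterS => p h A AF; exact: h.
have /finite_fsetP[F FE] := finA; rewrite FE in mAA *.
apply: filter_bigI => A AF; have [N hN] := packed_cvg (mAA A AF) e0.
by exists N.
Qed.

End packing.
Arguments shadow {R d X} z.

Section density.
Context {R : realType} d (X : measurableType d) (mu : probability X R).
Variable T : X -> X.
Local Notation I := (I01 R).
Local Notation val := (@unit_itv_val R).
Local Notation lambda := (@lebesgue_I01 R).
Local Notation nu := (mu \x lambda)%E.
Local Notation lambda2 := (lambda \x lambda)%E.
Local Notation M := (X * (I * (I * I)))%type.
Local Notation mm := (mu \x (lambda \x lambda2))%E.
Local Notation K := (set_type (@skew_products R d X mu T)).
Hypothesis sX : countably_separated X.
Hypothesis hT : invertible_mpt mu T.

Let mT : measurable_fun setT T. Proof. by case: hT. Qed.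

(** Over a null set of fibres F may fail to preserve lambda. It is replaced by the
    identity there, because the estimate of names works fibre by fibre. *)
Lemma regular_version (F : K) : exists f : X * I -> I,
  [/\ measurable_fun setT f, forall x, mpres lambda lambda (fun u => f (x, u)),
     {ae nu, forall y, skew_val F y = (T y.1, f y)} &
     exists g, mod0_inverse nu nu (fun y => (T y.1, f y)) g].
Proof.
have [G [Fp Gp GF FG]] := MPT_inverse (skew_val F).
have F1 := skew_fst sX hT (set_mem (valP F)).
have [N [mN N0 hN]] := fibre_mpres hT Fp F1.
pose f y := if y.1 \in N then y.2 else (skew_val F y).2.
have mf : measurable_fun setT f.
  apply: measurable_fun_if => //.
  - exact: (measurable_mem_preimage (@measurable_fst _ _ X I) mN).
  - apply: measurable_funTS; exact: measurable_snd.
  - apply: measurable_funTS.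
    exact: (measurableT_comp measurable_snd (proj1 Fp)).
have fE : {ae nu, forall y, skew_val F y = (T y.1, f y)}.
  have hN' : {ae mu, forall x, ~ N x} by apply/(ae_prob0 mu mN); rewrite /prob N0.
  apply: filterS2 F1 (mpres_ae (mpres_fst mu lambda) hN') => y h1 h2.
  by rewrite /f memNset// -h1 -surjective_pairing.
have mF0 : measurable_fun setT (fun y : X * I => (T y.1, f y)).
  by apply: measurable_fun_pair mf; exact: (measurableT_comp mT measurable_fst).
exists f; split => //.
- move=> x; rewrite /f/=; have [xN|xN] := boolP (x \in N); first exact: mpres_id.
  by apply: contrapT => h; move/negP: xN; apply; apply: mem_set; exact: hN.
- exists G; apply: mod0_inverse_left.
  + by apply: countably_separated_prod => //; exact: countably_separated_I.
  + exact: mpres_ae_eq Fp mF0 fE.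
  + by case: Gp.
  + by apply: filterS2 fE GF => y <-.
Qed.

Section lift.
Variables (f : X * I -> I) (B : set X).
Hypotheses (mf : measurable_fun setT f) (mB : measurable B).

(** The skew product over T with fibre maps f, which refreshes on arrival in B. *)
Definition lifted (z : M) : M :=
  fibre_if B refresh (T z.1, (f (z.1, z.2.1), z.2.2)).

Lemma mod0_inverse_lifted g : mod0_inverse nu nu (fun y => (T y.1, f y)) g ->
  exists g', mod0_inverse mm mm lifted g'.
Proof.
move=> hg; have [r hr] := mod0_inverse_refresh (R := R).
have h1 := mod0_inverse_assoc mu lambda lambda2.
have h2 := mod0_inverse_fprod_map hg (mod0_inverse_id lambda2).
have h3 := mod0_inverse_comp (mod0_inverse_comp (mod0_inverse_sym h1) h2) h1.
have h4 := mod0_inverse_fibre_if mu mB hr.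
have h5 := mod0_inverse_comp h3 h4.
suff -> : lifted = fibre_if B refresh \o (@assoc X I (I * I)%type \o
    (fprod_map (fun y => (T y.1, f y)) id \o @unassoc X I (I * I)%type)).
  by eexists; exact: h5.
by [].
Qed.

Definition forget (z : M) : X * (I * I) := (z.1, (z.2.1, z.2.2.1)).

Lemma mpres_forget : mpres mm (mu \x lambda2)%E forget.
Proof.
have h := mpres_fprod_map (mpres_id lambda) (mpres_fst lambda lambda).
exact: (mpres_fprod_map (mpres_id mu) h).
Qed.

Lemma forget_lifted z : forget (lifted z) = refreshed T f B (forget z).
Proof. by rewrite /lifted /refreshed /forget /fibre_if/=; case: ifP. Qed.

End lift.
End density.

(** F' is a factor of L by P, and outside of D so is F by S. Upstairs the
    distance from F' to F is at most the distances of P from S, before and after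
    the step, and the measure of D. *)
Lemma factor_close (R : realType) d d' (Y : measurableType d) (M : measurableType d')
    (nu : probability Y R) (m : probability M R) (P S : M -> Y) (L : M -> M)
    (F F' : Y -> Y) (D : set M) (A : set Y) :
  mpres m nu P -> mpres m nu S -> mpres m m L -> mpres nu nu F -> mpres nu nu F' ->
  measurable D -> measurable A ->
  {ae m, forall z, F' (P z) = P (L z)} ->
  {ae m, forall z, ~ D z -> S (L z) = F (S z)} ->
  sdist nu (F' @^-1` A) (F @^-1` A) <=
    sdist m (P @^-1` A) (S @^-1` A) + prob m D +
    sdist m (P @^-1` (F @^-1` A)) (S @^-1` (F @^-1` A)).
Proof.
move=> mP mS mL mF mF' mD mA hP hS.
have mFA := mpres_preimage mF mA; have mF'A := mpres_preimage mF' mA.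
rewrite -(sdist_mpres mP) //.
have mPA := mpres_preimage mP mA; have mSA := mpres_preimage mS mA.
have mPF' := mpres_preimage mP mF'A; have mPF := mpres_preimage mP mFA.
have mLP := mpres_preimage mL mPA; have mLS := mpres_preimage mL mSA.
have mSF := mpres_preimage mS mFA.
apply: le_trans (sdist_triangle m mPF' mLP mPF) _.
rewrite [X in X + _ <= _](_ : _ = 0) ?add0r; last first.
  by apply/sdist_ae => //; apply: filterS hP => z /= ->.
apply: le_trans (sdist_triangle m mLP mLS mPF) _.
rewrite (sdist_mpres mL)// -addrA lerD2l.
apply: le_trans (sdist_triangle m mLS mSF mPF) _.
rewrite [X in _ + X <= _]sdistC lerD2r.
have mSFD := measurableD mSF mD; have mLSD := measurableD mLS mD.
have mSFI := measurableI _ _ mSF mD; have mLSI := measurableI _ _ mLS mD.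
have d0 : sdist m (L @^-1` (S @^-1` A) `\` D) (S @^-1` (F @^-1` A) `\` D) = 0.
  apply/sdist_ae => //; apply: filterS hS => z /= hz.
  by split => -[h nD]; split => //; move: h; rewrite hz.
rewrite -[X in sdist m X _](setUIDK _ D) -[X in sdist m _ X](setUIDK _ D).
apply: le_trans (le_sdistU m mLSI mLSD mSFI mSFD) _.
rewrite d0 addr0; apply: le_prob => //; first exact: measurable_setY.
by move=> z [[[_]]|[[_]]].
Qed.


Lemma three_quarters (R : realFieldType) (a b c e : R) :
  0 < e -> a < e / 4 -> b < e / 4 -> c < e / 4 -> a + b + c < e.
Proof. by lra. Qed.

Lemma entropy_bound (R : realFieldType) (H x : R) :
  H < x / 32 -> 32 <= x -> 2 * (H + 1) < x / 8.
Proof. by lra. Qed.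

Section density.
Context {R : realType} d (X : measurableType d) (mu : probability X R).
Variable T : X -> X.
Local Notation I := (I01 R).
Local Notation val := (@unit_itv_val R).
Local Notation lambda := (@lebesgue_I01 R).
Local Notation nu := (mu \x lambda)%E.
Local Notation lambda2 := (lambda \x lambda)%E.
Local Notation M := (X * (I * (I * I)))%type.
Local Notation mm := (mu \x (lambda \x lambda2))%E.
Local Notation K := (set_type (@skew_products R d X mu T)).
Hypothesis sX : countably_separated X.
Hypothesis hT : invertible_mpt mu T.

Let mT : measurable_fun setT T. Proof. by case: hT. Qed.

Section conjugates.
Variables (f : X * I -> I) (B : set X).
Hypotheses (mf : measurable_fun setT f) (mB : measurable B).
Hypothesis if0 : exists g, mod0_inverse nu nu (fun y => (T y.1, f y)) g.

Let mL : mpres mm mm (lifted T f B).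
Proof. by have [g /(mod0_inverse_lifted mB)[g' [h _ _ _]]] := if0; exact: h. Qed.

(** F' is lifted, transported to X x I by packed p. *)
Lemma lifted_conjugate p : exists F' : K,
  {ae mm, forall z, skew_val F' (packed p z) = packed p (lifted T f B z)}.
Proof.
have [g0 hg0] := if0; have [g hL] := mod0_inverse_lifted mB hg0.
have [q hP] := mod0_inverse_packed mu p.
have h := mod0_inverse_comp (mod0_inverse_comp (mod0_inverse_sym hP) hL) hP.
have [Pp qp qP Pq] := hP.
have [||F' hF'] := @skew_of_iso _ _ _ mu T hT (packed p \o (lifted T f B \o q)).
- by apply/mod0_inverseP; eexists; exact: h.
- apply: filterS Pq => y hy.
  have e : (packed p (q y)).1 = y.1 by exact: congr1 hy.
  by rewrite -e.
exists F'; have := mpres_ae Pp hF'; apply: filterS2 qP => z /= hz ->.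
by rewrite hz.
Qed.

Variables (F F' : K) (p : nat).
Hypothesis fE : {ae nu, forall y, skew_val F y = (T y.1, f y)}.
Hypothesis F'E : {ae mm, forall z, skew_val F' (packed p z) = packed p (lifted T f B z)}.

Let Pp : mpres mm nu (packed p).
Proof. exact: mpres_packed. Qed.

Lemma conjugate_close A : measurable A ->
  sdist nu (skew_val F' @^-1` A) (skew_val F @^-1` A) <=
  sdist mm (packed p @^-1` A) (shadow @^-1` A) + prob mu B +
  sdist mm (packed p @^-1` (skew_val F @^-1` A)) (shadow @^-1` (skew_val F @^-1` A)).
Proof.
move=> mA; have mTX := mpres_comp (mpres_fst mu (lambda \x lambda2)%E) (mod0_mpres hT).
rewrite -(prob_mpres mTX mB).
apply: (factor_close Pp (mpres_shadow mu) mL (MPT_mpres (skew_val F))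
  (MPT_mpres (skew_val F')) (mpres_preimage mTX mB) mA F'E).
apply: filterS (mpres_ae (mpres_shadow mu) fE) => z /= -> nB.
by rewrite /lifted /fibre_if/= memNset.
Qed.

Hypotheses (fp : forall x, mpres lambda lambda (fun u => f (x, u))).
Variable L : nat.
Hypotheses (L0 : (0 < L)%N) (visits : forall x, exists2 i, (i < L)%N & B (iter i T x)).

(** The names of F' are those of lifted, and do not depend on the stack. *)
Lemma light_balls w n : {ae mm, forall z, lower_half (shadow z) <-> lower_half (packed p z)} ->
  prob nu (near_word (skew_val F') (@lower_half R d X) w n) <= expR (- (L%:R^-1 * n%:R / 8)).
Proof.
move=> low_p; apply: le_trans (near_word_refreshed mu mT mf fp mB L0 visits n w).
have mlow := mpres_preimage (mpres_shadow mu) (measurable_lower_half (R := R) (X := X)).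
have F'E' : {ae mm, forall z, packed p (lifted T f B z) = skew_val F' (packed p z)}.
  by apply: ae_imply F'E => z ->.
have h := near_word_factor w n Pp mL (proj1 (MPT_mpres (skew_val F'))) mlow
  (@measurable_lower_half _ _ X) F'E' low_p.
rewrite -h.
have fE' : {ae mm, forall z, forget (lifted T f B z) = refreshed T f B (forget z)}.
  by apply: ae_always => z; exact: forget_lifted.
by rewrite (near_word_factor w n (mpres_forget mu) mL (measurable_refreshed mT mf mB)
    mlow (@measurable_low R d X) fE' (ae_always _ (fun z => iff_refl _))).
Qed.

End conjugates.
Lemma packed_lower p :
  {ae mm, forall z, lower_half (shadow z) <-> lower_half (packed p.+1 z)}.
Proof.
have h := mpres_ae (mpres_snd mu (lambda \x lambda2)%E) (theta_lower p).
by apply: ae_imply h => z [h1 h2]; split.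
Qed.

Hypotheses (eT : ergodic mu T) (naT : nonatomic mu) (h0 : entropy mu T = 0%E).
Variable U : nat -> set X.
Hypothesis mU : forall i, measurable (U i).

(** A large p brings the skew product F' of lifted_conjugate close to F; by
    light_balls its balls of time n have measure at most exp (- n / (8 L)), which
    is less than the threshold for large n because T has zero entropy. *)
Lemma dense_complex_at m : dense (complex_at (mu := mu) (T := T) U m).
Proof.
move=> O [F OF] oO.
have [AA [e [finA mAA e0 hAA]]] := open_skew_wball oO OF.
have [f [mf fp fE if0]] := regular_version sX hT (F : K).
have e4 : 0 < e / 4 by rewrite divr_gt0.
have mpT := mod0_mpres hT.
have [B [L [mB Be L0 visits]]] := return_set mpT eT naT e4.
have finA' : finite_set [set skew_val F @^-1` A | A in AA] by exact: finite_image.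
have mA' : [set skew_val F @^-1` A | A in AA] `<=` measurable.
  by move=> _ [A AAA <-]; apply: measurable_MPT_preimage; exact: mAA.
have [p _ hp] := filterI (packed_cvg_finite mu finA mAA e4)
  (packed_cvg_finite mu finA' mA' e4).
have [h1 h2] := hp p.+1 (leqnSn p).
have [F' F'E] := lifted_conjugate mB if0 p.+1.
exists F'; split.
  apply: hAA => A AAA.
  apply: le_lt_trans (conjugate_close mB if0 fE F'E (mAA A AAA)) _.
  have {}h1 := h1 A AAA; have {}h2 : sdist mm _ _ < _ := h2 _ (ex_intro2 _ _ A AAA erefl).
  exact: three_quarters e0 h1 Be h2.
have s0 : 0 < (L%:R^-1 : R) by rewrite invr_gt0 ltr0n.
have c0 : 0 < (L%:R^-1 / 32 : R) by rewrite divr_gt0.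
have [N hN] := zero_entropy_small (@finite_level_partition _ _ U mU m) h0 c0.
(* Now n / (32 L) exceeds both the entropy of the names at time n and 1. *)
pose n := maxn N (32 * L).
have n0 : (0 < n)%N by rewrite leq_max muln_gt0 L0 orbT.
exists n, (expR (- (L%:R^-1 * n%:R / 8))); split => //.
  have {}hN := hN n (leq_maxl _ _) n0.
  have nL : 32 <= L%:R^-1 * n%:R :> R.
    by rewrite mulrC ler_pdivlMr ?ltr0n// -natrM ler_nat leq_maxr.
  rewrite /ball_threshold ltr_expR ltrN2; move: hN nL.
  by rewrite mulrAC; exact: entropy_bound.
move=> w; exact: (light_balls mf mB if0 F'E fp L0 visits w n (packed_lower p)).
Qed.


End density.

(** * The theorem *)

Theorem theorem3p2 (R : realType) (d : measure_display) (X : measurableType d)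
    (mu : probability X R) (T : X -> X)
    (hX : standard_borel R X) (hT : invertible_mpt mu T) (hE : ergodic mu T)
    (hA : nonatomic mu) (h0 : entropy mu T = 0%E) :
  ~ dominant mu T.
Proof.
have [U [mU genU sepU]] := standard_borel_generated hX.
have sX : countably_separated X by exists U.
move=> [S0 [[V oV S0E] dS0 S0iso]].
have dV i : dense (V i).
  move=> O O0 oO; have [F [OF S0F]] := dS0 O O0 oO; exists F; split => //.
  by move: S0F; rewrite S0E; apply.
(* The sets V i and complex_at m in one sequence. *)
pose W i := if odd i then complex_at (mu := mu) (T := T) U i./2 else V i./2.
have [||F WF] := @skew_products_baire _ _ _ mu T sX hT W.
- by move=> i; rewrite /W; case: ifP => _ //; exact: open_complex_at.
- by move=> i; rewrite /W; case: ifP => _ //; exact: dense_complex_at.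
apply: (not_isomorphic mU genU hT (F := F)).
  by move=> m; have := WF m.*2.+1; rewrite /W /= odd_double uphalf_double.
apply: S0iso; rewrite S0E => i _.
by have := WF i.*2; rewrite /W odd_double doubleK.
Qed.
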